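(* Let $n\ge 1$, let $f:\mathbb{R}^n\to\mathbb{R}$ be a smooth convex function and let $M\subset\mathbb{E}^{n+1}$ be its graph $\{(x,f(x)) : x\in\mathbb{R}^n\}$. For $p=(x,f(x))\in M$ put $W(p)=\sqrt{1+|\nabla f(x)|^2}$, where $\nabla f$ is the gradient of $f$. For a real number $k>0$, let $\Psi$ be the tangent hyperplane of $M$ at $p$ and let $\Phi$ be the hyperplane through the point $(x,f(x)+k)$ parallel to $\Psi$. Let $A_p^*(k)$ denote the $n$-dimensional area of the region in $\Phi$ enclosed by $\Phi\cap M$, and $V_p^*(k)$ the $(n+1)$-dimensional volume of the region bounded by $M$ and $\Phi$. Then $M$ is an elliptic paraboloid if and only if it satisfies one of the following conditions: $(V^* )$: there is a nonnegative function $\phi$ of $k$ alone such that $V_p^*(k)=\phi(k)$ for all $p\in M$ and all $k>0$; $(A^* )$: there is a nonnegative function $\psi$ of $k$ alone such that $A_p^*(k)/W(p)=\psi(k)$ for all $p\in M$ and all $k>0$.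
   Context: An elliptic paraboloid is a hypersurface congruent (by a rigid motion of $\mathbb{E}^{n+1}$) to $z=\sum_{i=1}^n a_i^2x_i^2$ with all $a_i>0$. *)

(* Defs.v *)
From HB Require Import structures.
From mathcomp Require Import all_boot all_order all_algebra.
From mathcomp Require Import all_classical all_reals all_analysis.
Set Implicit Arguments. Unset Strict Implicit. Unset Printing Implicit Defensive.
Import Order.TTheory GRing.Theory Num.Theory.
Import numFieldNormedType.Exports.
Local Open Scope classical_set_scope.
Local Open Scope ring_scope.

(* m-dimensional Lebesgue measure on 'rV[R]_m, defined by iterated
   (Tonelli/Cavalieri) integration of one-dimensional Lebesgue measure:
   vol_{m+1}(S) = int_R vol_m(S_t) dt, where S_t is the slice of S at
   first coordinate t; vol_0 is the counting (Dirac) measure on the point. *)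
Fixpoint lebvol (R : realType) (m : nat) : set 'rV[R]_m -> \bar R :=
  match m return set 'rV[R]_m -> \bar R with
  | 0 => fun S => if pselect (S 0) then 1%E else 0%E
  | m'.+1 => fun S =>
      (\int[@lebesgue_measure R]_t
         lebvol [set v : 'rV[R]_m' | S (row_mx (const_mx t : 'rV[R]_1) v)])%E
  end.

Fixpoint iterD (R : realType) (n : nat) (vs : seq 'rV[R]_n)
  (f : 'rV[R]_n -> R) : 'rV[R]_n -> R :=
  match vs with
  | [::] => f
  | v :: vs' => fun x => 'D_v (iterD vs' f) x
  end.

Definition smooth (R : realType) (n : nat) (f : 'rV[R]_n -> R) : Prop :=
  forall (vs : seq 'rV[R]_n) (x : 'rV[R]_n), differentiable (iterD vs f) x.

Definition convex_fun (R : realType) (n : nat) (f : 'rV[R]_n -> R) : Prop :=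
  forall (x y : 'rV[R]_n) (t : R), 0 <= t <= 1 ->
    f ((1 - t) *: x + t *: y) <= (1 - t) * f x + t * f y.

Definition grad (R : realType) (n : nat) (f : 'rV[R]_n -> R) (x : 'rV[R]_n)
  : 'rV[R]_n := \row_(i < n) 'D_(delta_mx 0 i) f x.

Definition dotv (R : realType) (n : nat) (u v : 'rV[R]_n) : R :=
  \sum_(i < n) u 0 i * v 0 i.

Definition Wfun (R : realType) (n : nat) (f : 'rV[R]_n -> R) (x : 'rV[R]_n) : R :=
  Num.sqrt (1 + dotv (grad f x) (grad f x)).

Definition pt (R : realType) (n : nat) (x : 'rV[R]_n) (z : R) : 'rV[R]_(n + 1) :=
  row_mx x (const_mx z : 'rV[R]_1).
Definition horiz (R : realType) (n : nat) (q : 'rV[R]_(n + 1)) : 'rV[R]_n :=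
  lsubmx q.
Definition height (R : realType) (n : nat) (q : 'rV[R]_(n + 1)) : R :=
  rsubmx q 0 0.

Definition graph (R : realType) (n : nat) (f : 'rV[R]_n -> R) : set 'rV[R]_(n + 1) :=
  [set pt x (f x) | x in setT].

Definition tangent (R : realType) (n : nat) (f : 'rV[R]_n -> R) (a : 'rV[R]_n)
  (x : 'rV[R]_n) : R := f a + dotv (grad f a) (x - a).
Definition Phi (R : realType) (n : nat) (f : 'rV[R]_n -> R) (a : 'rV[R]_n) (k : R)
  : set 'rV[R]_(n + 1) :=
  [set q | height q = tangent f a (horiz q) + k].

Definition regionV (R : realType) (n : nat) (f : 'rV[R]_n -> R) (a : 'rV[R]_n) (k : R)
  : set 'rV[R]_(n + 1) :=
  [set q | f (horiz q) <= height q /\ height q <= tangent f a (horiz q) + k].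

Definition regionA (R : realType) (n : nat) (f : 'rV[R]_n -> R) (a : 'rV[R]_n) (k : R)
  : set 'rV[R]_(n + 1) :=
  Phi f a k `&` [set q | f (horiz q) <= height q].

Definition unormal (R : realType) (n : nat) (f : 'rV[R]_n -> R) (a : 'rV[R]_n)
  : 'rV[R]_(n + 1) :=
  (Wfun f a)^-1 *: pt (- grad f a) 1.

Definition Vstar (R : realType) (n : nat) (f : 'rV[R]_n -> R) (a : 'rV[R]_n) (k : R)
  : \bar R := lebvol (regionV f a k).

(* n-dimensional area of a region S lying in the hyperplane Phi with unit
   normal nu: the (n+1)-volume of the right prism {s + t nu | s in S, t in [0,1]}
   of height 1 over S. *)
Definition Astar (R : realType) (n : nat) (f : 'rV[R]_n -> R) (a : 'rV[R]_n) (k : R)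
  : \bar R :=
  lebvol [set s + t *: unormal f a | s in regionA f a k & t in `[0, 1]%classic].

Definition std_paraboloid (R : realType) (n : nat) (c : 'I_n -> R)
  : set 'rV[R]_(n + 1) :=
  [set pt x (\sum_(i < n) c i ^+ 2 * x 0 i ^+ 2) | x in setT].

Definition elliptic_paraboloid (R : realType) (n : nat) (M : set 'rV[R]_(n + 1))
  : Prop :=
  exists (c : 'I_n -> R) (Q : 'M[R]_(n + 1)) (b : 'rV[R]_(n + 1)),
    (forall i, 0 < c i) /\ Q *m Q^T = 1%:M /\
    M = [set q *m Q + b | q in std_paraboloid c].

(* Main.v *)
(* Write m_a = f - (tangent plane at a) >= 0. The volume V*(k) is the integral of
   (k - m_a)^+, and the area A*(k)/W is the measure of {m_a <= k}, i.e. the slope in k of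
   that integral, so either condition says that the integrals of ((k - m_a)^+)^j / j!
   (j = 1, 2, 3) do not depend on a. Finiteness of the volumes makes all sections bounded.
   Replacing the tangent plane at a by the one at b inside the integral with j = 3 and
   expanding to second order, the first-order term vanishes at the centroid of the section.
   A section of height K has width O(sqrt K), so, as K tends to infinity, the remainder is
   negligible and m_b(a) is a limit of (quadratic form + linear form) in
   w = grad f(b) - grad f(a). Since w ranges over a neighbourhood of 0, m_b(a) is a
   polynomial of degree 2 in w; its gradient in w is b - a, hence grad f is affine and f is
   a positive definite quadratic function.
   Integrals over R^n are handled as iterated integrals of continuous compactly supported
   functions; arbitrary sets only enter through monotonicity. *)
Require Import Defs.
From HB Require Import structures.
From mathcomp Require Import all_boot all_order all_algebra.
From mathcomp Require Import all_classical all_reals all_analysis.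
From mathcomp Require Import measurable_realfun ring lra.
Set Implicit Arguments. Unset Strict Implicit. Unset Printing Implicit Defensive.
Import Order.TTheory GRing.Theory Num.Theory.
Import numFieldNormedType.Exports.
Local Open Scope classical_set_scope.
Local Open Scope ring_scope.

(** A priori the tangent plane at [a] may touch the graph along a larger convex set, so a section
    need not be centred at [a]. Expansions are therefore made about the centroid [z] of a section,
    which turns out to be a point of contact; its displacement [z - a] produces the linear form in
    the limit, removed only at the end. The volume is integrated twice more in the height because
    [ramp3] has a Lipschitz second derivative: its second-order Taylor error is cubic in the tilt,
    uniformly, also across the boundary of the section. At height s^2 the tilt is O(s), the error
    O(s^3) and the weight [ramp2] of order s^4, whence a relative error O(1/s). Volumes are never
    differentiated in the height; areas are squeezed between their difference quotients. The
    converse uses only translations and homotheties, since the axis of the paraboloid is shown to be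
    vertical before any integral is compared. *)

Section MatrixNorm.
Variable R : realType.

Lemma mx_norm_leP (m n : nat) (x : 'M[R]_(m, n)) (r : R) : 0 <= r ->
  reflect (forall i j, `|x i j| <= r) (`|x| <= r).
Proof.
move=> r0; rewrite /Num.norm/= mx_normrE; apply: (iffP idP).
  move=> h i j; apply: le_trans h.
  exact: (@le_bigmax _ _ _ 0 (fun ij : 'I_m * 'I_n => `|x ij.1 ij.2|) (i, j)).
by move=> h; apply: bigmax_le => // -[i j] _ /=; exact: h.
Qed.

Lemma mx_entry_le_norm (m n : nat) (x : 'M[R]_(m, n)) i j : `|x i j| <= `|x|.
Proof. by move: i j; apply/mx_norm_leP. Qed.

Lemma lipschitz_continuous (V W : normedModType R) (F : V -> W) (C : R) :
  (forall x y, `|F x - F y| <= C * `|x - y|) -> continuous F.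
Proof.
move=> FC x; apply/cvgrPdist_le => e e0.
have C0 : 0 < `|C| + 1 by rewrite ltr_wpDl.
near=> y.
apply: (le_trans (FC x y)).
apply: (@le_trans _ _ ((`|C| + 1) * `|x - y|)).
  by rewrite ler_wpM2r// (le_trans (ler_norm C))// lerDl.
rewrite -ler_pdivlMl// mulrC.
near: y; apply: cvgr_dist_le; first exact: cvg_id.
by rewrite divr_gt0.
Unshelve. all: by end_near. Qed.

End MatrixNorm.

(** * One variable: bounded continuous functions supported in an interval *)

Section Compact1D.
Variable R : realType.
Local Notation mu := (@lebesgue_measure R).
Implicit Types (h : R -> R) (M r : R).

(** The constants stay explicit because a whole sequence must share them: [box M r] is the common
    dominating function. *)
Definition bc1 M r h := [/\ continuous h, forall t, `|h t| <= M
  & forall t, r < `|t| -> h t = 0].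

Let box M r : R -> \bar R := fun t => (M%:E * (\1_(`[- r, r]%classic : set R) t)%:E)%E.

Let box_integrable M r : mu.-integrable setT (box M r).
Proof. by apply: integrableZl => //; exact: (integrable_indic_itv (-r) r true false). Qed.

Let box_int M r : 0 <= r -> (\int[mu]_t box M r t = (M * (2 * r))%:E)%E.
Proof.
move=> r0; rewrite /box integralZl//; last exact: (integrable_indic_itv (-r) r true false).
rewrite integral_indic// setIT; have := lebesgue_measure_itv `[- r, r]; rewrite /= lte_fin => ->.
case: ltP => rr; last first.
  have -> : r = 0 by lra.
  by rewrite !mulr0 mule0.
by rewrite -EFinD -EFinM; congr (_%:E); lra.
Qed.

Let le_box M r h : bc1 M r h -> forall t, (`|(h t)%:E| <= box M r t)%E.
Proof.
move=> [_ hM hr] t; rewrite /box indicE -EFinM lee_fin.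
case: (boolP (t \in _)) => [_|]; first by rewrite mulr1.
rewrite notin_setE/= in_itv/= => /negP; rewrite -ler_norml -ltNge => /hr ->.
by rewrite normr0 mulr0.
Qed.

Lemma bc1_integrable M r h : bc1 M r h -> mu.-integrable setT (EFin \o h).
Proof.
move=> hb; apply: (le_integrable _ _ _ (box_integrable M r)) => //.
  apply/measurable_EFinP; apply: continuous_measurable_fun; by case: hb.
move=> t _ /=; apply: le_trans (le_box hb t) _.
rewrite lee_abs//.
Qed.

Lemma bc1_fin M r h : bc1 M r h ->
  (\int[mu]_t (h t)%:E)%E = (\int[mu]_t h t)%:E.
Proof.
move=> hb; rewrite /Rintegral fineK//.
exact: integrable_fin_num (bc1_integrable hb).
Qed.

Lemma bc1_bound M r h : 0 <= r -> bc1 M r h ->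
  `|\int[mu]_t h t| <= M * (2 * r).
Proof.
move=> r0 hb; have hi := bc1_integrable hb.
apply: le_trans (le_normr_Rintegral _ hi) _ => //.
rewrite -lee_fin -(box_int M r0) /Rintegral fineK; last first.
  by apply: integrable_fin_num => //; exact: integrable_norm.
apply: le_integral => //; first exact: integrable_norm.
by move=> t _; have := le_box hb t.
Qed.

Lemma bc1_cvg M r (h_ : nat -> R -> R) h : (forall j, bc1 M r (h_ j)) ->
  bc1 M r h -> (forall t, h_ ^~ t @ \oo --> h t) ->
  \int[mu]_t h_ j t @[j --> \oo] --> \int[mu]_t h t.
Proof.
move=> hb hb0 hc; apply: fine_cvg; rewrite -(bc1_fin hb0).
have mh j : measurable_fun setT (fun t => (h_ j t)%:E).
  by case/integrableP : (bc1_integrable (hb j)).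
have mh0 : measurable_fun setT (EFin \o h).
  by case/integrableP : (bc1_integrable hb0).
have cv : {ae mu, forall x, setT x -> (h_ ^~ x j)%:E @[j --> \oo] --> (EFin \o h) x}.
  by apply: aeW => t _; apply: cvg_EFin; [exact: nearW|exact: hc].
have dom : {ae mu, forall x j, setT x -> (`|(h_ j x)%:E| <= box M r x)%E}.
  by apply: aeW => t j _; exact: le_box.
by have [_ _ ] := @dominated_convergence _ _ R mu setT measurableT _ _ _ mh mh0 cv (box_integrable M r) dom.
Qed.

End Compact1D.

(** * Iterated integrals of compactly supported functions *)

Section IteratedIntegral.
Variable R : realType.
Local Notation mu := (@lebesgue_measure R).

(** Written exactly as the slicing row of [lebvol], so that slices of sets and of functions match by
    conversion. *)
Definition vcons (m : nat) (t : R) (v : 'rV[R]_m) : 'rV[R]_m.+1 :=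
  row_mx (const_mx t : 'rV[R]_1) v.

Lemma vcons_lshift (m : nat) t (v : 'rV[R]_m) i j : vcons t v i (@lshift 1 m j) = t.
Proof. by transitivity ((const_mx t : 'rV[R]_1) i j); [exact: (@row_mxEl R 1 1 m)|rewrite mxE]. Qed.

Lemma vcons_rshift (m : nat) t (v : 'rV[R]_m) i j : vcons t v i (@rshift 1 m j) = v i j.
Proof. exact: (@row_mxEr R 1 1 m). Qed.

Lemma vcons_norm_le (m : nat) t (v : 'rV[R]_m) r : 0 <= r ->
  (`|vcons t v| <= r) = (`|t| <= r) && (`|v| <= r).
Proof.
move=> r0; apply/idP/andP => [/(mx_norm_leP _ r0) h|[ht /(mx_norm_leP _ r0) hv]]; last apply/(mx_norm_leP _ r0) => i j.
  split; last apply/(mx_norm_leP _ r0) => i j.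
    by have := h 0 (@lshift 1 m 0); rewrite vcons_lshift.
  by have := h i (@rshift 1 m j); rewrite vcons_rshift.
by case: (@split_ordP 1 m j) => k ->; rewrite (vcons_lshift, vcons_rshift).
Qed.

Lemma vconsD (m : nat) s t (v w : 'rV[R]_m) :
  vcons s v + vcons t w = vcons (s + t) (v + w).
Proof.
by apply/rowP => j; rewrite [LHS]mxE; case: (@split_ordP 1 m j) => k ->;
  rewrite ?(vcons_lshift, vcons_rshift) // ?mxE.
Qed.

Lemma vconsN (m : nat) t (v : 'rV[R]_m) : - vcons t v = vcons (- t) (- v).
Proof.
by apply/rowP => j; rewrite [LHS]mxE; case: (@split_ordP 1 m j) => k ->;
  rewrite ?(vcons_lshift, vcons_rshift) // ?mxE.
Qed.

Lemma vconsZ (m : nat) c t (v : 'rV[R]_m) : c *: vcons t v = vcons (c * t) (c *: v).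
Proof.
by apply/rowP => j; rewrite [LHS]mxE; case: (@split_ordP 1 m j) => k ->;
  rewrite ?(vcons_lshift, vcons_rshift) // ?mxE.
Qed.

Lemma vcons_split (m : nat) (x : 'rV[R]_m.+1) :
  vcons ((x : 'rV[R]_(1 + m)) 0 (lshift m 0)) (rsubmx (x : 'rV[R]_(1 + m))) = x.
Proof.
apply/rowP => j; case: (@split_ordP 1 m j) => k ->.
  by rewrite vcons_lshift (ord1 k).
by rewrite vcons_rshift mxE.
Qed.

Lemma vcons_continuous_r (m : nat) t : continuous (@vcons m t).
Proof.
apply: (@lipschitz_continuous _ _ _ _ 1) => x y.
by rewrite mul1r vconsN vconsD subrr vcons_norm_le// normr0 normr_ge0 lexx.
Qed.

Lemma vcons_continuous_l (m : nat) (v : 'rV[R]_m) : continuous (fun t => vcons t v).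
Proof.
apply: (@lipschitz_continuous R R^o _ _ 1) => x y.
by rewrite mul1r vconsN vconsD subrr vcons_norm_le ?normr_ge0// normr0 normr_ge0 lexx.
Qed.

(** The recursion of [lebvol] for real functions. The coordinates are always integrated in the same
    order and properties go by induction on the dimension, so integrals are never exchanged. *)
Fixpoint J (m : nat) : ('rV[R]_m -> R) -> R :=
  match m return ('rV[R]_m -> R) -> R with
  | 0 => fun g => g 0
  | k.+1 => fun g => \int[mu]_t J (fun v : 'rV[R]_k => g (vcons t v))
  end.

Definition bcc (m : nat) M r (g : 'rV[R]_m -> R) :=
  [/\ continuous g, forall x, `|g x| <= M & forall x, r < `|x| -> g x = 0].

Lemma bcc_vcons m M r (g : 'rV[R]_m.+1 -> R) t : 0 <= r ->
  bcc M r g -> bcc M r (fun v => g (vcons t v)).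
Proof.
move=> r0 [gc gM gr]; split => [x||x rx]; first 1 last.
- by move=> x; exact: gM.
- by apply: gr; rewrite ltNge vcons_norm_le// negb_and -!ltNge rx orbT.
- apply: continuous_comp; first exact: vcons_continuous_r.
  exact: gc.
Qed.

(** Bound and convergence are proved together: in dimension m they give boundedness and continuity
    of the section integrals, which are required to integrate once more. *)
Let J_ok m :=
  (forall M r (g : 'rV[R]_m -> R), 0 <= r -> bcc M r g ->
     `|J g| <= M * (2 * r) ^+ m) /\
  (forall M r (g_ : nat -> 'rV[R]_m -> R) g, 0 <= r ->
     (forall j, bcc M r (g_ j)) -> bcc M r g ->
     (forall x, g_ ^~ x @ \oo --> g x) -> J (g_ j) @[j --> \oo] --> J g).

Let J_ok_section m M r (g : 'rV[R]_m.+1 -> R) : J_ok m -> 0 <= r -> bcc M r g ->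
  bc1 (M * (2 * r) ^+ m) r (fun t => J (fun v : 'rV[R]_m => g (vcons t v))).
Proof.
move=> [IHb IHc] r0 gb; split=> [t|t|t rt].
- apply/(@cvg_nbhsP _ R^o) => u ut; apply: (IHc M r) => //.
  + by move=> j; exact: bcc_vcons.
  + exact: bcc_vcons.
  + move=> x.
    have hc : g (vcons s x) @[s --> t] --> g (vcons t x).
      apply: (@continuous_comp R^o _ _ (fun s => vcons s x)).
        exact: vcons_continuous_l.
      by case: gb => gc _ _; exact: gc.
    exact: (cvg_comp _ _ ut hc).
- by apply: IHb => //; exact: bcc_vcons.
- apply/eqP; rewrite -normr_le0.
  have -> : (0 : R) = 0 * (2 * r) ^+ m by rewrite mul0r.
  apply: (IHb _ _ _ r0).
  case: (bcc_vcons t r0 gb) => gc gM gr.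
  have g0 x : g (vcons t x) = 0.
    by case: gb => _ _; apply; rewrite ltNge vcons_norm_le// negb_and -!ltNge rt.
  by split => // x; rewrite g0 normr0.
Qed.

Let J_okP m : J_ok m.
Proof.
elim: m => [|m IH].
  split; first by move=> M r g r0 [_ gM _] /=; rewrite expr0 mulr1.
  by move=> M r g_ g r0 _ _ /(_ 0).
split.
  move=> M r g r0 gb /=; have := bc1_bound r0 (J_ok_section IH r0 gb).
  by rewrite exprSr !mulrA.
move=> M r g_ g r0 gb_ gb gc /=.
apply: (bc1_cvg (fun j => J_ok_section IH r0 (gb_ j)) (J_ok_section IH r0 gb)) => t.
by case: IH => _ IHc; apply: (IHc M r) => // [j|]; exact: bcc_vcons.
Qed.

Lemma J_cvg m M r (g_ : nat -> 'rV[R]_m -> R) g : 0 <= r ->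
  (forall j, bcc M r (g_ j)) -> bcc M r g ->
  (forall x, g_ ^~ x @ \oo --> g x) -> J (g_ j) @[j --> \oo] --> J g.
Proof. by have [_ +] := J_okP m; exact. Qed.

Lemma bc1_J m M r (g : 'rV[R]_m.+1 -> R) : 0 <= r -> bcc M r g ->
  bc1 (M * (2 * r) ^+ m) r (fun t => J (fun v : 'rV[R]_m => g (vcons t v))).
Proof. exact: J_ok_section. Qed.

End IteratedIntegral.

(** * Continuous functions with compact support: linearity and monotonicity of [J] *)

Section CompactSupport.
Variable R : realType.
Local Notation mu := (@lebesgue_measure R).

Lemma closed_le_continuous (T : topologicalType) (g : T -> R) c :
  continuous g -> closed [set x | g x <= c].
Proof.
by move=> /continuous_closedP gc; apply: (gc [set y | y <= c]); exact: closed_le.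
Qed.

Lemma compact_rV_bounded (m : nat) (A : set 'rV[R]_m) r :
  closed A -> (forall x, A x -> `|x| <= r) -> compact A.
Proof.
move=> cA Ar; apply: bounded_closed_compact => //.
exists r; split; first exact: num_real.
by move=> s rs x /Ar xr; apply: le_trans xr (ltW rs).
Qed.

Lemma continuous_bounded_ball (m : nat) (g : 'rV[R]_m -> R) r :
  continuous g -> exists2 M, 0 <= M & forall x, `|x| <= r -> `|g x| <= M.
Proof.
move=> gc; have [r0|r0] := leP 0 r; last first.
  by exists 0 => // x xr; have := le_lt_trans xr r0; rewrite normr_lt0.
have [|||c _ cmax] := @EVT_max_rV R m (fun x => `|g x|) [set x | `|x| <= r].
- by exists 0; rewrite /= normr0.
- apply: (@compact_rV_bounded _ _ r) => //.
  by apply: closed_le_continuous; exact: norm_continuous.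
- apply: continuous_subspaceT => x.
  by apply: continuous_comp; [exact: gc|exact: norm_continuous].
by exists `|g c| => // x xr; apply: cmax; rewrite inE.
Qed.

Definition cc (m : nat) (g : 'rV[R]_m -> R) :=
  continuous g /\ exists r, forall x, r < `|x| -> g x = 0.

Lemma cc_bcc m (g : 'rV[R]_m -> R) :
  cc g -> exists M r, 0 <= r /\ bcc M r g.
Proof.
move=> [gc [r gr]]; have [M M0 gM] := continuous_bounded_ball `|r| gc.
exists M, `|r|; split => //; split => // x; last first.
  by move=> rx; apply: gr; rewrite (le_lt_trans (ler_norm r)).
have [xr|xr] := leP `|x| `|r|; first exact: gM.
by rewrite gr ?normr0// (le_lt_trans (ler_norm r)).
Qed.

Lemma bcc_cc m M r (g : 'rV[R]_m -> R) : bcc M r g -> cc g.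
Proof. by case=> gc _ gr; split=> //; exists r. Qed.

Lemma cc_sub m (g h : 'rV[R]_m -> R) :
  continuous h -> (forall x, g x = 0 -> h x = 0) -> cc g -> cc h.
Proof. by move=> hc gh [_ [r gr]]; split=> //; exists r => x /gr/gh. Qed.

Lemma cc_add m (g h : 'rV[R]_m -> R) : cc g -> cc h -> cc (fun x => g x + h x).
Proof.
move=> [gc [r gr]] [hc [s hs]]; split.
  by move=> x; apply: continuousD; [exact: gc|exact: hc].
exists (Num.max r s) => x; rewrite gt_max => /andP[/gr -> /hs ->].
by rewrite addr0.
Qed.

Lemma cc_mulr m (g h : 'rV[R]_m -> R) : cc g -> continuous h ->
  cc (fun x => h x * g x).
Proof.
move=> gc hc; apply: (cc_sub _ _ gc) => x; last by move=> ->; rewrite mulr0.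
by apply: continuousM; [exact: hc|case: gc => + _; exact].
Qed.

Lemma cc_scale m (g : 'rV[R]_m -> R) c : cc g -> cc (fun x => c * g x).
Proof. by move=> gc; apply: (cc_mulr gc); exact: cst_continuous. Qed.

Lemma ccB m (g h : 'rV[R]_m -> R) : cc g -> cc h -> cc (fun x => g x - h x).
Proof.
move=> gc hc; have -> : (fun x => g x - h x) = (fun x => g x + -1 * h x).
  by apply/funext => x; rewrite mulN1r.
by apply: cc_add => //; exact: cc_scale.
Qed.

Lemma cc_sum m (g : nat -> 'rV[R]_m -> R) N : (forall j, cc (g j)) ->
  cc (fun x => \sum_(j < N) g j x).
Proof.
move=> gc; elim: N => [|N IH].
  under eq_fun do rewrite big_ord0.
  by split; [exact: cst_continuous|exists 0].
under eq_fun do rewrite big_ord_recr /=.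
exact: cc_add.
Qed.

Lemma affine_continuous m (c : 'rV[R]_m) (l : R) :
  continuous (fun x : 'rV[R]_m => c + l *: x).
Proof.
apply: (@lipschitz_continuous _ _ _ _ `|l|) => x y.
by rewrite opprD addrACA subrr add0r -scalerBr normrZ.
Qed.

Lemma cc_affine m (g : 'rV[R]_m -> R) (c : 'rV[R]_m) (l : R) : l != 0 -> cc g ->
  cc (fun x : 'rV[R]_m => g (c + l *: x)).
Proof.
move=> l0 [gc [r gr]]; split.
  move=> x; apply: (@continuous_comp _ _ _ (fun x : 'rV[R]_m => c + l *: x) g).
    exact: affine_continuous.
  exact: gc.
exists ((r + `|c|) / `|l|) => x; rewrite ltr_pdivrMr ?normr_gt0// => rx.
apply: gr; have := ler_normB (c + l *: x) c.
by rewrite addrAC subrr add0r normrZ mulrC => h; lra.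
Qed.

Lemma pos_part_continuous (T : topologicalType) (g : T -> R) :
  continuous g -> continuous (fun x => Num.max (g x) 0).
Proof.
by move=> gc x; apply: continuous_max; [exact: gc|exact: cst_continuous].
Qed.

Lemma cc_pos m (g : 'rV[R]_m -> R) : cc g -> cc (fun x => Num.max (g x) 0).
Proof.
move=> gc; apply: (cc_sub _ _ gc) => [|x]; last by move=> ->; rewrite maxxx.
by apply: pos_part_continuous; case: gc.
Qed.

Lemma cc_vcons m (g : 'rV[R]_m.+1 -> R) t : cc g -> cc (fun v => g (vcons t v)).
Proof. by move=> /cc_bcc[M [r [r0 gb]]]; apply: bcc_cc (bcc_vcons t r0 gb). Qed.

Lemma J_fin m (g : 'rV[R]_m.+1 -> R) : cc g ->
  (\int[mu]_t (J (fun v => g (vcons t v)))%:E)%E = (J g)%:E.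
Proof. by move=> /cc_bcc[M [r [r0 gb]]]; apply: (bc1_fin (bc1_J r0 gb)). Qed.

Lemma J_integrable m (g : 'rV[R]_m.+1 -> R) : cc g ->
  mu.-integrable setT (EFin \o (fun t => J (fun v => g (vcons t v)))).
Proof. by move=> /cc_bcc[M [r [r0 gb]]]; apply: (bc1_integrable (bc1_J r0 gb)). Qed.

Lemma J_section_continuous m (g : 'rV[R]_m.+1 -> R) : cc g ->
  continuous (fun t => J (fun v => g (vcons t v))).
Proof. by move=> /cc_bcc[M [r [r0 gb]]]; case: (bc1_J r0 gb). Qed.

Lemma JD m (g h : 'rV[R]_m -> R) : cc g -> cc h ->
  J (fun x => g x + h x) = J g + J h.
Proof.
elim: m g h => [//|m IH] g h gc hc /=.
rewrite -RintegralD//; [|exact: J_integrable..].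
by apply: eq_Rintegral => t _; apply: IH; exact: cc_vcons.
Qed.

Lemma JZ m (g : 'rV[R]_m -> R) c : cc g -> J (fun x => c * g x) = c * J g.
Proof.
elim: m g => [//|m IH] g gc /=.
rewrite -RintegralZl//; last exact: J_integrable.
by apply: eq_Rintegral => t _; apply: IH; exact: cc_vcons.
Qed.

Lemma JB m (g h : 'rV[R]_m -> R) : cc g -> cc h ->
  J (fun x => g x - h x) = J g - J h.
Proof.
move=> gc hc; have -> : (fun x => g x - h x) = (fun x => g x + -1 * h x).
  by apply/funext => x; rewrite mulN1r.
by rewrite JD// ?JZ// ?mulN1r//; exact: cc_scale.
Qed.

Lemma le_J m (g h : 'rV[R]_m -> R) : cc g -> cc h ->
  (forall x, g x <= h x) -> J g <= J h.
Proof.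
elim: m g h => [|m IH] g h gc hc gh /=; first exact: gh.
apply: le_Rintegral => //; [exact: J_integrable..|].
by move=> t _; apply: IH => //; exact: cc_vcons.
Qed.

Lemma norm_J_le m (g h : 'rV[R]_m -> R) : cc g -> cc h ->
  (forall x, `|g x| <= h x) -> `|J g| <= J h.
Proof.
move=> gc hc gh; rewrite ler_norml -mulN1r -JZ//; apply/andP; split; apply: le_J => //.
- exact: cc_scale.
- by move=> x; rewrite mulN1r; have := gh x; rewrite ler_norml => /andP[].
- by move=> x; have := gh x; rewrite ler_norml => /andP[].
Qed.

Lemma J0 m : J (fun _ : 'rV[R]_m => 0) = 0.
Proof.
elim: m => [//|m IH] /=; under eq_Rintegral do rewrite IH.
by rewrite Rintegral_cst// mul0r.
Qed.

Lemma cc0 m : cc (fun _ : 'rV[R]_m => 0).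
Proof. by split; [exact: cst_continuous|exists 0]. Qed.

Lemma J_ge0 m (g : 'rV[R]_m -> R) : (forall x, 0 <= g x) -> 0 <= J g.
Proof.
elim: m g => [|m IH] g g0 /=; first exact: g0.
by apply: Rintegral_ge0 => t _; exact: IH.
Qed.

Lemma J_sum m (g : nat -> 'rV[R]_m -> R) N : (forall j, cc (g j)) ->
  J (fun x => \sum_(j < N) g j x) = \sum_(j < N) J (g j).
Proof.
move=> gc; elim: N => [|N IH].
  rewrite big_ord0 -[RHS](J0 m); congr J.
  by apply/funext => x; rewrite big_ord0.
rewrite big_ord_recr /= -IH -JD//; last exact: cc_sum.
by congr J; apply/funext => x; rewrite big_ord_recr.
Qed.

End CompactSupport.

(** * Translations, homotheties and strict positivity *)

Section ChangeOfVariables.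
Variable R : realType.
Local Notation mu := (@lebesgue_measure R).

Lemma ge0_integral_affine (h : R -> R) (a l : R) : 0 < l -> continuous h ->
  (forall t, 0 <= h t) ->
  (\int[mu]_t (h (a + l * t))%:E = (l^-1)%:E * \int[mu]_t (h t)%:E)%E.
Proof.
move=> l0 hc h0.
have dF x : is_derive (x : R) 1 (fun t : R => a + l * t) l.
  by apply: is_derive_eq; rewrite add0r mul1r; exact: mulr1.
have F'E : derive1 (fun t : R => a + l * t) = cst l.
  by apply/funext => t; rewrite derive1E (@derive_val _ _ _ _ _ _ _ (dF t)).
rewrite (@increasing_ge0_integration_by_substitutionT _ (fun t => a + l * t) h).
- rewrite -ge0_integralZl//.
  + apply: eq_integral => t _; rewrite F'E /= -EFinM; congr (_%:E).
    transitivity (l^-1 * (h (a + l * t) * l)); last by [].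
    by rewrite mulrCA mulVf ?mulr1// gt_eqF.
  + apply/measurable_EFinP; rewrite F'E; apply: measurable_funM => //.
    apply: continuous_measurable_fun => x.
    apply: (@continuous_comp R R R (fun t => a + l * t)); last exact: hc.
    by apply/differentiable_continuous/derivable1_diffP; case: (dF x).
  + move=> x _; rewrite lee_fin F'E; apply: mulr_ge0; [exact: h0|exact: ltW].
  + by rewrite lee_fin invr_ge0 ltW.
- by move=> x y xy; rewrite ltrD2l ltr_pM2l.
- by rewrite F'E; exact: cst_continuous.
- by rewrite F'E; exact: is_cvg_cst.
- by rewrite F'E; exact: is_cvg_cst.
- by move=> x; case: (dF x).
- apply/cvgrNyPle => A; near=> x.
  by rewrite addrC -lerBrDr -ler_pdivlMl//; near: x; apply: nbhs_ninfty_le; rewrite num_real.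
- apply/cvgryPge => A; near=> x.
  by rewrite addrC -lerBlDr -ler_pdivrMl//; near: x; apply: nbhs_pinfty_ge; rewrite num_real.
- exact: hc.
- exact: h0.
Unshelve. all: by end_near. Qed.

(** The map [c + l *: x] acts on each coordinate separately, so the one-dimensional substitution
    applies coordinate by coordinate. That substitution is for nonnegative integrands; positive and
    negative parts give the general case. *)
Lemma J_affine m (g : 'rV[R]_m -> R) (c : 'rV[R]_m) (l : R) : 0 < l -> cc g ->
  J (fun x : 'rV[R]_m => g (c + l *: x)) = l ^- m * J g.
Proof.
move=> l0; suff pos : forall m (g : 'rV[R]_m -> R) (c : 'rV[R]_m), cc g ->
    (forall x, 0 <= g x) ->
    J (fun x : 'rV[R]_m => g (c + l *: x)) = l ^- m * J g.
  move=> gc; have gN : cc (fun x => - g x).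
    by under eq_fun do rewrite -mulN1r; exact: cc_scale.
  have gE : g = (fun x => Num.max (g x) 0 - Num.max (- g x) 0).
    apply/funext => x; have [h|/ltW h] := leP 0 (g x).
      by rewrite max_r ?subr0// oppr_le0.
    by rewrite max_l ?sub0r ?opprK// oppr_ge0.
  have lN0 : l != 0 by rewrite gt_eqF.
  rewrite {1 2}gE JB; [|exact: (@cc_affine _ _ (fun x => Num.max (g x) 0) c l lN0 (cc_pos gc))
    |exact: (@cc_affine _ _ (fun x => Num.max (- g x) 0) c l lN0 (cc_pos gN))].
  rewrite JB; [|exact: cc_pos..].
  rewrite mulrBr (pos _ (fun x => Num.max (g x) 0)) ?(pos _ (fun x => Num.max (- g x) 0))//.
  - exact: cc_pos.
  - by move=> x; rewrite le_max lexx orbT.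
  - exact: cc_pos.
  - by move=> x; rewrite le_max lexx orbT.
elim=> [|{}m IH] {}g {}c gc g0.
  by rewrite expr0 invr1 mul1r /=; congr g; apply/rowP => -[].
rewrite [LHS]/=.
pose H t := J (fun v => g (vcons t v)).
have Hc : continuous H by exact: J_section_continuous.
transitivity (\int[mu]_t (l ^- m * H (c 0 (@lshift 1 m 0) + l * t))).
  apply: eq_Rintegral => t _.
  rewrite -(IH (fun v => g (vcons (c 0 (@lshift 1 m 0) + l * t) v)) (rsubmx (c : 'rV_(1 + m)))).
  - congr J; apply/funext => v; rewrite -{1}(vcons_split c) vconsZ vconsD.
    by [].
  - exact: cc_vcons.
  - by move=> x; exact: g0.
have H0 t : 0 <= H t by exact: J_ge0.
have Hi : mu.-integrable setT (EFin \o H) by exact: J_integrable.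
have aff := @ge0_integral_affine H (c 0 (@lshift 1 m 0)) l l0 Hc H0.
rewrite (J_fin gc) -/(H _) in aff.
suff E : (\int[mu]_t (l ^- m * H (c 0 (@lshift 1 m 0) + l * t))%:E)%E =
    (l ^- m.+1 * J g)%:E by rewrite /Rintegral E.
under eq_integral do rewrite EFinM.
rewrite ge0_integralZl//.
- by rewrite aff -!EFinM exprS invfM mulrA (mulrC l^-1).
- apply/measurable_EFinP; apply: continuous_measurable_fun => x.
  apply: (@continuous_comp R R R (fun t => c 0 (@lshift 1 m 0) + l * t)); last exact: Hc.
  apply: continuousD; first exact: cst_continuous.
  apply: continuousM; [exact: cst_continuous|exact: cvg_id].
- by move=> x _; rewrite lee_fin.
- by rewrite lee_fin invr_ge0 exprn_ge0 ?ltW.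
Qed.

Lemma J_shift m (g : 'rV[R]_m -> R) (c : 'rV[R]_m) : cc g ->
  J (fun x : 'rV[R]_m => g (c + x)) = J g.
Proof.
move=> gc; have := J_affine c ltr01 gc; rewrite expr1n invr1 mul1r => <-.
by congr J; apply/funext => x; rewrite scale1r.
Qed.

Lemma integral_gt0 (h : R -> R) t0 : continuous h -> (forall t, 0 <= h t) ->
  mu.-integrable setT (EFin \o h) -> 0 < h t0 -> 0 < \int[mu]_t h t.
Proof.
move=> hc h0 hi ht0.
have /(_ _ (divr_gt0 ht0 (ltr0Sn R 1))) : forall e, 0 < e -> exists2 d, 0 < d & forall t, `|t0 - t| < d -> `|h t0 - h t| < e.
  by move=> e e0; have /cvgrPdist_lt/(_ e e0) [d d0 hd] := hc t0; exists d.
move=> [d d0 hd].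
have dd : t0 - d / 2 < t0 + d / 2 by lra.
pose A : set R := `[t0 - d / 2, t0 + d / 2]%classic.
have mA : mu A = d%:E.
  rewrite /A; have := lebesgue_measure_itv `[t0 - d / 2, t0 + d / 2].
  by rewrite /= lte_fin dd => ->; rewrite -EFinB; congr (_%:E); lra.
have iA : mu.-integrable setT (fun t => ((h t0 / 2)%:E * (\1_A t)%:E)%E).
  by apply: integrableZl => //; exact: (integrable_indic_itv _ _ true false).
apply: (@lt_le_trans _ _ (h t0 / 2 * d)); first by rewrite mulr_gt0// divr_gt0.
rewrite -lee_fin /Rintegral fineK; last exact: integrable_fin_num.
have -> : (h t0 / 2 * d)%:E = (\int[mu]_t ((h t0 / 2)%:E * (\1_A t)%:E))%E.
  rewrite integralZl//; last exact: (integrable_indic_itv _ _ true false).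
  rewrite integral_indic//; last exact: measurable_itv.
  by rewrite setIT EFinM; congr (_ * _)%E; exact: esym mA.
apply: le_integral => // t _.
rewrite -EFinM lee_fin indicE; case: (boolP (t \in A)) => [|_]; last by rewrite mulr0.
rewrite inE /A/= in_itv/= mulr1 => /andP[t1 t2].
have := hd t; rewrite ltr_norml ltr_norml => /(_ _)/andP[]; last by lra.
by lra.
Qed.

Lemma J_gt0 m (g : 'rV[R]_m -> R) x0 : cc g -> (forall x, 0 <= g x) ->
  0 < g x0 -> 0 < J g.
Proof.
elim: m g x0 => [|m IH] g x0 gc g0 gx0.
  by rewrite /=; have -> : 0 = x0 by apply/rowP => -[].
rewrite /=; apply: (@integral_gt0 _ (x0 0 (@lshift 1 m 0))).
- exact: J_section_continuous.
- by move=> t; exact: J_ge0.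
- exact: J_integrable.
- by apply: (IH _ (rsubmx (x0 : 'rV_(1 + m)))) => //; [exact: cc_vcons|rewrite vcons_split].
Qed.

End ChangeOfVariables.

(** * [lebvol] as an iterated integral of vertical fibres *)

Section LebesgueVolume.
Variable R : realType.
Local Notation mu := (@lebesgue_measure R).

(** The integral of a nonnegative function is a supremum over the simple functions below it, hence
    monotone even when measurability is unknown, as it is for slice volumes of arbitrary sets. *)
Lemma le_ge0_integral (h k : R -> \bar R) : (forall t, 0 <= h t)%E ->
  (forall t, h t <= k t)%E -> (\int[mu]_t h t <= \int[mu]_t k t)%E.
Proof.
move=> h0 hk; rewrite !ge0_integralTE//; last by move=> t; exact: le_trans (hk t).
apply: ereal_sup_le => _ [g /= gh <-]; exists g => // t.
exact: le_trans (gh t) (hk t).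
Qed.

(** Extended-valued twin of [J], for fibre lengths whose finiteness and measurability are
    unknown. *)
Fixpoint eJ (m : nat) : ('rV[R]_m -> \bar R) -> \bar R :=
  match m return ('rV[R]_m -> \bar R) -> \bar R with
  | 0 => fun g => g 0
  | k.+1 => fun g => (\int[mu]_t eJ (fun v : 'rV[R]_k => g (vcons t v)))%E
  end.

Lemma eJ_ge0 m (g : 'rV[R]_m -> \bar R) : (forall x, 0 <= g x)%E -> (0 <= eJ g)%E.
Proof.
elim: m g => [|m IH] g g0 /=; first exact: g0.
by apply: integral_ge0 => t _; exact: IH.
Qed.

Lemma le_eJ m (g h : 'rV[R]_m -> \bar R) : (forall x, 0 <= g x)%E ->
  (forall x, g x <= h x)%E -> (eJ g <= eJ h)%E.
Proof.
elim: m g h => [|m IH] g h g0 gh /=; first exact: gh.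
apply: le_ge0_integral => t; first exact: eJ_ge0.
exact: IH.
Qed.

Lemma eJ_EFin m (g : 'rV[R]_m -> R) : cc g -> eJ (EFin \o g) = (J g)%:E.
Proof.
elim: m g => [//|m IH] g gc; rewrite -(J_fin gc) /=.
by apply: eq_integral => t _; rewrite -IH//; exact: cc_vcons.
Qed.

Lemma pt_lshift n (x : 'rV[R]_n) z i j : pt x z i (lshift 1 j) = x i j.
Proof. exact: row_mxEl. Qed.

Lemma pt_rshift n (x : 'rV[R]_n) z i j : pt x z i (rshift n j) = z.
Proof. by transitivity ((const_mx z : 'rV[R]_1) i j); [exact: row_mxEr|rewrite mxE]. Qed.

Lemma vcons_pt n t (x : 'rV[R]_n) z : vcons t (pt x z) = pt (vcons t x) z.
Proof.
apply/rowP => i; case: (@split_ordP 1 (n + 1) i) => j ->.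
  rewrite vcons_lshift; transitivity (vcons t x 0 (@lshift 1 n j)).
    by rewrite vcons_lshift.
  rewrite -(pt_lshift _ z); congr (pt _ _ _ _); exact: val_inj.
rewrite vcons_rshift; case: (split_ordP j) => k ->.
  rewrite pt_lshift; transitivity (vcons t x 0 (@rshift 1 n k)).
    by rewrite vcons_rshift.
  by rewrite -(pt_lshift _ z); congr (pt _ _ _ _); exact: val_inj.
rewrite pt_rshift; transitivity (pt (vcons t x) z 0 (@rshift n.+1 1 k)).
  by rewrite pt_rshift.
by congr (pt _ _ _ _); exact: val_inj.
Qed.

(** [lebvol] slices from the first coordinate on, so the height, stored last, is the innermost
    integral: a volume is the integral over x of the length of the vertical fibre over x. *)
Lemma lebvol_pt n (S : set 'rV[R]_(n + 1)) :
  lebvol S = eJ (fun x : 'rV[R]_n =>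
    (\int[mu]_z (if pselect (S (pt x z)) then 1 else 0))%E).
Proof.
elim: n S => [|n IH] S.
  rewrite /=; apply: eq_integral => t _.
  suff -> : (row_mx (const_mx t : 'rV[R]_1) (0 : 'rV[R]_0) : 'rV[R]_1) = pt (0 : 'rV[R]_0) t by [].
  apply/rowP => i; case: (@split_ordP 1 0 i) => [j ->|[]//].
  transitivity t; first exact: vcons_lshift.
  transitivity (pt (0 : 'rV[R]_0) t 0 (@rshift 0 1 j)); first by rewrite pt_rshift.
  by congr (pt _ _ _ _); exact: val_inj.
rewrite /=; apply: eq_integral => t _.
rewrite IH; congr eJ; apply/funext => x; apply: eq_integral => z _.
by rewrite -vcons_pt.
Qed.

End LebesgueVolume.

(** * Prisms *)

Section SegmentIntegral.
Variable R : realType.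
Local Notation mu := (@lebesgue_measure R).
Implicit Types (h : R -> R) (a b c : R).

Lemma seg_integrable h a b : continuous h ->
  mu.-integrable `[a, b]%classic (EFin \o h).
Proof.
move=> hc; apply: continuous_compact_integrable; first exact: segment_compact.
exact: continuous_subspaceT.
Qed.

Lemma seg_add h a b c : continuous h -> a <= b -> b <= c ->
  \int[mu]_(u in `[a, c]) h u = \int[mu]_(u in `[a, b]) h u + \int[mu]_(u in `[b, c]) h u.
Proof.
move=> hc ab bc; have := @Rintegral_itvB _ h (BLeft a) (BRight c) b (seg_integrable _ _ hc).
rewrite !bnd_simp => /(_ ab bc) E.
rewrite -(@Rintegral_itv_obnd_cbnd _ b (BRight c)) -?E ?subrKC//.
apply: integrableS (seg_integrable b c hc) => //.
by apply: subset_itvr; rewrite bnd_simp.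
Qed.

Lemma seg_shift h a b c : continuous h -> a <= b ->
  \int[mu]_(u in `[a, b]) h (c + u) = \int[mu]_(u in `[c + a, c + b]) h u.
Proof.
move=> hc ab; rewrite /Rintegral; congr fine.
have dF x : is_derive (x : R) 1 (fun t : R => c + t) 1.
  by apply: is_derive_eq; rewrite add0r mulr1.
have F'E : derive1 (fun t : R => c + t) = cst 1.
  by apply/funext => t; rewrite derive1E (@derive_val _ _ _ _ _ _ _ (dF t)).
have Fc : continuous (fun t : R => c + t).
  by move=> x; apply/differentiable_continuous/derivable1_diffP; case: (dF x).
rewrite (@integration_by_substitution_increasing _ (fun t => c + t) h a b) //.
- by apply: eq_integral => u _; rewrite F'E; congr (_%:E); rewrite /= [RHS]mulr1.
- by move=> x y _ _ xy; rewrite ltrD2l.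
- by rewrite F'E => x _; exact: cst_continuous.
- by rewrite F'E; exact: is_cvg_cst.
- by rewrite F'E; exact: is_cvg_cst.
- split.
  + by move=> x _; case: (dF x).
  + by apply: cvg_at_right_filter; exact: Fc.
  + by apply: cvg_at_left_filter; exact: Fc.
- exact: continuous_subspaceT.
Qed.

Lemma seg_approx h a b c (e : R) : continuous h -> a <= b ->
  (forall u, a <= u <= b -> `|h u - c| <= e) ->
  `|\int[mu]_(u in `[a, b]) h u - (b - a) * c| <= (b - a) * e.
Proof.
move=> hc ab he.
have cst_int k : \int[mu]_(u in `[a, b]) k = (b - a) * k :> R.
  rewrite Rintegral_cst// mulrC; congr (_ * _).
  transitivity (fine (b - a)%:E) => //; congr fine.
  have := lebesgue_measure_itv `[a, b]; rewrite /= lte_fin.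
  case: ltP => // ba; have -> : a = b by lra.
  by rewrite subrr.
have cb k : mu.-integrable `[a, b]%classic (EFin \o (fun _ : R => k)).
  by apply: seg_integrable; exact: cst_continuous.
have ih := seg_integrable a b hc.
have le1 : \int[mu]_(u in `[a, b]) h u <= (b - a) * (c + e).
  rewrite -cst_int; apply: le_Rintegral => // x; rewrite /= in_itv /= => /he.
  by rewrite ler_norml; lra.
have le2 : (b - a) * (c - e) <= \int[mu]_(u in `[a, b]) h u.
  rewrite -cst_int; apply: le_Rintegral => // x; rewrite /= in_itv /= => /he.
  by rewrite ler_norml; lra.
by rewrite ler_distl -mulrBr -mulrDr le1 le2.
Qed.

End SegmentIntegral.

Section Prism.
Variable R : realType.
Local Notation mu := (@lebesgue_measure R).

(** Dominated convergence speaks of sequences, so continuity of [smear] is tested on sequences. *)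
Lemma seq_continuous (V : normedModType R) (F : V -> R) (p : V) :
  (forall u : nat -> V, u @ \oo --> p -> F (u j) @[j --> \oo] --> F p) ->
  F x @[x --> p] --> F p.
Proof.
move=> Fu; apply: contrapT => /cvgrPdist_lt /existsNP[e /not_implyP[e0 ne]].
have far d : 0 < d -> exists y, `|p - y| < d /\ e <= `|F p - F y|.
  move=> d0; apply: contrapT => /forallNP h; apply: ne.
  have hd : \forall y \near p, `|p - y| < d by apply: cvgr_dist_lt d0; exact: cvg_id.
  apply: (filterS _ hd) => y py.
  by rewrite ltNge; apply/negP => ey; exact: (h y).
have inv0 j : 0 < j.+1%:R^-1 :> R by rewrite invr_gt0.
pose u j := sval (cid (far _ (inv0 j))).
have up j : `|p - u j| < j.+1%:R^-1 /\ e <= `|F p - F (u j)|.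
  exact: svalP (cid (far _ (inv0 j))).
have /Fu /cvgrPdist_lt/(_ e e0)[N _ /(_ N (leqnn N))/=] : u @ \oo --> p.
  apply/cvgrPdist_lt => d d0; near=> j; apply: lt_trans (up j).1 _.
  by near: j; exact: near_infty_natSinv_lt (PosNum d0).
by rewrite ltNge (up N).2.
Unshelve. all: by end_near. Qed.

Variable m : nat.
Implicit Types (chi : 'rV[R]_m -> R) (v : 'rV[R]_m).

(** For [chi] the indicator of a base, this is the thickness over [y] of a slanted prism: the time
    in [0, T] that [y + u *: v] spends in the base. *)
Definition smear chi v (T : R) (y : 'rV[R]_m) : R :=
  \int[mu]_(u in `[0, T]) chi (y + u *: v).

Lemma line_continuous (y v : 'rV[R]_m) : continuous (fun u : R => y + u *: v).
Proof.
apply: (@lipschitz_continuous R R^o _ _ `|v|) => u u'.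
by rewrite opprD addrACA subrr add0r -scalerBl normrZ mulrC.
Qed.

Lemma comp_line_continuous chi y v : continuous chi ->
  continuous (fun u : R => chi (y + u *: v)).
Proof.
move=> cc u; apply: (@continuous_comp R^o _ _ (fun u : R => y + u *: v)); last exact: cc.
exact: line_continuous.
Qed.

Lemma smear_bcc chi v T M r : 0 <= T -> 0 <= r -> bcc M r chi ->
  bcc (T * M) (r + T * `|v|) (smear chi v T).
Proof.
move=> T0 r0 [cC cM cr]; split.
- move=> p; apply: seq_continuous => u up; apply: fine_cvg.
  rewrite /smear /Rintegral fineK; last first.
    by apply: integrable_fin_num => //; apply: seg_integrable; exact: comp_line_continuous.
  have mh (y : 'rV[R]_m) : measurable_fun (`[0, T]%classic : set R) (fun t : R => (chi (y + t *: v))%:E).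
    by case/integrableP: (seg_integrable 0 T (@comp_line_continuous chi y v cC)).
  have cv : {ae mu, forall x, (`[0, T]%classic : set R) x -> (chi (u j + x *: v))%:E @[j --> \oo] --> (chi (p + x *: v))%:E}.
    apply: aeW => t _; apply: cvg_EFin; first exact: nearW.
    apply: (cvg_comp _ chi); last exact: cC.
    by apply: cvgD => //; exact: cvg_cst.
  have dom : {ae mu, forall x j, (`[0, T]%classic : set R) x -> (`|(chi (u j + x *: v))%:E| <= (cst M%:E) x)%E}.
    by apply: aeW => t j _; rewrite /= lee_fin.
  have iM : mu.-integrable `[0, T]%classic (cst M%:E).
    by apply: (@seg_integrable _ (cst M)); exact: cst_continuous.
  by have [_ _ ] := @dominated_convergence _ _ R mu `[0, T]%classic (measurable_itv _) _ _ _
    (fun j => mh (u j)) (mh p) cv iM dom.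
- move=> y; have := @seg_approx R (fun u => chi (y + u *: v)) 0 T 0 M.
  rewrite mulr0 !subr0; apply => //; first exact: comp_line_continuous.
  by move=> u _; rewrite subr0.
- move=> y ry; apply/eqP; rewrite -normr_le0.
  have := @seg_approx R (fun u => chi (y + u *: v)) 0 T 0 0.
  rewrite !mulr0 !subr0; apply => //; first exact: comp_line_continuous.
  move=> u /andP[u0 uT]; rewrite subr0 cr ?normr0//.
  have := ler_normB (y + u *: v) (u *: v); rewrite addrK normrZ ger0_norm// => h.
  have : u * `|v| <= T * `|v| by rewrite ler_wpM2r.
  lra.
Qed.

Lemma smear_cc chi v T : 0 <= T -> cc chi -> cc (smear chi v T).
Proof. by move=> T0 /cc_bcc[M [r [r0 cb]]]; apply: bcc_cc (smear_bcc v T0 r0 cb). Qed.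

Lemma J_smearD chi v S T : 0 <= S -> 0 <= T -> cc chi ->
  J (smear chi v (S + T)) = J (smear chi v S) + J (smear chi v T).
Proof.
move=> S0 T0 cC; rewrite -(J_shift (S *: v) (smear_cc v T0 cC)) -JD; last first.
- have -> : (fun x : 'rV[R]_m => smear chi v T (S *: v + x)) = (fun x => smear chi v T (S *: v + 1 *: x)).
    by apply/funext => x; rewrite scale1r.
  by apply: cc_affine; [exact: oner_neq0|exact: smear_cc].
- exact: smear_cc.
congr J; apply/funext => y; have [cc _] := cC.
rewrite /smear (@seg_add _ _ 0 S (S + T)) ?lerDl//; last exact: comp_line_continuous.
congr (_ + _).
have := seg_shift S (@comp_line_continuous chi y v cc) T0; rewrite addr0 => <-.
by apply: eq_Rintegral => u _; rewrite scalerDl addrA (addrC y).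
Qed.

(** Cavalieri's principle for slanted prisms, without exchanging integrals: [J (smear chi v T)] is
    additive in [T], so its quotient by [T] is unchanged when [T] is replaced by
    [d j = T / (j + 1)], and [smear chi v d / d] tends to [chi] as d tends to 0. *)
Lemma J_smear chi v T : 0 < T -> cc chi -> J (smear chi v T) = T * J chi.
Proof.
move=> T0 cC.
have add N d : 0 <= d -> J (smear chi v (N%:R * d)) = N%:R * J (smear chi v d).
  move=> d0; elim: N => [|N IH]; last first.
    by rewrite -natr1 !mulrDl !mul1r J_smearD// ?IH// mulr_ge0.
  rewrite !mul0r -[RHS](J0 R m); congr J; apply/funext => y.
  by rewrite /smear set_itv1 Rintegral_set1.
pose d (j : nat) : R := T / j.+1%:R.
have d0 j : 0 < d j by rewrite divr_gt0.
have dJ j : J (fun y => (d j)^-1 * smear chi v (d j) y) = T^-1 * J (smear chi v T).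
  rewrite JZ; last exact: smear_cc (ltW (d0 j)) cC.
  have -> : T = j.+1%:R * d j by rewrite /d mulrC divfK.
  by rewrite add ?(ltW (d0 _))// [in RHS]invfM mulrACA mulVf// mul1r.
have [M [r [r0 cb]]] := cc_bcc cC; have [cc cM cr] := cb.
have dT j : d j <= T by rewrite /d ler_pdivrMr// ler_peMr ?(ltW T0)// ler1n.
have rT0 : 0 <= r + T * `|v| by rewrite addr_ge0// mulr_ge0// ltW.
suff : J (fun y => (d j)^-1 * smear chi v (d j) y) @[j --> \oo] --> J chi.
  under eq_cvg do rewrite dJ.
  move=> /cvg_lim; rewrite lim_cst// => <- //.
  by rewrite mulrA divff ?mul1r// gt_eqF.
apply: (@J_cvg R m M (r + T * `|v|)) => // [j||x].
- have [sc sM sr] := smear_bcc v (ltW (d0 j)) r0 cb; split.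
  + by case: (cc_scale (d j)^-1 (smear_cc v (ltW (d0 j)) cC)).
  + by move=> x; rewrite normrM gtr0_norm ?invr_gt0// ler_pdivrMl//.
  + move=> x rx; rewrite sr ?mulr0//; apply: le_lt_trans rx.
    by rewrite lerD2l ler_wpM2r.
- split => // x rx; apply: cr; apply: le_lt_trans rx.
  by rewrite lerDl mulr_ge0// ltW.
- apply/cvgrPdist_le => e e0.
  have /cvgrPdist_le/(_ e e0)[q /= q0 hq] := @comp_line_continuous chi x v cc 0.
  near=> j.
  have dq : d j < q.
    rewrite /d mulrC -ltr_pdivlMr//.
    by near: j; exact: near_infty_natSinv_lt (PosNum (divr_gt0 q0 T0)).
  have := @seg_approx R (fun u => chi (x + u *: v)) 0 (d j) (chi x) e.
  rewrite subr0 -/(smear chi v (d j) x) => /(_ (@comp_line_continuous _ _ _ cc) (ltW (d0 j))) h.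
  have {h} : `|smear chi v (d j) x - d j * chi x| <= d j * e.
    apply: h => u /andP[u0 ud]; have /= := hq u; rewrite sub0r normrN ger0_norm//.
    by rewrite scale0r addr0 distrC; apply; apply: le_lt_trans dq.
  move=> h; rewrite distrC -(ler_pM2l (d0 j)); apply: le_trans h.
  rewrite -[X in X * _](gtr0_norm (d0 j)) -normrM mulrBr mulrA mulfV ?mul1r//.
  by rewrite gt_eqF.
Unshelve. all: by end_near. Qed.

End Prism.

(** * Tangent planes and gaps *)

Section DotProduct.
Variables (R : realType) (n : nat).
Implicit Types u v w : 'rV[R]_n.

Lemma dotvC u v : dotv u v = dotv v u.
Proof. by apply: eq_bigr => i _; rewrite mulrC. Qed.

Lemma dotvDr u v w : dotv u (v + w) = dotv u v + dotv u w.
Proof. by rewrite /dotv -big_split; apply: eq_bigr => i _; rewrite mxE mulrDr. Qed.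

Lemma dotvDl u v w : dotv (u + v) w = dotv u w + dotv v w.
Proof. by rewrite dotvC dotvDr !(dotvC w). Qed.

Lemma dotvZr u v (c : R) : dotv u (c *: v) = c * dotv u v.
Proof. by rewrite /dotv mulr_sumr; apply: eq_bigr => i _; rewrite mxE mulrCA. Qed.

Lemma dotvZl u v (c : R) : dotv (c *: u) v = c * dotv u v.
Proof. by rewrite dotvC dotvZr dotvC. Qed.

Lemma dotvNr u v : dotv u (- v) = - dotv u v.
Proof. by rewrite -scaleN1r dotvZr mulN1r. Qed.

Lemma dotvNl u v : dotv (- u) v = - dotv u v.
Proof. by rewrite dotvC dotvNr dotvC. Qed.

Lemma dotvBr u v w : dotv u (v - w) = dotv u v - dotv u w.
Proof. by rewrite dotvDr dotvNr. Qed.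

Lemma dotvBl u v w : dotv (u - v) w = dotv u w - dotv v w.
Proof. by rewrite dotvDl dotvNl. Qed.

Lemma dotv0r u : dotv u 0 = 0.
Proof. by rewrite -(scale0r 0) dotvZr mul0r. Qed.

Lemma dotv0l u : dotv 0 u = 0.
Proof. by rewrite dotvC dotv0r. Qed.

Lemma dotv_delta u i : dotv u (delta_mx 0 i) = u 0 i.
Proof.
rewrite /dotv (bigD1 i) //= big1 ?addr0 ?mxE ?eqxx ?mulr1//.
by move=> j ji; rewrite mxE (negbTE ji) andbF mulr0.
Qed.

Lemma dotv_ext u v : (forall w, dotv u w = dotv v w) -> u = v.
Proof. by move=> uv; apply/rowP => i; rewrite -!dotv_delta uv. Qed.

Lemma dotv_ge0 u : 0 <= dotv u u.
Proof. by apply: sumr_ge0 => i _; rewrite -expr2 sqr_ge0. Qed.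

Lemma dotv_eq0 u : dotv u u = 0 -> u = 0.
Proof.
move=> /eqP; rewrite psumr_eq0; last by move=> i _; rewrite -expr2 sqr_ge0.
move=> /allP u0; apply/rowP => i; rewrite mxE.
by have := u0 i; rewrite mem_index_enum mulf_eq0 orbb => /(_ isT)/eqP.
Qed.

Lemma norm_dotv_le u v : `|dotv u v| <= n%:R * `|u| * `|v|.
Proof.
apply: le_trans (ler_norm_sum _ _ _) _.
apply: (@le_trans _ _ (\sum_(i < n) `|u| * `|v|)).
  by apply: ler_sum => i _; rewrite normrM ler_pM// mx_entry_le_norm.
by rewrite sumr_const card_ord -[X in _ <= X]mulrA mulr_natl.
Qed.

Lemma dotv_continuous u : continuous (dotv u).
Proof.
apply: (@lipschitz_continuous R 'rV[R]_n R^o _ (n%:R * `|u|)) => x y.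
by rewrite -dotvBr norm_dotv_le.
Qed.

Lemma dotvB_continuous u (a : 'rV[R]_n) : continuous (fun x : 'rV[R]_n => dotv u (x - a)).
Proof.
apply: (@lipschitz_continuous R 'rV[R]_n R^o _ (n%:R * `|u|)) => x y.
by rewrite -dotvBr opprB addrA subrK norm_dotv_le.
Qed.

End DotProduct.

Section Gap.
Variables (R : realType) (n : nat) (f : 'rV[R]_n -> R).
Hypothesis fd : forall x, differentiable f x.

Lemma f_continuous : continuous f.
Proof. by move=> x; exact: differentiable_continuous. Qed.

Lemma derive_grad x v : 'D_v f x = dotv (grad f x) v.
Proof.
rewrite deriveE// {1}[v]row_sum_delta linear_sum; apply: eq_bigr => i _.
by rewrite linearZ mxE deriveE// mulrC.
Qed.

Lemma grad_quotient_cvg x v :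
  t^-1 * (f (x + t *: v) - f x) @[t --> 0^'+] --> dotv (grad f x) v.
Proof.
rewrite -derive_grad; have : derivable f x v by exact: diff_derivable.
move=> /cvg_dnbhs_at_right.
rewrite -/('D_v f x); apply: cvg_trans; apply: near_eq_cvg.
by near=> t; rewrite (addrC x).
Unshelve. all: by end_near. Qed.

Lemma grad_quotient_ge x v c :
  (\forall t \near 0^'+, c <= t^-1 * (f (x + t *: v) - f x)) -> c <= dotv (grad f x) v.
Proof.
have h := @grad_quotient_cvg x v => hc.
rewrite -(cvg_lim (@Rhausdorff R) h); apply: limr_ge => //.
by apply/cvg_ex; eexists; exact: h.
Qed.

Lemma grad_quotient_le x v c :
  (\forall t \near 0^'+, t^-1 * (f (x + t *: v) - f x) <= c) -> dotv (grad f x) v <= c.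
Proof.
have h := @grad_quotient_cvg x v => hc.
rewrite -(cvg_lim (@Rhausdorff R) h); apply: limr_le => //.
by apply/cvg_ex; eexists; exact: h.
Qed.

Definition gap a x := f x - tangent f a x.

Lemma gap_tangent a x : gap a x = f x - tangent f a x.
Proof. by []. Qed.

Lemma gapE a x : gap a x = f x - f a - dotv (grad f a) (x - a).
Proof. by rewrite /gap /tangent; ring. Qed.

Lemma gap_refl a : gap a a = 0.
Proof. by rewrite gapE !subrr dotv0r subrr. Qed.

Lemma gap_continuous a : continuous (gap a).
Proof.
move=> x; apply: continuousB; first exact: f_continuous.
by apply: continuousD; [exact: cst_continuous|exact: dotvB_continuous].
Qed.

(** Right difference quotients give [dotv q v <= dotv (grad f b) v] in each direction; [v] and [- v]
    together force equality. *)
Lemma grad_eq_of_support b q :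
  (\forall x \near b, f b + dotv q (x - b) <= f x) -> grad f b = q.
Proof.
move=> fq; suff H v : dotv q v <= dotv (grad f b) v.
  apply: dotv_ext => v; apply/eqP; rewrite eq_le H andbT.
  by have := H (- v); rewrite !dotvNr lerN2.
apply: grad_quotient_ge.
have h : b + t *: v @[t --> 0^'+] --> b.
  rewrite -[X in _ --> X]addr0 -(scale0r v).
  apply: cvg_at_right_filter; exact: line_continuous.
have hq : \forall t \near 0^'+, f b + dotv q (b + t *: v - b) <= f (b + t *: v).
  exact: (h _ fq).
near=> t; have t0 : 0 < t by [].
rewrite ler_pdivlMl// -dotvZr lerBrDl; apply: le_trans (_ : _ <= f b + dotv q (b + t *: v - b)) _.
  by rewrite addrAC subrr add0r.
by near: t.
Unshelve. all: by end_near. Qed.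

Hypothesis fconv : convex_fun f.

Lemma gap_ge0 a x : 0 <= gap a x.
Proof.
rewrite gapE subr_ge0; apply: grad_quotient_le.
near=> t; have t0 : 0 < t by [].
have t1 : t <= 1 by near: t; exact: nbhs_right_le.
rewrite ler_pdivrMl//; have := fconv a x (t := t); rewrite (ltW t0) t1 => /(_ isT).
have -> : (1 - t) *: a + t *: x = a + t *: (x - a).
  by apply/rowP => i; rewrite !mxE; ring.
lra.
Unshelve. all: by end_near. Qed.

Lemma gap_convex a x y t : 0 <= t <= 1 ->
  gap a ((1 - t) *: x + t *: y) <= (1 - t) * gap a x + t * gap a y.
Proof.
move=> t01; have := fconv x y t01; rewrite !gapE.
have -> : (1 - t) *: x + t *: y - a = (1 - t) *: (x - a) + t *: (y - a).
  by apply/rowP => i; rewrite !mxE; ring.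
by rewrite [dotv _ (_ *: _ + _)]dotvDr !dotvZr; lra.
Qed.

End Gap.

(** * The two volumes *)

Section Volumes.
Variables (R : realType) (n : nat) (f : 'rV[R]_n -> R).
Hypothesis fd : forall x, differentiable f x.
Hypothesis fconv : convex_fun f.
Local Notation mu := (@lebesgue_measure R).
Local Notation gap := (gap f).

Lemma horiz_pt (x : 'rV[R]_n) z : horiz (pt x z) = x.
Proof. exact: row_mxKl. Qed.

Lemma height_pt (x : 'rV[R]_n) z : height (pt x z) = z.
Proof. by rewrite /height /pt row_mxKr mxE. Qed.

Lemma pt_horiz_height (q : 'rV[R]_(n + 1)) : pt (horiz q) (height q) = q.
Proof.
rewrite -[RHS]hsubmxK /pt /horiz; congr row_mx.
by apply/matrixP => i j; rewrite mxE (ord1 i) (ord1 j).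
Qed.

Lemma regionV_pt a k x z :
  regionV f a k (pt x z) = (f x <= z /\ z <= tangent f a x + k).
Proof. by rewrite /regionV /mkset horiz_pt height_pt. Qed.

Lemma Vstar_eJ a k :
  Vstar f a k = eJ (fun x => (Num.max (k - gap a x) 0)%:E).
Proof.
rewrite /Vstar lebvol_pt; congr eJ; apply/funext => x.
pose A : set R := `[f x, tangent f a x + k]%classic.
transitivity (\int[mu]_z (\1_A z)%:E)%E.
  apply: eq_integral => z _; rewrite indicE.
  case: pselect; rewrite regionV_pt => h.
    by rewrite mem_set// /A /= in_itv /= h.1 h.2.
  by rewrite memNset// /A /= in_itv /= => /andP.
rewrite integral_indic//; last exact: measurable_itv.
rewrite setIT.
have := lebesgue_measure_itv `[f x, tangent f a x + k]; rewrite /= lte_fin => h.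
apply: (eq_trans h); rewrite gap_tangent; case: ltP => fx.
  by rewrite max_l -?EFinB; [congr (_%:E); lra|lra].
by rewrite max_r//; lra.
Qed.

Definition bump (rho : R) (x : 'rV[R]_n) : R := Num.max (1 - rho^-1 * `|x|) 0.

Lemma bump_cc rho : 0 < rho -> cc (bump rho).
Proof.
move=> rho0; split.
  apply: pos_part_continuous; apply: (@lipschitz_continuous R _ R^o _ `|rho^-1|) => x y.
  have -> : 1 - rho^-1 * `|x| - (1 - rho^-1 * `|y|) = rho^-1 * (`|y| - `|x|) by ring.
  by rewrite normrM ler_wpM2l// distrC ler_dist_dist.
exists rho => x rx; apply: max_r; rewrite subr_le0 mulrC ler_pdivlMr//.
by rewrite mul1r ltW.
Qed.

Lemma bump_ge0 rho x : 0 <= bump rho x.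
Proof. by rewrite le_max lexx orbT. Qed.

Lemma bump_le1 rho x : 0 < rho -> bump rho x <= 1.
Proof.
move=> rho0; rewrite ge_max ler01 andbT gerBl.
by rewrite mulr_ge0// invr_ge0 ltW.
Qed.

Lemma bump_eq0 rho x : 0 < rho -> rho < `|x| -> bump rho x = 0.
Proof.
move=> rho0 rx; apply: max_r; rewrite subr_le0 mulrC ler_pdivlMr//.
by rewrite mul1r ltW.
Qed.

Lemma J_bump_gt0 rho : 0 < rho -> 0 < J (bump rho).
Proof.
move=> rho0; apply: (@J_gt0 _ _ _ 0); [exact: bump_cc|exact: bump_ge0|].
by rewrite /bump normr0 mulr0 subr0 lt_max ltr01.
Qed.

Definition bounded_sublevel a k := exists r, forall x, gap a x <= k -> `|x| <= r.

(* Far-away points of a section span, with a ball around [a], disjoint translates of a bump. *)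
Lemma unbounded_sublevel_bumps a k C : 0 < k -> ~ bounded_sublevel a k ->
  exists chi : 'rV[R]_n -> R, [/\ cc chi, forall x, 0 <= chi x <= 1,
    forall x, chi x != 0 -> gap a x <= 3 / 4 * k & C <= J chi].
Proof.
move=> k0 unb.
have [rho rho0 hrho] : exists2 rho, 0 < rho & forall y, `|y - a| <= 2 * rho -> gap a y <= k / 2.
  have /cvgrPdist_lt/(_ _ (divr_gt0 k0 (ltr0Sn R 1)))/nbhs_ballP[d /= d0 hd] := @gap_continuous _ _ f fd a a.
  exists (d / 4); first by rewrite divr_gt0.
  move=> y ya; have /= := hd y; rewrite -ball_normE /= distrC gap_refl sub0r normrN => /(_ _)/ltW.
  rewrite ger0_norm ?gap_ge0// => h; apply: h; lra.
pose N := Num.bound `|C / J (bump rho)|.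
have JN : C <= N%:R * J (bump rho).
  rewrite -ler_pdivrMr ?J_bump_gt0//; apply: (le_trans (ler_norm _)).
  by apply/ltW; apply: archi_boundP.
have [x0 gx0 xfar] : exists2 x0, gap a x0 <= k & 8 * rho * N%:R + `|a| < `|x0|.
  apply: contrapT => h; apply: unb; exists (8 * rho * N%:R + `|a|) => x gx.
  by rewrite leNgt; apply/negP => hx; apply: h; exists x.
pose d := `|x0 - a|.
have dN : 8 * rho * N%:R < d.
  have := ler_normB x0 a; have := ler_normD (x0 - a) a; rewrite subrK -/d; lra.
have d0 : 0 < d by apply: le_lt_trans dN; rewrite mulr_ge0// mulr_ge0// ltW.
(* The centres are [4 * rho] apart on the segment from [a] to [x0]; since [d > 8 * rho * N], all
   [t j] with j < N are at most 1/2. *)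
pose t (j : nat) : R := 4 * rho * j%:R / d.
pose z j : 'rV[R]_n := a + t j *: (x0 - a).
have zdist i j : i != j -> 4 * rho <= `|z i - z j|.
  move=> ij; rewrite /z opprD addrACA subrr add0r -scalerBl normrZ -/d.
  rewrite /t -mulrBl -mulrBr normrM normfV (gtr0_norm d0) divfK ?gt_eqF//.
  rewrite normrM gtr0_norm; last by rewrite mulr_gt0.
  rewrite ler_peMr//; first by rewrite mulr_ge0// ltW.
  case: (ltnP i j) => h.
    by rewrite distrC -natrB ?(ltnW h)// normr_nat ler1n subn_gt0.
  by rewrite -natrB// normr_nat ler1n subn_gt0 ltn_neqAle h andbT eq_sym.
pose chi x := \sum_(j < N) bump rho (- z j + 1 *: x).
have bc j : cc (fun x : 'rV[R]_n => bump rho (- z j + 1 *: x)).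
  by apply: cc_affine; [exact: oner_neq0|exact: bump_cc].
have chi_near x (j : 'I_N) : `|- z j + 1 *: x| <= rho ->
    chi x = bump rho (- z j + 1 *: x).
  rewrite scale1r => xj; rewrite /chi (bigD1 j)//= scale1r big1 ?addr0// => i ij.
  rewrite bump_eq0//.
  have := zdist i j ij.
  have := ler_normD (z i - x) (x - z j); rewrite subrKA.
  by rewrite -[`|z i - x|]normrN opprB (addrC x (- z j)) (addrC x (- z i)) in xj *; lra.
have chi_cases x : (exists j : 'I_N, `|- z j + 1 *: x| <= rho) \/ chi x = 0.
  have [[j hj]|h] := pselect (exists j : 'I_N, `|- z j + 1 *: x| <= rho); first by left; exists j.
  right; rewrite /chi big1// => j _; apply: bump_eq0 => //; rewrite ltNge; apply/negP => hj.
  by apply: h; exists j.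
exists chi; split.
- exact: (@cc_sum _ _ (fun j x => bump rho (- z j + 1 *: x)) N).
- move=> x; have [[j hj]|->] := chi_cases x; last by rewrite lexx ler01.
  by rewrite (chi_near _ _ hj) bump_ge0 bump_le1.
- move=> x chix; have [[j hj]|x0'] := chi_cases x; last by rewrite x0' eqxx in chix.
  have tj : 0 <= t j <= 1 / 2.
    rewrite /t divr_ge0 ?mulr_ge0 ?(ltW rho0) ?(ltW d0)//= ler_pdivrMr//.
    apply: (@le_trans _ _ (4 * rho * N%:R)); last by lra.
    by rewrite ler_wpM2l ?mulr_ge0 ?(ltW rho0)// ler_nat ltnW.
  have [t0 t12] := andP tj.
  have t1 : 0 < 1 - t j by lra.
  (* A point near [z j] is a convex combination of [x0] and a point [y] within [2 * rho] of [a];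
     hence [gap a x <= (1 - t j) * (k / 2) + t j * k], at most [3 / 4 * k] because
     [t j <= 1 / 2]. *)
  pose y := a + (1 - t j)^-1 *: (- z j + 1 *: x).
  have ya : `|y - a| <= 2 * rho.
    rewrite /y addrAC subrr add0r normrZ gtr0_norm ?invr_gt0//.
    rewrite ler_pdivrMl//; apply: le_trans hj _.
    by rewrite mulrA ler_peMl ?(ltW rho0)//; lra.
  have xE : x = (1 - t j) *: y + t j *: x0.
    rewrite /y scalerDr scalerA mulfV ?gt_eqF// !scale1r /z.
    by apply/rowP => i; rewrite !mxE; ring.
  have := @gap_convex _ _ f fconv a y x0 (t j) _; rewrite -xE => /(_ _) h.
  have {}h : gap a x <= (1 - t j) * gap a y + t j * gap a x0 by apply: h; lra.
  apply: le_trans h _; have := hrho y ya => gy.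
  have : (1 - t j) * gap a y <= (1 - t j) * (k / 2) by rewrite ler_pM2l.
  have : t j * gap a x0 <= t j * k by exact: ler_wpM2l.
  have : t j * k <= 1 / 2 * k by apply: ler_wpM2r => //; exact: ltW.
  lra.
- apply: le_trans JN _; rewrite /chi (@J_sum _ _ (fun j x => bump rho (- z j + 1 *: x)) N)//.
  have -> : \sum_(j < N) J (fun x : 'rV[R]_n => bump rho (- z j + 1 *: x)) =
      \sum_(j < N) J (bump rho).
    apply: eq_bigr => j _; rewrite J_affine//; last exact: bump_cc.
    by rewrite expr1n invr1 mul1r.
  by rewrite sumr_const card_ord mulr_natl.
Qed.

Lemma bounded_sublevel_V a k (c : R) : 0 < k -> Vstar f a k = c%:E -> bounded_sublevel a k.
Proof.
move=> k0 Vc; apply: contrapT => unb.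
(* On the support of [chi] the fibres have length at least [k / 4], so this target makes the volume
   exceed [c]. *)
have [chi [cchi chi01 chik Jchi]] := @unbounded_sublevel_bumps a k (4 / k * (c + 1)) k0 unb.
suff : ((k / 4 * J chi)%:E <= c%:E)%E.
  rewrite lee_fin => h.
  have : k / 4 * (4 / k * (c + 1)) <= k / 4 * J chi.
    by apply: ler_wpM2l => //; rewrite divr_ge0// ltW.
  have -> : k / 4 * (4 / k * (c + 1)) = c + 1 by field; rewrite gt_eqF.
  lra.
rewrite -JZ// -eJ_EFin; last exact: cc_scale.
rewrite -Vc Vstar_eJ; apply: le_eJ => x /=; rewrite lee_fin.
  have /andP[c0 _] := chi01 x.
  by rewrite mulr_ge0// divr_ge0// ltW.
have [->|/chik gx] := eqVneq (chi x) 0; first by rewrite mulr0 le_max lexx orbT.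
rewrite le_max; apply/orP; left; have /andP[_ c1] := chi01 x.
have : k / 4 * chi x <= k / 4 * 1 by apply: ler_wpM2l => //; rewrite divr_ge0// ltW.
lra.
Qed.

Lemma Wfun_gt0 a : 0 < Wfun f a.
Proof. by rewrite sqrtr_gt0 ltr_wpDr// dotv_ge0. Qed.

Lemma Wfun_sqr a : Wfun f a ^+ 2 = 1 + dotv (grad f a) (grad f a).
Proof. by rewrite sqr_sqrtr// addr_ge0// dotv_ge0. Qed.

(** Horizontal displacement back to the base per unit of vertical height above the plane: moving by
    t along the unit normal shifts the horizontal part by [- t / W] times the gradient and puts the
    point [t * W] above the plane. *)
Definition prism_dir a : 'rV[R]_n := (Wfun f a ^+ 2)^-1 *: grad f a.

Lemma tangentD a x (v : 'rV[R]_n) : tangent f a (x + v) = tangent f a x + dotv (grad f a) v.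
Proof.
have E : x + v - a = (x - a) + v by rewrite addrAC.
rewrite /tangent E (dotvDr _ _ v).
by rewrite addrA.
Qed.

(* Shearing the prism along its base makes it vertical, of height [Wfun f a]. *)
Lemma prismP a k y z :
  [set s + t *: unormal f a | s in regionA f a k & t in `[0, 1]%classic] (pt y z) <->
  (0 <= z - (tangent f a y + k) <= Wfun f a) /\
  gap a (y + (z - (tangent f a y + k)) *: prism_dir a) <= k.
Proof.
have W0 := Wfun_gt0 a; have W2 := Wfun_sqr a.
have Wne : Wfun f a != 0 by rewrite gt_eqF.
have unE : unormal f a = pt (- ((Wfun f a)^-1 *: grad f a)) (Wfun f a)^-1.
  rewrite /unormal -[LHS]pt_horiz_height; congr pt.
    by apply/rowP => i; rewrite /horiz mxE mxE pt_lshift !mxE mulrN.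
  by rewrite /height mxE mxE pt_rshift mulr1.
have ptD (x x' : 'rV[R]_n) u u' s : pt x u + s *: pt x' u' = pt (x + s *: x') (u + s * u').
  rewrite /pt scale_row_mx add_row_mx; congr row_mx.
  by apply/matrixP => i j; rewrite !mxE.
split.
- move=> [s [sPhi /= fs] [t]]; rewrite /= in_itv /= => /andP[t0 t1].
  rewrite -(pt_horiz_height s) unE ptD => E.
  have Ey : horiz s + t *: - ((Wfun f a)^-1 *: grad f a) = y.
    by have := congr1 (@horiz R n) E; rewrite !horiz_pt.
  have Ez : height s + t * (Wfun f a)^-1 = z.
    by have := congr1 (@height R n) E; rewrite !height_pt.
  have hs : height s = tangent f a (horiz s) + k by exact: sPhi.
  have zE : z - (tangent f a y + k) = t * Wfun f a.
    rewrite -Ez -Ey hs tangentD dotvZr dotvNr dotvZr.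
    have -> : dotv (grad f a) (grad f a) = Wfun f a ^+ 2 - 1 by rewrite W2; ring.
    by field.
  rewrite zE; split.
    by rewrite mulr_ge0 ?(ltW W0)//= ler_piMl// ltW.
  have -> : y + (t * Wfun f a) *: prism_dir a = horiz s.
    rewrite -Ey /prism_dir scalerA scalerN scalerA -addrA -scaleNr -scalerDl.
    have -> : - (t * (Wfun f a)^-1) + t * Wfun f a * (Wfun f a ^+ 2)^-1 = 0 by field.
    by rewrite scale0r addr0.
  by rewrite gap_tangent; lra.
- set u := z - _; move=> [/andP[u0 uW] gk].
  pose x := y + u *: prism_dir a.
  exists (pt x (tangent f a x + k)).
    split; first by rewrite /Phi /mkset height_pt horiz_pt.
    by rewrite /mkset height_pt horiz_pt; move: gk; rewrite gap_tangent -/x; lra.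
  exists (u / Wfun f a).
    by rewrite /= in_itv /= divr_ge0 ?(ltW W0)//= ler_pdivrMr// mul1r.
  rewrite unE ptD; congr pt.
    rewrite /x /prism_dir scalerA scalerN scalerA -addrA -scaleNr -scalerDl.
    have -> : u * (Wfun f a ^+ 2)^-1 + - (u / Wfun f a / Wfun f a) = 0 by field.
    by rewrite scale0r addr0.
  rewrite /x tangentD /prism_dir !dotvZr.
  have -> : dotv (grad f a) (grad f a) = Wfun f a ^+ 2 - 1 by rewrite W2; ring.
  rewrite [X in _ + X = _](_ : _ = u / Wfun f a ^+ 2); last by field.
  rewrite [LHS](_ : _ = tangent f a y + k + u); last by field.
  by rewrite /u; ring.
Qed.

Lemma smear_seg a k (chi : 'rV[R]_n -> R) y : cc chi ->
  (smear chi (prism_dir a) (Wfun f a) y)%:E =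
  (\int[mu]_z ((fun z => (chi (y + (z - (tangent f a y + k)) *: prism_dir a))%:E)
     \_ (`[(tangent f a y + k)%R, (tangent f a y + k + Wfun f a)%R]%classic)) z)%E.
Proof.
move=> [cchi _]; set c := tangent f a y + k.
have hc : continuous (fun z : R => chi (y + (z - c) *: prism_dir a)).
  have -> : (fun z : R => chi (y + (z - c) *: prism_dir a)) =
            (fun z : R => chi (y - c *: prism_dir a + z *: prism_dir a)).
    by apply/funext => z; rewrite scalerBl -addrA (addrC (- _)).
  exact: comp_line_continuous.
rewrite -integral_mkcond; have := seg_integrable c (c + Wfun f a) hc.
move=> hi; rewrite -[RHS]fineK; last exact: integrable_fin_num.
have := seg_shift c hc (ltW (Wfun_gt0 a)); rewrite addr0 /Rintegral => <-.
rewrite /smear /Rintegral; congr (fine _)%:E.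
by apply: eq_integral => z _; rewrite addrAC subrr add0r.
Qed.

(** Sheared to vertical, the prism has height [Wfun f a], so by [J_smear] a density [chi] on the
    base contributes [Wfun f a * J chi]. This is why the area is divided by W: the quotient measures
    the horizontal projection of the section. The prism itself is only compared with [chi]
    fibrewise. *)
Lemma Astar_le a k (chi : 'rV[R]_n -> R) : cc chi -> (forall x, 0 <= chi x) ->
  (forall x, gap a x <= k -> 1 <= chi x) ->
  (Astar f a k <= (Wfun f a * J chi)%:E)%E.
Proof.
move=> cchi chi0 chi1.
rewrite -(J_smear (prism_dir a) (Wfun_gt0 a) cchi) -eJ_EFin; last first.
  by apply: smear_cc => //; exact/ltW/Wfun_gt0.
rewrite /Astar lebvol_pt; apply: le_eJ => y.
  by apply: integral_ge0 => z _; case: pselect.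
rewrite /= (smear_seg a k)//; apply: le_ge0_integral => z; first by case: pselect.
rewrite patchE; case: pselect => [h|_] /=.
  have [h1 h2] := (prismP a k y z).1 h.
  by rewrite mem_set ?lee_fin ?chi1//= in_itv /=; lra.
by case: ifP => // _; rewrite lee_fin.
Qed.

Lemma Astar_ge a k (chi : 'rV[R]_n -> R) : cc chi -> (forall x, 0 <= chi x <= 1) ->
  (forall x, chi x != 0 -> gap a x <= k) ->
  ((Wfun f a * J chi)%:E <= Astar f a k)%E.
Proof.
move=> cchi chi01 chik.
rewrite -(J_smear (prism_dir a) (Wfun_gt0 a) cchi) -eJ_EFin; last first.
  by apply: smear_cc => //; exact/ltW/Wfun_gt0.
have chi0 x : 0 <= chi x by have /andP[] := chi01 x.
rewrite /Astar lebvol_pt; apply: le_eJ => y /=; rewrite (smear_seg a k)//.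
  by apply: integral_ge0 => z _; rewrite patchE; case: ifP => // _; rewrite lee_fin.
apply: le_ge0_integral => z; rewrite patchE; case: ifPn => //=.
- by rewrite lee_fin.
- rewrite inE /= in_itv /= => h.
  case: pselect => [_|hz] /=; first by rewrite lee_fin; have /andP[] := chi01 (y + (z - (tangent f a y + k)) *: prism_dir a).
  have [->//|/chik gx] := eqVneq (chi (y + (z - (tangent f a y + k)) *: prism_dir a)) 0.
  by exfalso; apply: hz; apply/prismP; split => //; lra.
- by move=> _; case: pselect.
Qed.

Lemma bounded_sublevel_A a k (c : R) : 0 < k -> Astar f a k = c%:E -> bounded_sublevel a k.
Proof.
move=> k0 Ac; apply: contrapT => unb.
have [chi [cchi chi01 chik Jchi]] := @unbounded_sublevel_bumps a k ((c + 1) / Wfun f a) k0 unb.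
have : ((Wfun f a * J chi)%:E <= Astar f a k)%E.
  by apply: Astar_ge => // x /chik; lra.
rewrite Ac lee_fin; rewrite ler_pdivrMr ?Wfun_gt0// mulrC in Jchi; lra.
Qed.

End Volumes.

(** * Ramp functions *)

Section PowerRamps.
Variable R : realType.
Implicit Types u v y : R.

Definition ramp1 u : R := Num.max u 0.
Definition ramp2 u : R := 1 / 2 * ramp1 u ^+ 2.
Definition ramp3 u : R := 1 / 6 * ramp1 u ^+ 3.

Lemma ramp1_ge0 u : 0 <= ramp1 u.
Proof. by rewrite le_max lexx orbT. Qed.

Lemma ramp2_ge0 u : 0 <= ramp2 u.
Proof. by rewrite mulr_ge0// sqr_ge0. Qed.

Lemma ramp1_id u : 0 <= u -> ramp1 u = u.
Proof. by move=> u0; rewrite /ramp1 max_l. Qed.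

Lemma ramp1_0 u : u <= 0 -> ramp1 u = 0.
Proof. by move=> u0; rewrite /ramp1 max_r. Qed.

Lemma ramp2_0 u : u <= 0 -> ramp2 u = 0.
Proof. by move=> u0; rewrite /ramp2 ramp1_0// expr0n mulr0. Qed.

Lemma ramp3_0 u : u <= 0 -> ramp3 u = 0.
Proof. by move=> u0; rewrite /ramp3 ramp1_0// expr0n mulr0. Qed.

Lemma ramp1_continuous : continuous ramp1.
Proof. by apply: pos_part_continuous => x; exact: cvg_id. Qed.

Lemma continuous_mul_fun (T : topologicalType) (g h : T -> R) :
  continuous g -> continuous h -> continuous (fun x => g x * h x).
Proof. by move=> gc hc x; apply: continuousM; [exact: gc|exact: hc]. Qed.

Lemma continuous_add_fun (T : topologicalType) (g h : T -> R) :
  continuous g -> continuous h -> continuous (fun x => g x + h x).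
Proof. by move=> gc hc x; apply: continuousD; [exact: gc|exact: hc]. Qed.

Lemma ramp2_continuous : continuous ramp2.
Proof.
apply: continuous_mul_fun; first exact: cst_continuous.
by apply: continuous_mul_fun; exact: ramp1_continuous.
Qed.

Lemma ramp3_continuous : continuous ramp3.
Proof.
apply: continuous_mul_fun; first exact: cst_continuous.
apply: continuous_mul_fun; first exact: ramp1_continuous.
by apply: continuous_mul_fun; exact: ramp1_continuous.
Qed.

Lemma ler_ramp1 u v : u <= v -> ramp1 u <= ramp1 v.
Proof. by move=> uv; rewrite /ramp1 ge_max !le_max uv lexx !orbT. Qed.

Lemma ler_ramp2 u v : u <= v -> ramp2 u <= ramp2 v.
Proof. by move=> uv; rewrite ler_pM2l// lerXn2r ?nnegrE ?ramp1_ge0// ler_ramp1. Qed.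

Lemma ramp1Z u (c : R) : 0 <= c -> ramp1 (c * u) = c * ramp1 u.
Proof.
move=> c0; have [u0|/ltW u0] := leP 0 u; first by rewrite !ramp1_id// mulr_ge0.
by rewrite !ramp1_0 ?mulr0// mulr_ge0_le0.
Qed.

Lemma ramp2Z u (c : R) : 0 <= c -> ramp2 (c * u) = c ^+ 2 * ramp2 u.
Proof. by move=> c0; rewrite /ramp2 ramp1Z// exprMn; ring. Qed.

Lemma ramp2_slope u v : u <= v ->
  ramp1 u * (v - u) <= ramp2 v - ramp2 u <= ramp1 v * (v - u).
Proof.
move=> uv; rewrite /ramp2; have [u0|/ltW u0] := leP 0 u.
  rewrite !ramp1_id//; [|lra]; have := sqr_ge0 (v - u); rewrite !expr2; lra.
rewrite (ramp1_0 u0); have [v0|/ltW v0] := leP 0 v; last by rewrite ramp1_0// !expr2; lra.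
rewrite ramp1_id// !expr2; have := mulr_ge0 v0 v0.
have := mulr_ge0_le0 v0 u0; lra.
Qed.

Lemma ramp3_convex u y : 0 <= ramp3 (u + y) - ramp3 u - ramp2 u * y.
Proof.
rewrite /ramp3 /ramp2; have [u0|/ltW u0] := leP 0 u; last first.
  by rewrite (ramp1_0 u0) !expr0n /= !mulr0 mul0r !subr0 mulr_ge0// exprn_ge0// ramp1_ge0.
rewrite (ramp1_id u0); have [v0|/ltW v0] := leP 0 (u + y).
  rewrite (ramp1_id v0).
  have -> : 1 / 6 * (u + y) ^+ 3 - 1 / 6 * u ^+ 3 - 1 / 2 * u ^+ 2 * y =
     1 / 6 * (y ^+ 2 * (u + y) + 2 * (y ^+ 2 * u)) by field.
  have := mulr_ge0 (sqr_ge0 y) v0; have := mulr_ge0 (sqr_ge0 y) u0; lra.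
rewrite (ramp1_0 v0) expr0n/= mulr0.
have -> : 0 - 1 / 6 * u ^+ 3 - 1 / 2 * u ^+ 2 * y =
  1 / 3 * (u ^+ 2 * u) + 1 / 2 * (u ^+ 2 * - (u + y)) by field.
have := mulr_ge0 (sqr_ge0 u) u0; have := mulr_ge0_le0 (sqr_ge0 u) v0; lra.
Qed.

Lemma ramp3_slope u v : u <= v ->
  ramp2 u * (v - u) <= ramp3 v - ramp3 u <= ramp2 v * (v - u).
Proof.
move=> uv; have := ramp3_convex u (v - u); have := ramp3_convex v (u - v).
rewrite !subrKC; lra.
Qed.

(* A bound linear in [|y|] that survives where the ramp vanishes; it comes from
   [y ^+ 2 >= s * `|y| - s ^+ 2]. *)
Lemma ramp3_lower u y (K s : R) : 0 <= s -> s <= K -> K <= u ->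
  K / 3 * (s * `|y| - s ^+ 2) <= ramp3 (u + y) - ramp3 u - ramp2 u * y.
Proof.
move=> s0 sK Ku; have u0 : 0 <= u by lra.
have K0 : 0 <= K by lra.
rewrite /ramp3 /ramp2 (ramp1_id u0).
have young : s * `|y| - s ^+ 2 <= y ^+ 2.
  have := sqr_ge0 (`|y| - s); rewrite sqrrB real_normK ?num_real//.
  have := mulr_ge0 s0 (normr_ge0 y); have := sqr_ge0 s; lra.
have [v0|/ltW v0] := leP 0 (u + y).
  rewrite (ramp1_id v0).
  have -> : 1 / 6 * (u + y) ^+ 3 - 1 / 6 * u ^+ 3 - 1 / 2 * u ^+ 2 * y =
     1 / 6 * (y ^+ 2 * (u + y)) + u / 3 * y ^+ 2 by field.
  have h1 : 0 <= 1 / 6 * (y ^+ 2 * (u + y)) by have := mulr_ge0 (sqr_ge0 y) v0; lra.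
  have : K / 3 * (s * `|y| - s ^+ 2) <= K / 3 * y ^+ 2 by rewrite ler_wpM2l//; lra.
  have : K / 3 * y ^+ 2 <= u / 3 * y ^+ 2 by rewrite ler_wpM2r ?sqr_ge0//; lra.
  lra.
rewrite (ramp1_0 v0) expr0n/= mulr0.
have yN : `|y| = - y by rewrite ler0_norm//; lra.
have -> : 0 - 1 / 6 * u ^+ 3 - 1 / 2 * u ^+ 2 * y =
  u ^+ 2 / 3 * `|y| + 1 / 6 * (u ^+ 2 * - (u + y)) by rewrite yN; field.
have h1 : 0 <= 1 / 6 * (u ^+ 2 * - (u + y)) by have := mulr_ge0_le0 (sqr_ge0 u) v0; lra.
have h2 : K * s <= u ^+ 2 by rewrite expr2 ler_pM//; lra.
have : K * s / 3 * `|y| <= u ^+ 2 / 3 * `|y| by rewrite ler_wpM2r//; lra.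
have : 0 <= K / 3 * s ^+ 2 by rewrite mulr_ge0 ?sqr_ge0//; lra.
lra.
Qed.

(** [ramp1], the second derivative of [ramp3], is 1-Lipschitz, so the error is cubic uniformly in
    [u], also across the kink at 0. *)
Lemma ramp3_taylor u y :
  `|ramp3 (u + y) - ramp3 u - ramp2 u * y - 1 / 2 * (ramp1 u * y ^+ 2)| <= `|y| ^+ 3.
Proof.
rewrite /ramp3 /ramp2; have y3 : `|y| ^+ 3 = `|y| * y ^+ 2.
  by rewrite exprS real_normK ?num_real.
have ay := normr_ge0 y; have y2 := sqr_ge0 y.
have [u0|/ltW u0] := leP 0 u; have [v0|/ltW v0] := leP 0 (u + y).
- rewrite (ramp1_id u0) (ramp1_id v0).
  have -> : 1 / 6 * (u + y) ^+ 3 - 1 / 6 * u ^+ 3 - 1 / 2 * u ^+ 2 * y -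
    1 / 2 * (u * y ^+ 2) = 1 / 6 * y ^+ 3 by field.
  by rewrite normrM normrX ger0_norm ?divr_ge0// ler_piMl ?exprn_ge0//; lra.
- rewrite (ramp1_id u0) (ramp1_0 v0) expr0n /= mulr0.
  have yN : `|y| = - y by rewrite ler0_norm//; lra.
  have -> : 0 - 1 / 6 * u ^+ 3 - 1 / 2 * u ^+ 2 * y - 1 / 2 * (u * y ^+ 2) =
    1 / 6 * y ^+ 3 + 1 / 6 * (- (u + y)) ^+ 3 by field.
  have h0 : 0 <= - (u + y) by lra.
  have h1 : - (u + y) <= `|y| by lra.
  have h3 : (- (u + y)) ^+ 3 <= `|y| ^+ 3 by rewrite lerXn2r ?nnegrE.
  have h4 : 0 <= (- (u + y)) ^+ 3 by exact: exprn_ge0.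
  have h5 : y ^+ 3 = - `|y| ^+ 3 by rewrite yN; ring.
  by rewrite h5 ler_norml; apply/andP; split; lra.
- rewrite (ramp1_0 u0) (ramp1_id v0) !expr0n /= !mulr0 !mul0r !mulr0 !subr0.
  have yP : `|y| = y by rewrite ger0_norm//; lra.
  have h3 : (u + y) ^+ 3 <= `|y| ^+ 3 by rewrite lerXn2r ?nnegrE//; lra.
  have h4 : 0 <= (u + y) ^+ 3 by exact: exprn_ge0.
  by rewrite ler_norml; apply/andP; split; lra.
- rewrite (ramp1_0 u0) (ramp1_0 v0) !expr0n /= !mulr0 !mul0r !mulr0 !subr0 normr0.
  exact: exprn_ge0.
Qed.

(** The convex function [(1 + t) ^+ N] lies below its chord over [0, 1]. *)
Lemma expr1D_le (t : R) N : 0 <= t <= 1 -> (1 + t) ^+ N <= 1 + (2 ^+ N - 1) * t.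
Proof.
move=> /andP[t0 t1]; elim: N => [|N IH]; first by rewrite !expr0 subrr mul0r addr0.
have h : 0 <= (2 ^+ N - 1 : R) by rewrite subr_ge0 exprn_ege1// ler1n.
rewrite exprS; apply: le_trans (_ : (1 + t) * (1 + (2 ^+ N - 1) * t) <= _).
  by rewrite ler_wpM2l// addr_ge0.
have -> : (1 + t) * (1 + (2 ^+ N - 1) * t) = 1 + t * (2 ^+ N + (2 ^+ N - 1) * t) by ring.
rewrite lerD2l mulrC ler_wpM2r// exprS.
have : (2 ^+ N - 1) * t <= (2 ^+ N - 1) * 1 by rewrite ler_wpM2l.
lra.
Qed.

(* Cutting [0, k] into N steps, the errors telescope to at most [g k * k / N]. *)
Lemma slope_unique (g G H : R -> R) :
  (forall s t, 0 <= s -> 0 < t -> s <= t -> G t - G s <= g t * (t - s)) ->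
  (forall s t, 0 < s -> s <= t -> g s * (t - s) <= G t - G s) ->
  (forall s t, 0 <= s -> 0 < t -> s <= t -> H t - H s <= g t * (t - s)) ->
  (forall s t, 0 < s -> s <= t -> g s * (t - s) <= H t - H s) ->
  G 0 = H 0 -> (forall t, 0 < t -> G 0 <= G t) -> (forall t, 0 < t -> H 0 <= H t) ->
  forall k, 0 < k -> G k = H k.
Proof.
move=> Gu Gl Hu Hl GH0 G0 H0 k k0.
have step N : `|G k - H k| <= g k * (k / N.+1%:R).
  pose d := k / N.+1%:R; have d0 : 0 < d by rewrite divr_gt0.
  have E i : `|G (i.+1%:R * d) - H (i.+1%:R * d)| <= g (i.+1%:R * d) * d.
    elim: i => [|i IH].
      (* No lower slope is available at 0; on the first step the increments of [G] and [H] are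
         bounded below by 0 instead. *)
      rewrite mul1r ler_norml; have := Gu 0 d (lexx _) d0 (ltW d0).
      have := Hu 0 d (lexx _) d0 (ltW d0); rewrite subr0.
      have := G0 _ d0; have := H0 _ d0 => *; apply/andP; split; lra.
    have i0 : 0 < i.+1%:R * d by rewrite mulr_gt0.
    have ii : i.+2%:R * d = i.+1%:R * d + d by rewrite -[in LHS]natr1 mulrDl mul1r.
    have lei : i.+1%:R * d <= i.+2%:R * d by lra.
    have := Gu _ _ (ltW i0) (lt_le_trans i0 lei) lei; have := Gl _ _ i0 lei.
    have := Hu _ _ (ltW i0) (lt_le_trans i0 lei) lei; have := Hl _ _ i0 lei.
    have -> : i.+2%:R * d - i.+1%:R * d = d by lra.
    move: IH; rewrite !ler_norml => /andP[? ?] *; apply/andP; split; lra.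
  have := E N; have -> : N.+1%:R * d = k by rewrite /d mulrC divfK.
  by [].
apply/eqP; rewrite -subr_eq0 -normr_le0; rewrite leNgt; apply/negP => D0.
have g0 : 0 < g k * k by have := step 0; rewrite divr1; exact: lt_le_trans.
have := step (Num.bound (g k * k / `|G k - H k|)).
rewrite leNgt => /negP; apply.
have := archi_boundP (ltW (divr_gt0 g0 D0)); rewrite ltr_pdivrMr// => h.
rewrite mulrA ltr_pdivrMr//; apply: lt_le_trans h _.
by rewrite mulrC ler_wpM2l// ler_nat.
Qed.

End PowerRamps.

(** * Levels of the gap functions *)

Section Levels.
Variables (R : realType) (n : nat) (f : 'rV[R]_n -> R).
Hypothesis fd : forall x, differentiable f x.
Hypothesis fconv : convex_fun f.
Hypothesis bdd : forall a k, 0 < k -> bounded_sublevel f a k.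
Local Notation gap := (gap f).

Lemma cc_level a k (h : 'rV[R]_n -> R) : continuous h ->
  (forall x, k <= gap a x -> h x = 0) -> cc h.
Proof.
move=> hc h0; split => //.
(* Sections are known to be bounded at positive heights only, while [k] may be nonpositive. *)
have [|r hr] := @bdd a (Num.max k 1); first by rewrite lt_max ltr01 orbT.
exists r => x rx; apply: h0; rewrite leNgt; apply/negP => gx.
have := hr x; rewrite le_max (ltW gx) => /(_ isT); rewrite leNgt => /negP; exact.
Qed.

Lemma level_continuous a k (h : R -> R) : continuous h ->
  continuous (fun x => h (k - gap a x)).
Proof.
move=> hc x; apply: (@continuous_comp _ _ _ (fun x => k - gap a x) h); last exact: hc.
by apply: continuousB; [exact: cst_continuous|exact: gap_continuous].
Qed.

Lemma cc_ramp1 a k : cc (fun x => ramp1 (k - gap a x)).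
Proof.
apply: (@cc_level a k); first exact/level_continuous/ramp1_continuous.
by move=> x kx; rewrite ramp1_0// subr_le0.
Qed.

Lemma cc_ramp2 a k : cc (fun x => ramp2 (k - gap a x)).
Proof.
apply: (@cc_level a k); first exact/level_continuous/ramp2_continuous.
by move=> x kx; rewrite ramp2_0// subr_le0.
Qed.

Lemma cc_ramp3 a k : cc (fun x => ramp3 (k - gap a x)).
Proof.
apply: (@cc_level a k); first exact/level_continuous/ramp3_continuous.
by move=> x kx; rewrite ramp3_0// subr_le0.
Qed.

Definition Phi1 a k := J (fun x => ramp1 (k - gap a x)).
Definition Phi2 a k := J (fun x => ramp2 (k - gap a x)).
Definition Phi3 a k := J (fun x => ramp3 (k - gap a x)).

Lemma Phi2_gt0 a k : 0 < k -> 0 < Phi2 a k.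
Proof.
move=> k0; apply: (@J_gt0 _ _ _ a); [exact: cc_ramp2|by move=> x; exact: ramp2_ge0|].
rewrite gap_refl subr0 /ramp2 ramp1_id ?(ltW k0)//.
by rewrite mulr_gt0// exprn_gt0.
Qed.

Lemma Phi2_slope a s t : s <= t ->
  Phi1 a s * (t - s) <= Phi2 a t - Phi2 a s <= Phi1 a t * (t - s).
Proof.
move=> st; have c1 := cc_ramp1 a; have c2 := cc_ramp2 a.
rewrite /Phi1 /Phi2 -JB// !(mulrC _ (t - s)) -!JZ//.
have H x : ramp1 (s - gap a x) * (t - s) <= ramp2 (t - gap a x) - ramp2 (s - gap a x)
    <= ramp1 (t - gap a x) * (t - s).
  have -> : t - s = (t - gap a x) - (s - gap a x) by ring.
  by apply: ramp2_slope; rewrite lerD2r.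
have cB : cc (fun x => ramp2 (t - gap a x) - ramp2 (s - gap a x)) by exact: ccB.
apply/andP; split; apply: le_J => //; try exact: cc_scale.
  by move=> x; rewrite mulrC; have /andP[] := H x.
by move=> x; rewrite mulrC; have /andP[] := H x.
Qed.

Lemma Phi3_slope a s t : s <= t ->
  Phi2 a s * (t - s) <= Phi3 a t - Phi3 a s <= Phi2 a t * (t - s).
Proof.
move=> st; have c2 := cc_ramp2 a; have c3 := cc_ramp3 a.
rewrite /Phi2 /Phi3 -JB// !(mulrC _ (t - s)) -!JZ//.
have H x : ramp2 (s - gap a x) * (t - s) <= ramp3 (t - gap a x) - ramp3 (s - gap a x)
    <= ramp2 (t - gap a x) * (t - s).
  have -> : t - s = (t - gap a x) - (s - gap a x) by ring.
  by apply: ramp3_slope; rewrite lerD2r.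
have cB : cc (fun x => ramp3 (t - gap a x) - ramp3 (s - gap a x)) by exact: ccB.
apply/andP; split; apply: le_J => //; try exact: cc_scale.
  by move=> x; rewrite mulrC; have /andP[] := H x.
by move=> x; rewrite mulrC; have /andP[] := H x.
Qed.

Lemma Phi1_at0 a : Phi1 a 0 = 0.
Proof.
rewrite -[RHS](J0 R n); congr J; apply/funext => x.
by rewrite ramp1_0// sub0r oppr_le0 gap_ge0.
Qed.

Lemma Phi2_at0 a : Phi2 a 0 = 0.
Proof.
rewrite -[RHS](J0 R n); congr J; apply/funext => x.
by rewrite ramp2_0// sub0r oppr_le0 gap_ge0.
Qed.

Lemma Phi3_at0 a : Phi3 a 0 = 0.
Proof.
rewrite -[RHS](J0 R n); congr J; apply/funext => x.
by rewrite ramp3_0// sub0r oppr_le0 gap_ge0.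
Qed.

Lemma gap_scale a z x t : gap a z = 0 -> 0 <= t <= 1 ->
  gap a (z + t *: (x - z)) <= t * gap a x.
Proof.
move=> z0 t01; have := gap_convex fconv a z x t01; rewrite z0 mulr0 add0r.
suff -> : z + t *: (x - z) = (1 - t) *: z + t *: x by [].
by apply/rowP => i; rewrite !mxE; ring.
Qed.

(** By convexity, shrinking by [1 / l] towards [a] divides the gap by at least [l], so the section
    at height [l * k] lies in the [l]-fold dilate of the one at height [k]. The exponent is [n] from
    the measure plus 2 from the homogeneity of [ramp2]. *)
Lemma Phi2_dilation a k (l : R) : 0 < k -> 1 <= l ->
  Phi2 a (l * k) <= l ^+ n.+2 * Phi2 a k.
Proof.
move=> k0 l1; have l0 : 0 < l by lra.
have c2 := cc_ramp2 a (l * k).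
have := J_affine ((1 - l) *: a) l0 c2.
rewrite -/(Phi2 a (l * k)) => E.
have -> : Phi2 a (l * k) = l ^+ n * J (fun x : 'rV[R]_n =>
    ramp2 (l * k - gap a ((1 - l) *: a + l *: x))).
  by rewrite E mulrA mulfV ?mul1r// expf_neq0// gt_eqF.
have -> : l ^+ n.+2 * Phi2 a k = l ^+ n * J (fun x => l ^+ 2 * ramp2 (k - gap a x)).
  by rewrite JZ; [rewrite mulrA -exprD addn2|exact: cc_ramp2].
rewrite ler_pM2l ?exprn_gt0//; apply: le_J.
- exact: (@cc_affine _ _ (fun x => ramp2 (l * k - gap a x)) _ _ (lt0r_neq0 l0) c2).
- exact/cc_scale/cc_ramp2.
move=> x; rewrite -ramp2Z ?(ltW l0)//; apply: ler_ramp2; rewrite mulrBr lerD2l lerN2.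
have t01 : 0 <= l^-1 <= 1 by rewrite invr_ge0 (ltW l0) invf_le1.
have := gap_scale ((1 - l) *: a + l *: x) (gap_refl f a) t01.
have -> : a + l^-1 *: ((1 - l) *: a + l *: x - a) = x.
  by apply/rowP => i; rewrite !mxE; field; rewrite gt_eqF.
by rewrite ler_pdivlMl.
Qed.

(* The new contact point minimises the gap minus the tilt over a compact section. *)
Lemma grad_range_open a : exists2 d, 0 < d &
  forall w, `|w| <= d -> exists b, grad f b = grad f a + w.
Proof.
have [r hr] := @bdd a 1 ltr01.
pose r1 := `|r| + `|a| + 1.
have r10 : 0 < r1 by rewrite ltr_wpDl// addr_ge0.
(* Keeps the tilt [dotv w (x - a)] within 1/2 on the section of height 1, so that the minimiser has
   gap at most 1/2 and is interior. The sup norm causes the dimension factor; [n.+1] keeps the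
   denominator nonzero. *)
exists (1 / (2 * n.+1%:R * r1)); first by rewrite divr_gt0// !mulr_gt0.
move=> w wd.
have wb x : gap a x <= 1 -> `|dotv w (x - a)| <= 1 / 2.
  move=> gx; apply: le_trans (norm_dotv_le _ _) _.
  have xa : `|x - a| <= r1.
    have := ler_normB x a; have := hr x gx; have := ler_norm r; rewrite /r1; lra.
  apply: (@le_trans _ _ (n.+1%:R * (1 / (2 * n.+1%:R * r1)) * r1)).
    by rewrite !ler_pM ?mulr_ge0// ler_nat.
  by rewrite le_eqVlt; apply/orP; left; apply/eqP; field; rewrite gt_eqF//= nat1r; apply/eqP; rewrite pnatr_eq0.
pose h x := gap a x - dotv w (x - a).
have hc : continuous h.
  by move=> x; apply: continuousB; [exact: gap_continuous|exact: dotvB_continuous].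
have [|||b bA bmin] := @EVT_min_rV R n h [set x | gap a x <= 1].
- by exists a; rewrite /= gap_refl.
- apply: (@compact_rV_bounded _ _ [set x | gap a x <= 1] r) => //.
  by apply: closed_le_continuous => x; exact: gap_continuous.
- exact: continuous_subspaceT.
rewrite inE /= in bA.
have hb : gap a b <= 1 / 2.
  have := bmin a; rewrite inE /= gap_refl ler01 => /(_ isT).
  rewrite /h gap_refl subrr dotv0r subrr => h0.
  have := wb b bA; rewrite ler_norml; lra.
exists b; apply: (grad_eq_of_support fd).
have : \forall x \near b, gap a x < 1.
  have h1 : gap a b < 1 by lra.
  have hl : gap a x @[x --> b] --> gap a b by exact: gap_continuous.
  exact: (cvgr_lt _ hl _ h1).
apply: filterS => x gx; have := bmin x; rewrite inE => /(_ (ltW gx)).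
rewrite /h !gapE -[x - a](subrKA b) !(dotvDr _ _ (b - a)) dotvDl; lra.
Qed.

(** Two gaps differ by an affine function. It is normalised at an arbitrary contact point [z] of the
    plane at [a], because centroids, not [a], serve as centres. *)
Lemma gap_shift a b z x : gap a z = 0 ->
  gap b x = gap a x - dotv (grad f b - grad f a) (x - z) + gap b z.
Proof.
rewrite !gapE => z0; rewrite -[x - b](subrKA z) -[x - a](subrKA z).
rewrite (dotvDr _ _ (z - b)) (dotvDr _ _ (z - a)) dotvBl; lra.
Qed.

Lemma sum_dotv_J (g : 'rV[R]_n -> R) w z : cc g ->
  J (fun x => dotv w (x - z) * g x) =
  dotv w (\row_i J (fun x => x 0 i * g x) - J g *: z).
Proof.
move=> gc.
have ci (i : 'I_n) : cc (fun x : 'rV[R]_n => x 0 i * g x).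
  by apply: (cc_mulr gc) => x; exact: coord_continuous.
have -> : (fun x => dotv w (x - z) * g x) =
   (fun x => \sum_(i < n) (w 0 i * (x 0 i * g x)) - dotv w z * g x).
  apply/funext => x; rewrite dotvBr mulrBl; congr (_ - _).
  by rewrite mulr_suml; apply: eq_bigr => i _; rewrite mulrA.
have JS (s : seq 'I_n) : cc (fun x => \sum_(i <- s) (w 0 i * (x 0 i * g x))) /\
    J (fun x => \sum_(i <- s) (w 0 i * (x 0 i * g x))) =
    \sum_(i <- s) (w 0 i * J (fun x => x 0 i * g x)).
  elim: s => [|i s [cs IH]].
    under eq_fun do rewrite big_nil; rewrite big_nil J0; split => //; exact: cc0.
  under eq_fun do rewrite big_cons; rewrite big_cons -IH -JZ// -JD//; last exact: cc_scale.
  by split => //; apply: cc_add => //; exact: cc_scale.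
have [cs JE] := JS (index_enum 'I_n).
rewrite JB//; last exact: cc_scale.
rewrite JE JZ// dotvBr dotvZr mulrC; congr (_ - _).
by apply: eq_bigr => i _; rewrite mxE.
Qed.

Hypothesis Phi3_eq : forall a b k, 0 < k -> Phi3 a k = Phi3 b k.

(* [Phi3 _ k] is constant, so by convexity the tangent plane at any [b] lies below
   the one at [a] on average; evaluated at the centroid [z] with [b = z] this makes [z]
   a contact point. *)
Lemma centroid a k : 0 < k -> exists z, gap a z = 0 /\
  forall w, J (fun x => dotv w (x - z) * ramp2 (k - gap a x)) = 0.
Proof.
move=> k0; have c2 := cc_ramp2 a k; have P0 := Phi2_gt0 a k0.
pose z : 'rV[R]_n := (Phi2 a k)^-1 *: \row_i J (fun x => x 0 i * ramp2 (k - gap a x)).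
have zw w : J (fun x => dotv w (x - z) * ramp2 (k - gap a x)) = 0.
  by rewrite sum_dotv_J// -/(Phi2 a k) scalerA mulfV ?gt_eqF// scale1r subrr dotv0r.
exists z; split => //; apply/eqP; rewrite eq_le gap_ge0// andbT.
pose al := gap a z.
have dE x : gap a x - gap z x = dotv (grad f z - grad f a) (x - z) + al.
  rewrite /al !gapE -[x - a](subrKA z) (dotvDr _ _ (z - a)) dotvBl; lra.
have le1 : J (fun x => (gap a x - gap z x) * ramp2 (k - gap a x)) <= Phi3 z k - Phi3 a k.
  have c3 := cc_ramp3.
  have cB : cc (fun x => ramp3 (k - gap z x) - ramp3 (k - gap a x)) by exact: ccB.
  rewrite /Phi3 -JB//; apply: le_J => //.
    apply: cc_mulr => // x; apply: continuousB; exact: gap_continuous.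
  move=> x; have := ramp3_convex (k - gap a x) (gap a x - gap z x).
  rewrite subrKA; lra.
move: le1; rewrite (Phi3_eq z a k0) subrr.
have -> : (fun x => (gap a x - gap z x) * ramp2 (k - gap a x)) =
  (fun x => dotv (grad f z - grad f a) (x - z) * ramp2 (k - gap a x) + al * ramp2 (k - gap a x)).
  by apply/funext => x; rewrite dE mulrDl.
rewrite JD; last 2 first.
- apply: cc_mulr => //; exact: dotvB_continuous.
- exact: cc_scale.
by rewrite zw add0r JZ// pmulr_lle0.
Qed.

End Levels.

(** * Asymptotics of large sections *)

Section Expansion.
Variables (R : realType) (n : nat) (f : 'rV[R]_n -> R).
Hypothesis fd : forall x, differentiable f x.
Hypothesis fconv : convex_fun f.
Hypothesis bdd : forall a k, 0 < k -> bounded_sublevel f a k.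
Local Notation gap := (gap f).
Local Notation Phi1 := (Phi1 f).
Local Notation Phi2 := (Phi2 f).
Local Notation Phi3 := (Phi3 f).

(** [Phi1] is the slope of [Phi2] in the height and [Phi2] that of [Phi3], and both vanish at height
    0; [slope_unique] therefore applies twice. *)
Lemma Phi3_eq_of_Phi1 :
  (forall a b k, 0 < k -> Phi1 a k = Phi1 b k) ->
  forall a b k, 0 < k -> Phi3 a k = Phi3 b k.
Proof.
move=> P1.
have P2 a b k : 0 < k -> Phi2 a k = Phi2 b k.
  move: k; apply: (@slope_unique _ (Phi1 a)).
  - by move=> s t _ _ st; have /andP[] := Phi2_slope fd bdd a st.
  - by move=> s t _ st; have /andP[] := Phi2_slope fd bdd a st.
  - by move=> s t _ t0 st; rewrite (P1 a b)//; have /andP[] := Phi2_slope fd bdd b st.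
  - by move=> s t s0 st; rewrite (P1 a b)//; have /andP[] := Phi2_slope fd bdd b st.
  - by rewrite !Phi2_at0.
  - by move=> t _; rewrite Phi2_at0//; apply: J_ge0 => x; exact: ramp2_ge0.
  - by move=> t _; rewrite Phi2_at0//; apply: J_ge0 => x; exact: ramp2_ge0.
have ramp3_ge0 (u : R) : 0 <= ramp3 u by rewrite mulr_ge0// exprn_ge0// ramp1_ge0.
move=> a b k; move: k; apply: (@slope_unique _ (Phi2 a)).
- by move=> s t _ _ st; have /andP[] := Phi3_slope fd bdd a st.
- by move=> s t _ st; have /andP[] := Phi3_slope fd bdd a st.
- by move=> s t _ t0 st; rewrite (P2 a b)//; have /andP[] := Phi3_slope fd bdd b st.
- by move=> s t s0 st; rewrite (P2 a b)//; have /andP[] := Phi3_slope fd bdd b st.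
- by rewrite !Phi3_at0.
- by move=> t _; rewrite Phi3_at0//; apply: J_ge0.
- by move=> t _; rewrite Phi3_at0//; apply: J_ge0.
Qed.

Hypothesis Phi3_eq : forall a b k, 0 < k -> Phi3 a k = Phi3 b k.

Lemma Phi2_le a s t : s <= t -> Phi2 a s <= Phi2 a t.
Proof.
move=> st; apply: le_J; [exact: cc_ramp2|exact: cc_ramp2|].
by move=> x; apply: ler_ramp2; rewrite lerD2r.
Qed.

(** The contact set of the plane at [a] lies in the bounded section of height 1, so [E] serves the
    centroids of all heights at once. *)
Lemma contact_bounded a b :
  exists2 E, 0 <= E & forall z, gap a z = 0 -> gap b z <= E.
Proof.
have [r hr] := @bdd a 1 ltr01.
have [E E0 hE] := continuous_bounded_ball r (@gap_continuous _ _ f fd b).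
exists E => // z z0; apply: le_trans (ler_norm _) (hE _ (hr _ _)).
by rewrite z0.
Qed.

Definition centroid_at a k z := gap a z = 0 /\
  forall w, J (fun x => dotv w (x - z) * ramp2 (k - gap a x)) = 0.

Variables a b : 'rV[R]_n.
Let w := grad f b - grad f a.

(** First-order Taylor remainder of [ramp3] when the cutting plane is tilted about [z] to the slope
    of the tangent plane at [b]. *)
Definition rem k z x := ramp3 (k - gap a x + dotv w (x - z)) - ramp3 (k - gap a x)
  - ramp2 (k - gap a x) * dotv w (x - z).

(** Tilting the cutting plane of height [k] about the contact point [z] gives the plane parallel to
    the tangent plane at [b] at height [k + gap b z]. *)
Lemma rem_split k z : gap a z = 0 ->
  rem k z = (fun x => (ramp3 (k + gap b z - gap b x) - ramp3 (k - gap a x))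
    - dotv w (x - z) * ramp2 (k - gap a x)).
Proof.
move=> z0; apply/funext => x; rewrite /rem [ramp2 _ * _]mulrC; congr (ramp3 _ - _ - _).
by rewrite (gap_shift b x z0) -/w; ring.
Qed.

Lemma cc_tilt_ramp2 k z v : cc (fun x => dotv v (x - z) * ramp2 (k - gap a x)).
Proof. by apply: cc_mulr; [exact: cc_ramp2|exact: dotvB_continuous]. Qed.

Lemma cc_rem k z : gap a z = 0 -> cc (rem k z).
Proof.
move=> z0; rewrite rem_split//; apply: ccB; last exact: cc_tilt_ramp2.
by apply: ccB; exact: cc_ramp3.
Qed.

(** The linear term vanishes at the centroid and [Phi3 b] may be replaced by [Phi3 a], so the
    integral is the increment of [Phi3 a] over a height step [gap b z]. *)
Lemma J_rem k z : 0 < k -> centroid_at a k z ->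
  gap b z * Phi2 a k <= J (rem k z) <= gap b z * Phi2 a (k + gap b z).
Proof.
move=> k0 [z0 zw]; have e0 := gap_ge0 fd fconv b z.
have -> : J (rem k z) = Phi3 a (k + gap b z) - Phi3 a k.
  rewrite rem_split// JB; [|by apply: ccB; exact: cc_ramp3|exact: cc_tilt_ramp2].
  rewrite zw subr0 JB; [|exact: cc_ramp3..].
  by rewrite -/(Phi3 b _) (Phi3_eq b a)// ltr_wpDr.
have := @Phi3_slope _ _ _ fd bdd a k (k + gap b z); rewrite addrAC subrr add0r.
by rewrite ![_ * gap b z]mulrC; apply; rewrite lerDl.
Qed.

(* [J_rem] at height [2 * s ^+ 2] bounds the mean of [|y|] over the section by O(s), and
   the copy of the section shrunk by 1/2 towards a point x0 turns this into a bound at x0. *)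
Lemma tilt_bound : exists2 C, 0 <= C & exists2 s0, 1 <= s0 &
  forall s, s0 <= s -> forall z x, gap a z = 0 -> gap a x <= s ^+ 2 ->
  `|dotv w (x - z)| <= C * s.
Proof.
have [E E0 hE] := contact_bounded a b.
(* In [C1], [3 ^+ n.+2] is the dilation factor from [K] to [3 * K], which is at least [2 * K + E],
   and 2/3 comes from the [s ^+ 2] term of [ramp3_lower]. In [C2], [2 ^+ n] is the Jacobian of
   halving and 8 undoes the factors 1/2 and 1/4 lost at midpoints by the tilt and by [g]. *)
pose C1 : R := 3 / 2 * (E * 3 ^+ n.+2 + 2 / 3).
pose C2 : R := (8 * 2 ^+ n + 1) * C1.
have p30 : 0 <= E * 3 ^+ n.+2 by rewrite mulr_ge0// exprn_ge0.
have p20 : 0 <= (2 : R) ^+ n by rewrite exprn_ge0.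
have C10 : 0 <= C1 by rewrite /C1; lra.
exists (2 * C2); first by rewrite /C2 !mulr_ge0//; lra.
exists (E + 1); first by lra.
move=> s sE; have s1 : 1 <= s by lra.
have s0 : 0 < s by lra.
pose K := s ^+ 2; have K0 : 0 < K by rewrite exprn_gt0.
have sK : s <= K by rewrite /K expr2 ler_peMr// ltW.
have EK : E <= K by lra.
have K2 : 0 < 2 * K by lra.
(* At height [2 * K] the argument [2 * K - gap a x] is at least [K] throughout the section of height
   [K], as [ramp3_lower] demands. *)
have [z' [z'0 z'w]] := centroid fd fconv bdd Phi3_eq a K2.
pose y x := dotv w (x - z').
pose g x := ramp2 (K - gap a x).
pose G x := `|y x| * g x.
have yc : continuous (fun x => `|y x|).
  move=> x; apply: (@continuous_comp _ _ _ y); first exact: dotvB_continuous.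
  exact: norm_continuous.
have cg : cc g by exact: cc_ramp2.
have Jg : J g = Phi2 a K by [].
have cG : cc G by exact: cc_mulr.
have P0 := Phi2_gt0 fd bdd a K0.
have JG : J G <= C1 * s * Phi2 a K.
  have h1 : J (rem (2 * K) z') <= E * 3 ^+ n.+2 * Phi2 a K.
    have /andP[_ h] := J_rem K2 (conj z'0 z'w); apply: le_trans h _.
    apply: (@le_trans _ _ (E * Phi2 a (3 * K))).
      rewrite ler_pM ?gap_ge0 ?hE//; first by apply: J_ge0 => x; exact: ramp2_ge0.
      by apply: Phi2_le; have := hE _ z'0; lra.
    rewrite -mulrA ler_wpM2l//; apply: Phi2_dilation => //; lra.
  have h2 : J (fun x => 2 / (3 * s) * G x - 2 / 3 * g x) <= J (rem (2 * K) z').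
    apply: le_J; [by apply: ccB; exact: cc_scale|exact: cc_rem|] => x.
    have [mK|/ltW Km] := leP (gap a x) K; last first.
      by rewrite /G /g ramp2_0 ?subr_le0// !mulr0 subrr; exact: ramp3_convex.
    have lo := @ramp3_lower R (2 * K - gap a x) (y x) K s (ltW s0) sK.
    have {}lo := lo (ltac:(lra)); have re0 := ramp3_convex (2 * K - gap a x) (y x).
    have m0 := gap_ge0 fd fconv a x.
    have g0 : 0 <= g x by exact: ramp2_ge0.
    have gK : g x <= 1 / 2 * K ^+ 2.
      rewrite /g /ramp2 ramp1_id ?subr_ge0// ler_pM2l//.
      by rewrite lerXn2r ?nnegrE ?subr_ge0 ?(ltW K0)// gerBl.
    (* Since [g x <= K ^+ 2 / 2], [l] lies in [0, 1]; scaling the nonnegative remainder down by [l]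
       inserts the weight [g] in the lower bound. *)
    pose l := 2 * g x / K ^+ 2.
    have l0 : 0 <= l by apply: divr_ge0; [apply: mulr_ge0|exact: sqr_ge0].
    have l1 : l <= 1 by rewrite /l ler_pdivrMr ?exprn_gt0//; lra.
    have -> : 2 / (3 * s) * G x - 2 / 3 * g x = l * (K / 3 * (s * `|y x| - s ^+ 2)).
      by rewrite /l /G /K; field; rewrite gt_eqF.
    apply: le_trans (_ : l * rem (2 * K) z' x <= _); first by rewrite ler_wpM2l.
    by rewrite ler_piMl.
  have {}h2 : 2 / (3 * s) * J G - 2 / 3 * Phi2 a K <= J (rem (2 * K) z').
    by rewrite -Jg -(JZ _ cG) -(JZ _ cg) -JB; [exact: h2|exact: cc_scale..].
  have h3 : 2 / (3 * s) * J G <= (E * 3 ^+ n.+2 + 2 / 3) * Phi2 a K by lra.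
  have -> : J G = (3 / 2 * s) * (2 / (3 * s) * J G) by field; rewrite gt_eqF.
  have -> : C1 * s * Phi2 a K = (3 / 2 * s) * ((E * 3 ^+ n.+2 + 2 / 3) * Phi2 a K).
    by rewrite /C1; ring.
  by rewrite ler_wpM2l// mulr_ge0// ltW.
have yb x0 : gap a x0 <= K -> `|y x0| <= C2 * s.
  move=> gx0; have h20 : 0 < 2^-1 :> R by rewrite invr_gt0.
  have JA := @J_affine R n G (2^-1 *: x0) 2^-1 h20 cG.
  have cA := @cc_affine R n G (2^-1 *: x0) 2^-1 (lt0r_neq0 h20) cG.
  (* At the midpoint [m] of [x0] and [x], convexity gives [g m >= g x / 4], and the size of [y m] is
     at least half the size of [y x0] minus half that of [y x]. *)
  have le1 : J (fun x => 1 / 8 * (`|y x0| * g x - G x)) <= 2 ^+ n * J G.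
    have -> : 2 ^+ n * J G = 2^-1 ^- n * J G by rewrite exprVn invrK.
    rewrite -JA; apply: le_J => //.
      by apply: cc_scale; apply: ccB => //; exact: cc_scale.
    move=> x; set m := 2^-1 *: x0 + 2^-1 *: x.
    have mid : gap a m <= 1 / 2 * gap a x0 + 1 / 2 * gap a x.
      have := @gap_convex _ _ f fconv a x0 x (1 / 2) (ltac:(lra)).
      have -> : (1 - 1 / 2) *: x0 + (1 / 2) *: x = m.
        by rewrite /m; congr (_ *: _ + _ *: _); field.
      lra.
    have gm : 1 / 4 * g x <= g m.
      have -> : 1 / 4 * g x = ramp2 (1 / 2 * (K - gap a x)).
        by rewrite ramp2Z//; rewrite /g; field.
      by apply: ler_ramp2; lra.
    have ym : 1 / 2 * (`|y x0| - `|y x|) <= `|y m|.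
      have -> : y m = 1 / 2 * (y x0 + y x).
        rewrite /y /m -dotvDr -dotvZr; congr (dotv _ _).
        by apply/rowP => i; rewrite !mxE; field.
      rewrite normrM ger0_norm ?divr_ge0//.
      by have := ler_normB (y x0 + y x) (y x); rewrite addrK; lra.
    have gx0' : 0 <= g x by exact: ramp2_ge0.
    have [neg|pos] := ltP (`|y x0|) (`|y x|).
      have : 0 <= G m by rewrite mulr_ge0// ramp2_ge0.
      have : (`|y x0| - `|y x|) * g x <= 0 by rewrite mulr_le0_ge0//; lra.
      by rewrite /G mulrBl; lra.
    have : 1 / 2 * (`|y x0| - `|y x|) * (1 / 4 * g x) <= G m.
      by rewrite /G ler_pM//; lra.
    by rewrite /G mulrBr mulrBl; lra.
  have {}le1 : 1 / 8 * (`|y x0| * Phi2 a K - J G) <= 2 ^+ n * J G.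
    rewrite -Jg -(JZ _ cg) -JB//; last exact: cc_scale.
    by rewrite -[X in X <= _]JZ; [exact: le1|apply: ccB => //; exact: cc_scale].
  rewrite -(ler_pM2r P0).
  have -> : C2 * s * Phi2 a K = 8 * 2 ^+ n * (C1 * s * Phi2 a K) + C1 * s * Phi2 a K.
    by rewrite /C2; ring.
  have : 8 * 2 ^+ n * J G <= 8 * 2 ^+ n * (C1 * s * Phi2 a K).
    by rewrite ler_wpM2l// mulr_ge0.
  lra.
move=> z x z0 gx.
have -> : dotv w (x - z) = y x - y z by rewrite /y -dotvBr opprB addrA subrK.
apply: le_trans (ler_normB _ _) _.
have := yb _ gx; have := yb z; rewrite z0 => /(_ (ltW K0)); lra.
Qed.

(** [J_rem] ties the remainder to [gap b z * Phi2 a K], Taylor's formula ties it to half the second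
    moment of the tilt. With [K = s ^+ 2] both errors are O(1/s) relative to [Phi2 a K]. *)
Lemma expansion : exists C s0 : R, forall s, s0 <= s -> 0 < s /\
  forall z, centroid_at a (s ^+ 2) z ->
  `|1 / 2 * J (fun x => dotv w (x - z) ^+ 2 * ramp1 (s ^+ 2 - gap a x))
     - gap b z * Phi2 a (s ^+ 2)| <= C / s * Phi2 a (s ^+ 2).
Proof.
have [E E0 hE] := contact_bounded a b.
have [C C0 [s1 s11 hC]] := tilt_bound.
pose c := 2 * C; have c0 : 0 <= c by rewrite mulr_ge0.
(* First term: the cubic Taylor error, measured on sections enlarged to [5 * K]. Second term:
   passing from height [K + gap b z] back to [K]. The threshold yields [c * s <= K] and [E <= K]. *)
exists (2 * c ^+ 3 * 5 ^+ n.+2 + E ^+ 2 * 2 ^+ n.+2), (s1 + E + c) => s ss.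
have s0 : 0 < s by lra.
split => // z zc; have [z0 zw] := zc.
set K := s ^+ 2; have K0 : 0 < K by rewrite exprn_gt0.
pose y x := dotv w (x - z).
have P0 := Phi2_gt0 fd bdd a K0.
have yin x : gap a x <= 4 * K -> `|y x| <= c * s.
  move=> gx; have := hC (2 * s) (ltac:(lra)) z x z0.
  rewrite exprMn -/K (_ : 2 ^+ 2 = 4 :> R); last by ring.
  by move=> /(_ gx); rewrite /c /y; lra.
(* Pulling [x] towards [z] until the gap is at most [4 * K] bounds the tilt by a quarter of the gap;
   beyond that section all terms of [rem] then vanish. *)
have yout x : 4 * K < gap a x -> y x <= gap a x / 4.
  move=> gx; have g0 : 0 < gap a x by lra.
  pose t := 4 * K / gap a x.
  have t01 : 0 <= t <= 1 by rewrite /t divr_ge0 ?(ltW g0)//= ?ler_pdivrMr//; lra.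
  have := gap_scale fconv x z0 t01; rewrite /t divfK ?gt_eqF// -/t => /yin.
  rewrite /y addrAC subrr add0r dotvZr => h.
  have {}h : t * dotv w (x - z) <= c * s by apply: le_trans (ler_norm _) h.
  have {h} : t * dotv w (x - z) <= K.
    by apply: le_trans h _; rewrite /K expr2 ler_wpM2r ?(ltW s0)//; lra.
  move=> {}h; have Kne : K != 0 by rewrite gt_eqF.
  have gne : gap a x != 0 by rewrite gt_eqF.
  have -> : gap a x / 4 = K * (gap a x / (4 * K)) by field.
  have -> : dotv w (x - z) = t * dotv w (x - z) * (gap a x / (4 * K)).
    by rewrite /t; field; rewrite gne Kne.
  by rewrite ler_wpM2r// divr_ge0 ?(ltW g0)// mulr_ge0// ltW.
have cq : cc (fun x => y x ^+ 2 * ramp1 (K - gap a x)).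
  apply: cc_mulr; first exact: cc_ramp1.
  have -> : (fun x => y x ^+ 2) = (fun x => y x * y x) by apply/funext => x; rewrite expr2.
  have yc : continuous y by exact: dotvB_continuous.
  exact: (@continuous_mul_fun _ _ y y yc yc).
have cr := cc_rem K z0.
have rem_close x : `|rem K z x - 1 / 2 * (y x ^+ 2 * ramp1 (K - gap a x))| <=
    2 * c ^+ 3 / s * ramp2 (5 * K - gap a x).
  have [gx|gx] := leP (gap a x) (4 * K); last first.
    have yx := yout x gx.
    rewrite /rem -/(y x) ramp3_0; last by lra.
    rewrite ramp3_0; last by lra.
    rewrite ramp2_0; last by lra.
    rewrite ramp1_0; last by lra.
    rewrite mul0r mulr0 mulr0 !subrr normr0.
    by rewrite mulr_ge0 ?ramp2_ge0// divr_ge0 ?(ltW s0)// mulr_ge0// exprn_ge0.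
  have := ramp3_taylor (K - gap a x) (y x); rewrite [ramp1 _ * _]mulrC => h.
  apply: le_trans h _.
  have h1 : `|y x| ^+ 3 <= (c * s) ^+ 3.
    by rewrite lerXn2r ?nnegrE ?yin// mulr_ge0// ltW.
  apply: le_trans h1 _.
  (* On the section of height [4 * K] the enlarged weight is at least [ramp2 K], that is
     [s ^+ 4 / 2], which absorbs [s ^+ 3] and leaves the factor [1 / s]. *)
  have h2 : ramp2 K <= ramp2 (5 * K - gap a x) by apply: ler_ramp2; lra.
  have -> : (c * s) ^+ 3 = 2 * c ^+ 3 / s * ramp2 K.
    by rewrite /ramp2 ramp1_id ?(ltW K0)// /K; field; rewrite gt_eqF.
  by rewrite ler_wpM2l// divr_ge0 ?(ltW s0)// mulr_ge0// exprn_ge0.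
have close : `|J (rem K z) - 1 / 2 * J (fun x => y x ^+ 2 * ramp1 (K - gap a x))| <=
    2 * c ^+ 3 * 5 ^+ n.+2 / s * Phi2 a K.
  have c3 : 0 <= 2 * c ^+ 3 / s by rewrite divr_ge0 ?(ltW s0)// mulr_ge0// exprn_ge0.
  apply: le_trans (_ : 2 * c ^+ 3 / s * Phi2 a (5 * K) <= _); last first.
    have -> : 2 * c ^+ 3 * 5 ^+ n.+2 / s * Phi2 a K = 2 * c ^+ 3 / s * (5 ^+ n.+2 * Phi2 a K) by ring.
    by rewrite ler_wpM2l//; apply: Phi2_dilation => //; lra.
  have c5 := cc_ramp2 fd bdd a (5 * K).
  rewrite -JZ// -JB//; last exact: cc_scale.
  rewrite -[X in _ <= _ * X]/(J (fun x => ramp2 (5 * K - gap a x))) -JZ//; apply: norm_J_le => //; last exact: cc_scale.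
  by apply: ccB => //; exact: cc_scale.
have e0 := gap_ge0 fd fconv b z; have eE := hE z z0.
have /andP[lo up] := J_rem K0 zc.
have KE : E <= K by rewrite /K expr2; apply: le_trans (_ : 1 * s <= _); [lra|rewrite ler_wpM2r//; lra].
have up2 : gap b z * Phi2 a (K + gap b z) <= gap b z * Phi2 a K + E ^+ 2 * 2 ^+ n.+2 / s * Phi2 a K.
  have h1 : Phi2 a (K + gap b z) <= (1 + 2 ^+ n.+2 * (E / K)) * Phi2 a K.
    apply: le_trans (_ : Phi2 a ((1 + E / K) * K) <= _).
      by apply: Phi2_le; rewrite mulrDl mul1r divfK ?gt_eqF// lerD2l.
    have EK0 : 0 <= E / K by rewrite divr_ge0// ltW.
    apply: le_trans (_ : (1 + E / K) ^+ n.+2 * Phi2 a K <= _).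
      by apply: Phi2_dilation => //; lra.
    rewrite ler_pM2r//; apply: le_trans (expr1D_le _ _) _.
      by rewrite EK0 ler_pdivrMr// mul1r.
    by rewrite lerD2l ler_wpM2r//; lra.
  apply: le_trans (ler_wpM2l e0 h1) _.
  have -> : gap b z * ((1 + 2 ^+ n.+2 * (E / K)) * Phi2 a K) =
    gap b z * Phi2 a K + gap b z * (2 ^+ n.+2 * (E / K) * Phi2 a K) by ring.
  rewrite lerD2l.
  have -> : E ^+ 2 * 2 ^+ n.+2 / s * Phi2 a K = E * (2 ^+ n.+2 * (E / s) * Phi2 a K) by ring.
  have EKs : E / K <= E / s.
    rewrite ler_wpM2l// lef_pV2// ?posrE//.
    by rewrite /K expr2 ler_peMr ?(ltW s0)//; lra.
  have p2 : 0 <= (2 : R) ^+ n.+2 by exact: exprn_ge0.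
  apply: ler_pM => //.
    by apply: mulr_ge0 (ltW P0); apply: mulr_ge0 => //; exact: divr_ge0 (ltW K0).
  by rewrite ler_pM2r// ler_wpM2l.
have -> : (2 * c ^+ 3 * 5 ^+ n.+2 + E ^+ 2 * 2 ^+ n.+2) / s * Phi2 a K =
  2 * c ^+ 3 * 5 ^+ n.+2 / s * Phi2 a K + E ^+ 2 * 2 ^+ n.+2 / s * Phi2 a K by ring.
move: close; rewrite !ler_norml => /andP[cl1 cl2].
have r0 : 0 <= E ^+ 2 * 2 ^+ n.+2 / s * Phi2 a K.
  apply: mulr_ge0 (ltW P0); apply: divr_ge0 (ltW s0).
  by apply: mulr_ge0; [exact: sqr_ge0|exact: exprn_ge0].
by apply/andP; split; lra.
Qed.

End Expansion.

(** * Quadratic functions *)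

Lemma cvgn_unique (R : realType) (u_ : nat -> R) (x y : R) :
  u_ @ \oo --> x -> u_ @ \oo --> y -> x = y.
Proof. by move=> h1 h2; rewrite -(cvg_lim (@Rhausdorff R) h1) -(cvg_lim (@Rhausdorff R) h2). Qed.

Lemma near_natS_ge (R : realType) (r : R) : \forall j \near \oo, r <= j.+1%:R.
Proof.
by apply: filterS (nbhs_infty_gtr r) => j h; rewrite (le_trans (ltW h))// ler_nat.
Qed.

Section BilinearLimit.
Variables (R : realType) (n : nat).
Implicit Types u v w : 'rV[R]_n.

Lemma linear_dotv (L : 'rV[R]_n -> R) :
  (forall u v, L (u + v) = L u + L v) -> (forall c v, L (c *: v) = c * L v) ->
  forall v, L v = dotv (\row_i L (delta_mx 0 i)) v.
Proof.
move=> LD LZ v; have L0 : L 0 = 0 by rewrite -(scale0r 0) LZ mul0r.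
rewrite {1}[v]row_sum_delta (big_morph L LD L0); apply: eq_bigr => i _.
by rewrite LZ mxE mulrC.
Qed.

Lemma bilinear_dotv (B : 'rV[R]_n -> 'rV[R]_n -> R) :
  (forall v w, B v w = B w v) ->
  (forall u v w, B u (v + w) = B u v + B u w) -> (forall c u v, B u (c *: v) = c * B u v) ->
  exists2 S : 'M[R]_n, S^T = S & forall v w, B v w = dotv (v *m S) w.
Proof.
move=> Bs BD BZ; exists (\matrix_(i, j) B (delta_mx 0 i) (delta_mx 0 j)).
  by apply/matrixP => i j; rewrite !mxE Bs.
move=> v w; rewrite (linear_dotv (BD v) (fun c => BZ c v)); congr dotv.
apply/rowP => j; rewrite !mxE Bs (linear_dotv (BD _) (fun c => BZ c _)) dotvC.
by apply: eq_bigr => i _; rewrite !mxE Bs.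
Qed.

(* Polarisation and scaling turn convergence near 0 into convergence everywhere. *)
Lemma bilinear_limit (B_ : nat -> 'rV[R]_n -> 'rV[R]_n -> R) (l_ : nat -> 'rV[R]_n -> R)
    (E : 'rV[R]_n -> R) (d : R) : 0 < d ->
  (forall j v w, B_ j v w = B_ j w v) ->
  (forall j u v w, B_ j u (v + w) = B_ j u v + B_ j u w) ->
  (forall j c u v, B_ j u (c *: v) = c * B_ j u v) ->
  (forall j u v, l_ j (u + v) = l_ j u + l_ j v) ->
  (forall j c v, l_ j (c *: v) = c * l_ j v) ->
  (forall w, `|w| <= d -> 1 / 2 * B_ j w w + l_ j w @[j --> \oo] --> E w) ->
  exists (B : 'rV[R]_n -> 'rV[R]_n -> R) (l : 'rV[R]_n -> R),
    [/\ forall v w, B_ j v w @[j --> \oo] --> B v w, forall w, l_ j w @[j --> \oo] --> l w,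
     [/\ forall v w, B v w = B w v,
      forall u v w, B u (v + w) = B u v + B u w & forall c u v, B u (c *: v) = c * B u v] &
      (forall u v, l (u + v) = l u + l v) /\ forall c v, l (c *: v) = c * l v].
Proof.
move=> d0 Bs BD BZ lD lZ cE.
have small w : exists2 t, 0 < t & `|t *: w| <= d.
  exists (d / (`|w| + 1)); first by rewrite divr_gt0// ltr_wpDl.
  rewrite normrZ ger0_norm; last by rewrite divr_ge0 ?(ltW d0)// addr_ge0.
  by rewrite mulrAC ler_pdivrMr ?ltr_wpDl// ler_wpM2l ?(ltW d0)// lerDl.
have BNN j w : B_ j (- w) (- w) = B_ j w w.
  by rewrite -scaleN1r BZ (Bs j _ w) BZ; ring.
have BZZ j t w : B_ j (t *: w) (t *: w) = t ^+ 2 * B_ j w w.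
  by rewrite BZ (Bs j _ w) BZ mulrA expr2.
have lN j w : l_ j (- w) = - l_ j w by rewrite -scaleN1r lZ; ring.
have clq w : cvgn (fun j => l_ j w) /\ cvgn (fun j => B_ j w w).
  have [t t0 tw] := small w.
  have c1 := cE _ tw; have /cE c2 : `|- (t *: w)| <= d by rewrite normrN.
  have tne : t != 0 by rewrite gt_eqF.
  split; apply/cvg_ex.
  - exists ((2 * t)^-1 * (E (t *: w) - E (- (t *: w)))).
    have -> : (fun j => l_ j w) = (fun j => (2 * t)^-1 *
       (1 / 2 * B_ j (t *: w) (t *: w) + l_ j (t *: w) -
       (1 / 2 * B_ j (- (t *: w)) (- (t *: w)) + l_ j (- (t *: w))))).
      by apply/funext => j; rewrite BNN lN lZ; field.
    by apply: cvgMr; exact: cvgB c1 c2.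
  - exists ((t ^+ 2)^-1 * (E (t *: w) + E (- (t *: w)))).
    have -> : (fun j => B_ j w w) = (fun j => (t ^+ 2)^-1 *
       (1 / 2 * B_ j (t *: w) (t *: w) + l_ j (t *: w) +
       (1 / 2 * B_ j (- (t *: w)) (- (t *: w)) + l_ j (- (t *: w))))).
      by apply/funext => j; rewrite BNN lN BZZ; field.
    by apply: cvgMr; exact: cvgD c1 c2.
have cB v w : cvgn (fun j => B_ j v w).
  have /cvg_ex[/= x1 h1] := (clq (v + w)).2; have /cvg_ex[/= x2 h2] := (clq (v - w)).2.
  apply/cvg_ex; exists (1 / 4 * (x1 - x2)).
  have -> : (fun j => B_ j v w) = (fun j => 1 / 4 * (B_ j (v + w) (v + w) - B_ j (v - w) (v - w))).
    apply/funext => j; have BDD u u' : B_ j (u + u') (u + u') =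
        B_ j u u + 2 * B_ j u u' + B_ j u' u'.
      by rewrite BD (Bs j _ u) (Bs j _ u') !BD (Bs j u' u); ring.
    by rewrite !BDD BNN -[- w]scaleN1r BZ; field.
  by apply: cvgMr; exact: cvgB h1 h2.
pose B v w := lim (B_ j v w @[j --> \oo]).
pose l w := lim (l_ j w @[j --> \oo]).
have BE v w : B_ j v w @[j --> \oo] --> B v w by exact: cB.
have lE w : l_ j w @[j --> \oo] --> l w by exact: (clq w).1.
exists B, l; split => //; split => //.
- by move=> v w; apply: (cvgn_unique (BE v w)); under eq_fun do rewrite Bs; exact: BE.
- move=> u v w; apply: (cvgn_unique (BE u (v + w))); under eq_fun do rewrite BD.
  by apply: cvgD; exact: BE.
- move=> c u v; apply: (cvgn_unique (BE u (c *: v))); under eq_fun do rewrite BZ.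
  by apply: cvgMr; exact: BE.
- move=> u v; apply: (cvgn_unique (lE (u + v))); under eq_fun do rewrite lD.
  by apply: cvgD; exact: lE.
- move=> c v; apply: (cvgn_unique (lE (c *: v))); under eq_fun do rewrite lZ.
  by apply: cvgMr; exact: lE.
Qed.

End BilinearLimit.

Section Quadratic.
Variables (R : realType) (n : nat) (f : 'rV[R]_n -> R).
Hypothesis fd : forall x, differentiable f x.
Hypothesis fconv : convex_fun f.
Hypothesis bdd : forall a k, 0 < k -> bounded_sublevel f a k.
Local Notation gap := (gap f).
Local Notation Phi2 := (Phi2 f).
Hypothesis Phi3_eq : forall a b k, 0 < k -> Phi3 f a k = Phi3 f b k.

(** Second-moment form about [z], weighted by [ramp1] but normalised by [Phi2]: the quotient that
    [expansion] compares with [gap b z]. *)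
Definition cov a k z v w :=
  J (fun x => dotv v (x - z) * (dotv w (x - z) * ramp1 (k - gap a x))) / Phi2 a k.

Lemma cc_cov a k z v w :
  cc (fun x => dotv v (x - z) * (dotv w (x - z) * ramp1 (k - gap a x))).
Proof.
apply: cc_mulr; last exact: dotvB_continuous.
by apply: cc_mulr; [exact: cc_ramp1|exact: dotvB_continuous].
Qed.

Lemma covC a k z v w : cov a k z v w = cov a k z w v.
Proof. by congr (J _ / _); apply/funext => x; rewrite mulrCA. Qed.

Lemma covDr a k z u v w : cov a k z u (v + w) = cov a k z u v + cov a k z u w.
Proof.
rewrite /cov -mulrDl -JD; [|exact: cc_cov..]; congr (J _ / _).
by apply/funext => x; rewrite dotvDl; ring.
Qed.

Lemma covZr a k z (c : R) u v : cov a k z u (c *: v) = c * cov a k z u v.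
Proof.
rewrite /cov mulrA -JZ; last exact: cc_cov; congr (J _ / _).
by apply/funext => x; rewrite dotvZl; ring.
Qed.

(** The centroids depend on [a] alone, so one sequence of forms serves every [b]. They are contact
    points, hence [gap b (z_ j)] differs from [gap b a] by a linear form in [w]. The heights
    [j.+1%:R ^+ 2] are the [s ^+ 2] of [expansion]. *)
Lemma cov_limit a : exists z_ : nat -> 'rV[R]_n,
  forall b, let w := grad f b - grad f a in
  1 / 2 * cov a (j.+1%:R ^+ 2) (z_ j) w w + dotv w (z_ j - a) @[j --> \oo] --> gap b a.
Proof.
have K0 j : 0 < (j.+1%:R ^+ 2 : R) by rewrite exprn_gt0.
pose z_ j := sval (cid (centroid fd fconv bdd Phi3_eq a (K0 j))).
have zc j : centroid_at f a (j.+1%:R ^+ 2) (z_ j) := svalP (cid (centroid fd fconv bdd Phi3_eq a (K0 j))).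
exists z_ => b w; have [C [s0 hC]] := @expansion _ _ _ fd fconv bdd Phi3_eq a b.
apply/cvgrPdist_le => e e0; near=> j.
have js : s0 <= j.+1%:R by near: j; exact: near_natS_ge.
have je : `|C| / j.+1%:R <= e.
  rewrite ler_pdivrMr// mulrC -ler_pdivrMr//; near: j; exact: near_natS_ge.
have [j0 /(_ _ (zc j))] := hC _ js.
have P0 := @Phi2_gt0 _ _ _ fd bdd a _ (K0 j).
have -> : gap b (z_ j) = gap b a - dotv w (z_ j - a).
  by rewrite (gap_shift b (z_ j) (gap_refl f a)) (zc j).1 -/w; ring.
have -> : J (fun x => dotv w (x - z_ j) ^+ 2 * ramp1 (j.+1%:R ^+ 2 - gap a x)) =
    cov a (j.+1%:R ^+ 2) (z_ j) w w * Phi2 a (j.+1%:R ^+ 2).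
  rewrite /cov divfK ?gt_eqF//; congr J; apply/funext => x.
  by rewrite expr2 mulrA.
rewrite mulrA -mulrBl normrM (gtr0_norm P0) ler_pM2r// => h.
rewrite distrC; apply: le_trans je.
apply: le_trans (_ : C / j.+1%:R <= _); last by rewrite ler_wpM2r ?invr_ge0// ler_norm.
by move: h; rewrite opprB addrA -addrA; congr (`|_| <= _); ring.
Unshelve. all: by end_near. Qed.

(* In terms of [w b], [gap b a] is the convex conjugate of f up to an affine function, so
   its gradient at [w b] is [b - a]. *)
Lemma quadratic_of_Phi3 a : exists X : 'M[R]_n,
  [/\ X^T = X, X \in unitmx &
   forall v, f (a + v) = f a + dotv (grad f a) v + 1 / 2 * dotv v (v *m X)].
Proof.
have [z_ zE] := cov_limit a.
have [d d0 hd] := grad_range_open fd bdd a.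
pose w b := grad f b - grad f a.
have hw v : `|v| <= d -> exists b, w b = v.
  by move=> /hd[b hb]; exists b; rewrite /w hb addrAC subrr add0r.
(* Reads [gap b a] as a function of the slope difference through a chosen [b]; the default [a] of
   [xget] occurs only for slopes that are not attained, none of which has norm at most [d]. *)
pose Ev v := gap (xget a [set b | w b = v]) a.
have [||||||B [l [cB cl [Bs BD BZ] [lD lZ]]]] := @bilinear_limit _ _
  (fun j => cov a (j.+1%:R ^+ 2) (z_ j)) (fun j v => dotv v (z_ j - a)) Ev d d0.
- by move=> j v u; exact: covC.
- by move=> j u v u'; exact: covDr.
- by move=> j c u v; exact: covZr.
- by move=> j u v; exact: dotvDl.
- by move=> j c v; exact: dotvZl.
- move=> v /hw[b hb]; rewrite /Ev; case: xgetP => [b' _ /= <-|/(_ b)/(_ hb)//].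
  exact: zE.
have gapB b : gap b a = 1 / 2 * B (w b) (w b) + l (w b).
  apply: (cvgn_unique (zE b)).
  by apply: cvgD => //; apply: cvgMr; exact: cB.
have key b v : B (w b) v + l v = dotv v (b - a).
  have [db db0 hdb] := grad_range_open fd bdd b.
  (* This is [0 <= gap c b] for a point [c] of slope [grad f b + u], with [gap c a] and [gap b a]
     expanded by [gapB]. *)
  have le1 u : `|u| <= db -> 0 <= B (w b) u + l u - dotv u (b - a) + 1 / 2 * B u u.
    move=> /hdb[c hc].
    have wc : w c = w b + u by rewrite /w hc addrAC.
    have := gap_shift c a (gap_refl f b); rewrite hc [grad f b + u - _]addrAC subrr add0r.
    have := gap_ge0 fd fconv c b; rewrite !gapB wc lD.
    have -> : B (w b + u) (w b + u) = B (w b) (w b) + 2 * B (w b) u + B u u.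
      rewrite (BD _ (w b) u) (Bs (w b + u) (w b)) (Bs (w b + u) u).
      by rewrite !(BD _ (w b) u) (Bs u (w b)); ring.
    by rewrite -[a - b]opprB dotvNr; lra.
  have half v' : 0 <= B (w b) v' + l v' - dotv v' (b - a).
    set L := _ - _; rewrite leNgt; apply/negP => L0.
    (* [t1] keeps [t *: v'] among the attained slope increments, [t2] makes the quadratic term at
       most half of [- L], so a negative linear part would win. *)
    pose t1 := db / (`|v'| + 1); pose t2 := - L / (`|B v' v'| + 1).
    have t10 : 0 < t1 by rewrite divr_gt0// ltr_wpDl.
    have t20 : 0 < t2 by rewrite divr_gt0 ?oppr_gt0// ltr_wpDl.
    pose t := Num.min t1 t2.
    have t0 : 0 < t by rewrite lt_min t10.
    have tt1 : t <= t1 by rewrite ge_min lexx.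
    have tt2 : t <= t2 by rewrite ge_min lexx orbT.
    have tv : `|t *: v'| <= db.
      rewrite normrZ (gtr0_norm t0); move: tt1; rewrite /t1 ler_pdivlMr ?ltr_wpDl//.
      by apply: le_trans; rewrite ler_wpM2l ?(ltW t0)// lerDl.
    have := le1 _ tv; rewrite BZ lZ dotvZl BZ (Bs (t *: v') v') BZ.
    have -> : t * B (w b) v' + t * l v' - t * dotv v' (b - a) + 1 / 2 * (t * (t * B v' v')) =
       t * (L + 1 / 2 * (t * B v' v')) by rewrite /L; ring.
    rewrite pmulr_rge0//.
    have h1 : t * B v' v' <= t * (`|B v' v'| + 1).
      by rewrite ler_wpM2l ?(ltW t0)// (le_trans (ler_norm _))// lerDl.
    have : t * (`|B v' v'| + 1) <= - L by rewrite -ler_pdivlMr ?ltr_wpDl.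
    lra.
  have := half v; have := half (- v).
  have -> : B (w b) (- v) = - B (w b) v by rewrite -scaleN1r BZ mulN1r.
  have -> : l (- v) = - l v by rewrite -scaleN1r lZ mulN1r.
  by rewrite dotvNl; lra.
have waa : w a = 0 by rewrite /w subrr.
(* At [b = a] both the slope difference and [b - a] vanish, so [key] leaves only the linear form. *)
have l0 v : l v = 0.
  have := key a v; rewrite waa subrr dotv0r Bs -(scale0r 0) BZ mul0r add0r; exact.
have [S St SE] := bilinear_dotv Bs BD BZ.
have wS b : w b *m S = b - a.
  by apply: dotv_ext => v; rewrite -SE (dotvC (b - a)) -key l0 addr0.
(* The rows are the slope differences at the points a + e_i, so [wS] says that [X] inverts [S]; it
   is the Hessian of [f]. *)
pose X : 'M[R]_n := \matrix_i w (a + delta_mx 0 i).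
have XS : X *m S = 1%:M.
  apply/row_matrixP => i; rewrite row_mul rowK wS addrAC subrr add0r row1 //.
have SX : S *m X = 1%:M by exact: mulmx1C.
have wX b : w b = (b - a) *m X by rewrite -wS -mulmxA SX mulmx1.
exists X; split.
- rewrite -[LHS]mul1mx -XS -mulmxA -{1}St -trmx_mul XS trmx1 mulmx1 //.
- by have [] := mulmx1_unit XS.
- move=> v; have := gapB (a + v); rewrite l0 addr0 SE wS [a + v - a]addrAC subrr add0r.
  rewrite gapE -[a - (a + v)]opprB [a + v - a]addrAC subrr add0r dotvNr.
  have -> : grad f (a + v) = grad f a + w (a + v) by rewrite /w subrKC.
  rewrite dotvDl wX [a + v - a]addrAC subrr add0r (dotvC (v *m X)); lra.
Qed.

End Quadratic.

(** * Areas of sections *)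

Section AreaSlopes.
Variables (R : realType) (n : nat) (f : 'rV[R]_n -> R).
Hypothesis fd : forall x, differentiable f x.
Hypothesis fconv : convex_fun f.
Hypothesis bdd : forall a k, 0 < k -> bounded_sublevel f a k.
Local Notation gap := (gap f).
Local Notation Phi1 := (Phi1 f).

Lemma Vstar_Phi1 a k : Vstar f a k = (Phi1 a k)%:E.
Proof. by rewrite Vstar_eJ -eJ_EFin; [|exact: cc_ramp1]. Qed.

(** The difference quotient [chi] of ramps is 1 on the section of height [s] and 0 outside the one
    of height [t]: a continuous function between the two indicators. *)
Lemma Astar_slope a s t : s < t ->
  (Astar f a s <= (Wfun f a * ((Phi1 a t - Phi1 a s) / (t - s)))%:E)%E /\
  ((Wfun f a * ((Phi1 a t - Phi1 a s) / (t - s)))%:E <= Astar f a t)%E.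
Proof.
move=> st; have ts0 : 0 < t - s by rewrite subr_gt0.
pose chi x := (t - s)^-1 * (ramp1 (t - gap a x) - ramp1 (s - gap a x)).
have c1 := cc_ramp1 fd bdd a.
have cchi : cc chi by apply: cc_scale; exact: ccB.
have JE : (Phi1 a t - Phi1 a s) / (t - s) = J chi.
  by rewrite JZ; [rewrite JB// mulrC|exact: ccB].
have chi0 x : 0 <= chi x.
  by rewrite mulr_ge0 ?invr_ge0 ?(ltW ts0)// subr_ge0 ler_ramp1// lerD2r ltW.
have chi1 x : chi x <= 1.
  rewrite /chi ler_pdivrMl// mulr1.
  have [h1|/ltW h1] := leP 0 (t - gap a x); last by rewrite !ramp1_0; lra.
  have [h2|/ltW h2] := leP 0 (s - gap a x); first by rewrite !ramp1_id//; lra.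
  by rewrite ramp1_id// ramp1_0//; lra.
rewrite JE; split.
- apply: Astar_le => // x gx; rewrite /chi !ramp1_id; [|lra..].
  have -> : t - gap a x - (s - gap a x) = t - s by ring.
  by rewrite mulVf// gt_eqF.
- apply: Astar_ge => // [x|x]; first by rewrite chi0 chi1.
  move=> /eqP chine; rewrite leNgt; apply/negP => gx; apply: chine.
  by rewrite /chi !ramp1_0 ?subrr ?mulr0//; lra.
Qed.

Lemma Phi1_eq_of_Vstar (phi : R -> R) :
  (forall a k, 0 < k -> Vstar f a k = (phi k)%:E) ->
  forall a b k, 0 < k -> Phi1 a k = Phi1 b k.
Proof. by move=> V a b k k0; apply: EFin_inj; rewrite -!Vstar_Phi1 !V. Qed.

(** [psi] is squeezed between difference quotients of [Phi1] on either side, for every base point;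
    it thus plays the slope [g] in [slope_unique]. *)
Lemma Phi1_eq_of_Astar (psi : R -> R) :
  (forall a k, 0 < k -> Astar f a k = (Wfun f a * psi k)%:E) ->
  forall a b k, 0 < k -> Phi1 a k = Phi1 b k.
Proof.
move=> A.
have up a s t : 0 <= s -> 0 < t -> s <= t -> Phi1 a t - Phi1 a s <= psi t * (t - s).
  move=> s0 t0; rewrite le_eqVlt => /predU1P[->|st]; first by rewrite !subrr mulr0.
  have [_] := Astar_slope a st; rewrite A// lee_fin ler_pM2l ?Wfun_gt0//.
  by rewrite ler_pdivrMr// subr_gt0.
have lo a s t : 0 < s -> s <= t -> psi s * (t - s) <= Phi1 a t - Phi1 a s.
  move=> s0; rewrite le_eqVlt => /predU1P[->|st]; first by rewrite !subrr mulr0.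
  have [+ _] := Astar_slope a st; rewrite A// lee_fin ler_pM2l ?Wfun_gt0//.
  by rewrite ler_pdivlMr// subr_gt0.
move=> a b k; move: k; apply: (slope_unique (up a) (lo a) (up b) (lo b)).
- by rewrite !Phi1_at0.
- by move=> t _; rewrite Phi1_at0//; apply: J_ge0 => x; exact: ramp1_ge0.
- by move=> t _; rewrite Phi1_at0//; apply: J_ge0 => x; exact: ramp1_ge0.
Qed.

End AreaSlopes.

(** * Spectral theorem for real symmetric matrices *)

Section Spectral.
Variable R : realType.

Lemma dotv_mx (n : nat) (u v : 'rV[R]_n) : dotv u v = (u *m v^T) 0 0.
Proof. by rewrite mxE; apply: eq_bigr => i _; rewrite mxE. Qed.

Lemma dotv_mulmx (n m : nat) (u : 'rV[R]_n) (v : 'rV[R]_m) (A : 'M[R]_(n, m)) :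
  dotv (u *m A) v = dotv u (v *m A^T).
Proof. by rewrite !dotv_mx trmx_mul trmxK mulmxA. Qed.

Lemma dotv_orthogonal (n : nat) (u v : 'rV[R]_n) (O : 'M[R]_n) : O *m O^T = 1%:M ->
  dotv (u *m O) (v *m O) = dotv u v.
Proof. by move=> OO; rewrite dotv_mulmx -mulmxA OO mulmx1. Qed.

Lemma quadratic_continuous (n : nat) (X : 'M[R]_n) :
  continuous (fun v : 'rV[R]_n => dotv v (v *m X)).
Proof.
have -> : (fun v : 'rV[R]_n => dotv v (v *m X)) =
  (fun v => \sum_(i < n) v 0 i * dotv (\row_j X j i) v).
  apply/funext => v; apply: eq_bigr => i _; congr (_ * _).
  by rewrite mxE; apply: eq_bigr => j _; rewrite mxE mulrC.
elim: (index_enum 'I_n) => [|i s IH].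
  by under eq_fun do rewrite big_nil; exact: cst_continuous.
under eq_fun do rewrite big_cons.
apply: continuous_add_fun; last exact: IH.
by apply: continuous_mul_fun; [exact: coord_continuous|exact: dotv_continuous].
Qed.

(* A maximiser of the Rayleigh quotient is an eigenvector. *)
Lemma sym_eigenvector (n : nat) (X : 'M[R]_n.+1) : X^T = X ->
  exists2 u : 'rV[R]_n.+1, dotv u u = 1 & exists l, u *m X = l *: u.
Proof.
move=> Xs; pose q v := dotv v (v *m X).
pose A := [set v : 'rV[R]_n.+1 | dotv v v = 1].
have entry_le (v : 'rV[R]_n.+1) i : v 0 i ^+ 2 <= dotv v v.
  rewrite /dotv (bigD1 i)//= -expr2 lerDl; apply: sumr_ge0 => j _.
  by rewrite -expr2 sqr_ge0.
have [|||u uA umax] := @EVT_max_rV R n.+1 q A.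
- exists (delta_mx 0 0); rewrite /A /= dotv_delta mxE !eqxx //.
- apply: (@compact_rV_bounded _ _ A 1).
    have -> : A = (fun v : 'rV[R]_n.+1 => dotv v v) @^-1` [set 1] by [].
    have : continuous (fun v : 'rV[R]_n.+1 => dotv v v).
      by have := @quadratic_continuous n.+1 1%:M; under eq_fun do rewrite mulmx1.
    by move=> /continuous_closedP; apply; exact: closed_eq.
  move=> v Av; apply/mx_norm_leP => // i j; rewrite (ord1 i).
  by rewrite -(@ler_pXn2r _ 2)// ?nnegrE// real_normK ?num_real// expr1n -Av.
- exact/continuous_subspaceT/quadratic_continuous.
rewrite inE /A /= in uA; exists u => //; exists (q u).
have psd v : 0 <= q u * dotv v v - q v.
  have [v0|v0] := eqVneq (dotv v v) 0.
    by rewrite (dotv_eq0 v0) /q !dotv0l mulr0 subrr.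
  have vp : 0 < dotv v v by rewrite lt_def v0 dotv_ge0.
  pose s := (Num.sqrt (dotv v v))^-1.
  have s2 : s ^+ 2 = (dotv v v)^-1 by rewrite exprVn sqr_sqrtr// ltW.
  have := umax (s *: v); rewrite inE /A /= dotvZl dotvZr mulrA -expr2 s2 mulVf// => /(_ erefl).
  rewrite /q -scalemxAl dotvZl dotvZr mulrA -expr2 s2 ler_pdivrMl// subr_ge0 mulrC; exact.
apply: dotv_ext => v; rewrite dotvZl; apply/eqP; rewrite -subr_eq0; apply/eqP.
set L := _ - _.
have bil t : 0 <= t * (t * (q u * dotv v v - q v)) - 2 * t * L.
  have := psd (u + t *: v).
  have -> : q (u + t *: v) = q u + 2 * t * dotv (u *m X) v + t ^+ 2 * q v.
    rewrite /q mulmxDl -scalemxAl !dotvDl !dotvDr !dotvZl !dotvZr.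
    rewrite (dotvC v (u *m X)) -[dotv u (v *m X)](_ : dotv (u *m X) v = _); last first.
      by rewrite dotv_mulmx Xs.
    ring.
  have -> : dotv (u + t *: v) (u + t *: v) = 1 + 2 * t * dotv u v + t ^+ 2 * dotv v v.
    by rewrite !dotvDl !dotvDr !dotvZl !dotvZr (dotvC v u) uA; ring.
  by rewrite /L; lra.
apply/eqP; rewrite -normr_le0 leNgt; apply/negP => Lp.
set P := q u * dotv v v - q v in bil.
have P0 : 0 <= P by exact: psd.
have Lne : L != 0 by rewrite -normr_gt0.
(* The minimiser [L / P] of the quadratic in t, with [P + 1] in place of a possibly zero [P]. *)
have := bil (L / (P + 1)).
have -> : L / (P + 1) * (L / (P + 1) * P) - 2 * (L / (P + 1)) * L =
  - (L ^+ 2 * (P + 2) / (P + 1) ^+ 2) by field; rewrite gt_eqF//; lra.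
rewrite oppr_ge0 leNgt => /negP; apply.
by rewrite divr_gt0 ?exprn_gt0//; [rewrite mulr_gt0// ?exprn_even_gt0//; lra|lra].
Qed.

(** The reflection in the hyperplane orthogonal to [u - e] swaps the first basis vector [e] and the
    unit vector [u]; it moves an eigenvector to the first axis for [spectral_sym]. *)
Lemma householder (n : nat) (u : 'rV[R]_n.+1) : dotv u u = 1 ->
  exists2 H : 'M[R]_n.+1, H *m H^T = 1%:M & delta_mx 0 0 *m H = u.
Proof.
move=> u1; pose e : 'rV[R]_n.+1 := delta_mx 0 0; pose y := u - e.
have [y0|y0] := eqVneq (dotv y y) 0.
  exists 1%:M; first by rewrite trmx1 mulmx1.
  by rewrite mulmx1; apply/esym/eqP; rewrite -subr_eq0; apply/eqP; exact: dotv_eq0 y0.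
have ee : dotv e e = 1 by rewrite dotv_delta mxE !eqxx.
pose c := 2 / dotv y y.
pose H : 'M[R]_n.+1 := 1%:M - c *: (y^T *m y).
have HT : H^T = H by rewrite /H linearB linearZ /= trmx1 trmx_mul trmxK.
have yy : y *m y^T = (dotv y y)%:M.
  by apply/matrixP => i j; rewrite !ord1 dotv_mx [RHS]mxE eqxx mulr1n.
exists H.
  have : (y^T *m y) *m (y^T *m y) = dotv y y *: (y^T *m y).
    by rewrite mulmxA -(mulmxA y^T) yy mul_mx_scalar -scalemxAl.
  rewrite HT /H; move: (y^T *m y) => P PP.
  rewrite mulmxBl mul1mx -scalemxAl mulmxBr mulmx1 -scalemxAr PP.
  by apply/matrixP => i j; rewrite !mxE /c; field.
rewrite /H mulmxBr mulmx1 -scalemxAr mulmxA.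
have -> : delta_mx 0 0 *m y^T = (dotv e y)%:M.
  by apply/matrixP => i j; rewrite !ord1 dotv_mx [RHS]mxE eqxx mulr1n.
rewrite mul_scalar_mx scalerA.
have -> : c * dotv e y = -1.
  have yE : dotv y y = - 2 * dotv e y.
    by rewrite /y dotvBl !dotvBr ee u1 (dotvC u e); ring.
  have : dotv e y != 0 by apply: contraNneq y0 => h; rewrite yE h mulr0.
  by rewrite /c yE => h; field.
by rewrite scaleN1r opprK /y addrC subrK.
Qed.

(** Deflation: once a unit eigenvector is the first basis vector, symmetry clears the first row and
    column off the diagonal, and the induction hypothesis diagonalises the remaining block. *)
Lemma spectral_sym (n : nat) (X : 'M[R]_n) : X^T = X ->
  exists (O : 'M[R]_n) (d : 'rV[R]_n), O *m O^T = 1%:M /\ X = O^T *m diag_mx d *m O.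
Proof.
elim: n X => [|n IH] X Xs.
  by exists 1%:M, 0; split; apply/matrixP => -[].
have [u u1 [l ul]] := sym_eigenvector Xs.
have [H HH eH] := householder u1.
have HtH : H^T *m H = 1%:M by exact: mulmx1C.
have [Y YX] : exists Y : 'M[R]_(1 + n), Y = H *m X *m H^T by eexists.
have Ys : Y^T = Y by rewrite YX !trmx_mul trmxK Xs mulmxA.
have Y0 : delta_mx 0 0 *m Y = l *: delta_mx 0 0 :> 'rV_(1 + n).
  rewrite YX !mulmxA eH ul -scalemxAl -eH -mulmxA HH mulmx1 //.
have Y0j j : Y 0 j = l *+ (j == 0).
  have := congr1 (fun M : 'rV_(1 + n) => M 0 j) Y0.
  rewrite -rowE !mxE => ->; rewrite eqxx /= eq_sym.
  by case: eqP => _; rewrite ?mulr1 ?mulr0.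
pose Y' := drsubmx Y.
have YE : Y = block_mx l%:M 0 0 Y'.
  rewrite -[Y]submxK; congr block_mx.
  - apply/matrixP => i j; rewrite !ord1 !mxE lshift0 Y0j eqxx //.
  - apply/matrixP => i j; rewrite !ord1 !mxE lshift0 Y0j; case: eqP => // /(congr1 val) //.
  - apply/matrixP => i j; rewrite !ord1 !mxE -[Y]Ys mxE lshift0 Y0j.
    by case: eqP => // /(congr1 val).
have subY_sym : Y'^T = Y' by rewrite /Y' trmx_drsub Ys.
have [W [d1 [OO1 YO1]]] := IH _ subY_sym.
pose B : 'M[R]_(1 + n) := block_mx 1%:M 0 0 W.
pose D : 'rV[R]_(1 + n) := row_mx l%:M d1.
have BB : B *m B^T = 1%:M.
  rewrite /B tr_block_mx mulmx_block !trmx0 !mulmx0 !mul0mx trmx1 mulmx1 !addr0 add0r OO1.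
  by rewrite -scalar_mx_block.
have BD : B^T *m diag_mx D *m B = Y.
  rewrite YE YO1 /B /D diag_mx_row tr_block_mx !mulmx_block !trmx0 trmx1.
  rewrite !mulmx0 !mul0mx !mul1mx !addr0 !add0r !mulmx1 ?mulmx0 ?mul0mx.
  by congr block_mx; apply/matrixP => i j; rewrite !ord1 !mxE eqxx.
exists ((B : 'M[R]_n.+1) *m H), D; split.
  by rewrite trmx_mul mulmxA -(mulmxA _ H) HH mulmx1 BB.
have XE : X = H^T *m (Y : 'M[R]_n.+1) *m H.
  by rewrite YX !mulmxA HtH mul1mx -mulmxA HtH mulmx1.
by rewrite XE -[in LHS]BD trmx_mul !mulmxA.
Qed.

End Spectral.

(** * Paraboloids *)

Section Paraboloid.
Variables (R : realType) (n : nat) (f : 'rV[R]_n -> R).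

Lemma ptD (x y : 'rV[R]_n) u v : pt x u + pt y v = pt (x + y) (u + v).
Proof.
by rewrite /pt add_row_mx; congr row_mx; apply/matrixP => i j; rewrite !mxE.
Qed.

Lemma ptZ (x : 'rV[R]_n) u c : c *: pt x u = pt (c *: x) (c * u).
Proof.
by rewrite /pt scale_row_mx; congr row_mx; apply/matrixP => i j; rewrite !mxE.
Qed.

Lemma pt_block (x : 'rV[R]_n) u (O : 'M[R]_n) :
  pt x u *m block_mx O 0 0 1%:M = pt (x *m O) u.
Proof. by rewrite /pt mul_row_block !mulmx0 mulmx1 addr0 add0r. Qed.

Lemma pt_inj (x y : 'rV[R]_n) u v : pt x u = pt y v -> x = y /\ u = v.
Proof.
move=> E; split.
  by have := congr1 (@horiz R n) E; rewrite !horiz_pt.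
by have := congr1 (@height R n) E; rewrite !height_pt.
Qed.

Lemma dotv_pt (x y : 'rV[R]_n) u v : dotv (pt x u) (pt y v) = dotv x y + u * v.
Proof.
rewrite /dotv big_split_ord /=; congr (_ + _).
  by apply: eq_bigr => i _; rewrite !pt_lshift.
by rewrite big_ord_recl big_ord0 addr0 !pt_rshift.
Qed.

(** An orthogonal map fixing the vertical axis diagonalises [X], and completing the square gives the
    translation. Eigenvalues are positive by semidefiniteness and invertibility together. *)
Lemma quadratic_paraboloid (p : 'rV[R]_n) (X : 'M[R]_n) : X^T = X -> X \in unitmx ->
  (forall v, 0 <= dotv v (v *m X)) ->
  (forall v, f v = f 0 + dotv p v + 1 / 2 * dotv v (v *m X)) ->
  elliptic_paraboloid (graph f).
Proof.
move=> Xs Xu psd fE.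
have [U [d [UU XU]]] := spectral_sym Xs.
have UtU : U^T *m U = 1%:M by exact: mulmx1C.
have UX (v : 'rV[R]_n) : v *m U *m X = v *m diag_mx d *m U.
  by rewrite XU !mulmxA -(mulmxA v) UU mulmx1.
have dE v : dotv (v *m U) (v *m U *m X) = \sum_(i < n) d 0 i * v 0 i ^+ 2.
  rewrite UX dotv_orthogonal// /dotv; apply: eq_bigr => i _.
  by rewrite mul_mx_diag mxE; ring.
have d0 i : 0 < d 0 i.
  have di : 0 <= d 0 i.
    have := psd (delta_mx 0 i *m U); rewrite dE (bigD1 i)//= big1 ?addr0.
      by rewrite mxE !eqxx expr1n mulr1.
    by move=> j ji; rewrite mxE (negbTE ji) andbF expr0n mulr0.
  rewrite lt_def di andbT; apply/negP => /eqP di0.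
  have : (delta_mx 0 i : 'rV[R]_n) *m diag_mx d *m U = 0.
    rewrite -rowE row_diag_mx di0 scale0r mul0mx //.
  rewrite -UX.
  move=> /(congr1 (fun M => M *m invmx X *m U^T)) /=.
  rewrite !mul0mx mulmxK// -mulmxA UU mulmx1 => /matrixP/(_ 0 i).
  by rewrite !mxE !eqxx => /eqP; rewrite oner_eq0.
pose c i := Num.sqrt (d 0 i / 2).
have c2 i : c i ^+ 2 = 1 / 2 * d 0 i.
  by rewrite sqr_sqrtr ?divr_ge0 ?(ltW (d0 i))// mulrC mul1r.
(* The critical point of [f]; [z0] is the value of [f] there. *)
pose b := - (p *m invmx X).
pose z0 := f 0 - 1 / 2 * dotv b (b *m X).
have fS v : f v = \sum_(i < n) c i ^+ 2 * ((v - b) *m U^T) 0 i ^+ 2 + z0.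
  have -> : \sum_(i < n) c i ^+ 2 * ((v - b) *m U^T) 0 i ^+ 2 =
      1 / 2 * dotv (v - b) ((v - b) *m X).
    have vy : v - b = (v - b) *m U^T *m U by rewrite -mulmxA UtU mulmx1.
    rewrite [in RHS]vy dE mulr_sumr.
    by apply: eq_bigr => i _; rewrite c2; field.
  have bX : b *m X = - p by rewrite /b mulNmx mulmxKV.
  have vX : dotv b (v *m X) = - dotv p v.
    by rewrite -[in LHS]Xs -dotv_mulmx bX dotvNl.
  by rewrite fE mulmxBl dotvBl !dotvBr vX bX !dotvNr (dotvC v p) /z0 bX dotvNr; field.
exists c; exists (block_mx U 0 0 1%:M : 'M[R]_(n + 1)); exists (pt b z0).
split=> [i|].
  by rewrite sqrtr_gt0 divr_gt0.
split.
  rewrite tr_block_mx mulmx_block !trmx0 !mulmx0 !mul0mx trmx1 mulmx1 UU !addr0 add0r.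
  by rewrite -scalar_mx_block.
rewrite eqEsubset; split => [_ [v _ <-]|_ [_ [x _ <-] <-]].
  exists (pt ((v - b) *m U^T) (\sum_(i < n) c i ^+ 2 * ((v - b) *m U^T) 0 i ^+ 2)).
    by exists ((v - b) *m U^T).
  by rewrite pt_block ptD -mulmxA UtU mulmx1 subrK fS.
exists (x *m U + b) => //.
by rewrite pt_block ptD fS addrK -mulmxA UU mulmx1.
Qed.

Hypothesis n_gt0 : (1 <= n)%N.
Hypothesis fd : forall x, differentiable f x.
Hypothesis fconv : convex_fun f.

(* The rotated axis must be vertical: otherwise every vertical line meets the paraboloid
   in a double root of a concave quadratic, and no point would lie above the paraboloid. *)
Lemma paraboloid_gap : elliptic_paraboloid (graph f) ->
  exists S : 'rV[R]_n -> R, [/\ forall a v, gap f a (a + v) = S v,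
    forall t v, S (t *: v) = t ^+ 2 * S v &
    exists2 m, 0 < m & forall v, m * dotv v v <= S v].
Proof.
move=> [c [Q [b [c0 [QQ graphE]]]]].
have QtQ : Q^T *m Q = 1%:M by exact: mulmx1C.
pose hf (q : 'rV[R]_(n + 1)) := height q - \sum_(i < n) c i ^+ 2 * horiz q 0 i ^+ 2.
have hf0 q : hf q = 0 -> std_paraboloid c q.
  move=> /eqP; rewrite subr_eq0 => /eqP h; exists (horiz q) => //.
  by rewrite -h pt_horiz_height.
have on_graph x z : z = f x <-> hf ((pt x z - b) *m Q^T) = 0.
  split=> [zf|h].
    have : graph f (pt x z) by exists x => //; rewrite zf.
    rewrite graphE => -[_ [y _ <-] <-].
    by rewrite addrK -mulmxA QQ mulmx1 /hf height_pt horiz_pt subrr.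
  have : graph f (pt x z).
    rewrite graphE; exists ((pt x z - b) *m Q^T); first exact: hf0.
    by rewrite -mulmxA QtQ mulmx1 subrK.
  by move=> [y _ /pt_inj[<- <-]].
(* The vertical direction in the coordinates of the standard paraboloid. Along a vertical line [hf]
   is a polynomial of degree at most 2 in the height, with leading coefficient
   [- cb (horiz D) (horiz D)]. *)
pose D := pt 0 1 *m Q^T.
pose q0 x := (pt x 0 - b) *m Q^T.
have qE x z : (pt x z - b) *m Q^T = q0 x + z *: D.
  rewrite /q0 /D scalemxAl -mulmxDl; congr (_ *m _).
  by rewrite ptZ scaler0 mulr1 addrAC ptD addr0 add0r.
have horizD u v : horiz (u + v) = horiz u + horiz v :> 'rV[R]_n by rewrite /horiz linearD.
have horizZ t v : horiz (t *: v) = t *: horiz v :> 'rV[R]_n by rewrite /horiz linearZ.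
have heightD u v : height (u + v) = @height R n u + height v by rewrite /height linearD mxE.
have heightZ t v : height (t *: v) = t * @height R n v by rewrite /height linearZ mxE.
pose cb (u v : 'rV[R]_n) := \sum_(i < n) c i ^+ 2 * (u 0 i * v 0 i) : R.
have cbE q : hf q = height q - cb (horiz q) (horiz q).
  by rewrite /hf /cb; congr (_ - _); apply: eq_bigr => i _; rewrite expr2.
have cbC (u v : 'rV[R]_n) : cb u v = cb v u.
  by apply: eq_bigr => i _; rewrite (mulrC (u 0 i)).
have cbDr (u v w : 'rV[R]_n) : cb u (v + w) = cb u v + cb u w.
  by rewrite /cb -big_split; apply: eq_bigr => i _; rewrite mxE /=; ring.
have cbZr t (u v : 'rV[R]_n) : cb u (t *: v) = t * cb u v.
  by rewrite /cb mulr_sumr; apply: eq_bigr => i _; rewrite mxE; ring.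
have cb_line (u v : 'rV[R]_n) t : cb (u + t *: v) (u + t *: v) = cb u u + 2 * t * cb u v + t ^+ 2 * cb v v.
  rewrite cbDr (cbC (u + _) u) (cbC (u + _) (t *: v)) !cbDr (cbC (t *: v) u) !cbZr.
  by rewrite (cbC (t *: v) v) cbZr; ring.
have cb_ge0 (u : 'rV[R]_n) : 0 <= cb u u.
  by apply: sumr_ge0 => i _; rewrite mulr_ge0// -?expr2 sqr_ge0.
have [mu mu0 cb_lower] : exists2 m, 0 < m & forall v, m * dotv v v <= cb v v.
  pose s := 1 + \sum_(i < n) (c i ^+ 2)^-1.
  have s0 : 0 < s.
    by rewrite ltr_pwDl// sumr_ge0// => i _; rewrite invr_ge0 sqr_ge0.
  exists s^-1; first by rewrite invr_gt0.
  move=> v; rewrite /cb /dotv mulr_sumr; apply: ler_sum => i _.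
  rewrite ler_wpM2r -?expr2 ?sqr_ge0//.
  have ci : 0 < c i ^+ 2 by rewrite exprn_gt0.
  rewrite -[leRHS]invrK lef_pV2 ?posrE ?invr_gt0//.
  rewrite /s (bigD1 i)//=.
  have : 0 <= \sum_(j < n | j != i) (c j ^+ 2)^-1.
    by rewrite sumr_ge0// => j _; rewrite invr_ge0 sqr_ge0.
  lra.
have hfq x z : hf (q0 x + z *: D) = hf (q0 x) + z * (height D - 2 * cb (horiz (q0 x)) (horiz D))
    - z ^+ 2 * cb (horiz D) (horiz D).
  by rewrite !cbE horizD horizZ heightD heightZ cb_line; ring.
have Dh0 : horiz D = 0.
  have [A0|A0] := eqVneq (cb (horiz D) (horiz D)) 0.
    apply: dotv_eq0; apply/eqP; rewrite eq_le dotv_ge0 andbT.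
    by rewrite -(pmulr_rle0 _ mu0) -A0.
  have Ap : 0 < cb (horiz D) (horiz D) by rewrite lt_def A0 cb_ge0.
  exfalso; set A := cb _ _ in A0 Ap hfq.
  have neg x z : hf (q0 x + z *: D) <= 0.
    set B := height D - 2 * cb (horiz (q0 x)) (horiz D).
    have r0 : hf (q0 x + f x *: D) = 0 by rewrite -qE; apply/on_graph.
    (* By Vieta the left-hand side is the second root on the vertical line over [x]; the line meets
       the graph only once, so the root is double. *)
    have EB : f x + (B - 2 * A * f x) / A = f x.
      apply/(on_graph x); rewrite qE; move: r0; rewrite !hfq -/B => r0.
      have -> : hf (q0 x) = - (f x * B) + f x ^+ 2 * A by lra.
      by field.
    have BA : B = 2 * A * f x.
      have : (B - 2 * A * f x) / A = 0 by lra.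
      by move/eqP; rewrite mulf_eq0 invr_eq0 (negbTE A0) orbF subr_eq0 => /eqP.
    move: r0; rewrite !hfq -/B BA => r0.
    have -> : hf (q0 x) = - (f x ^+ 2 * A) by lra.
    have := mulr_ge0 (ltW Ap) (sqr_ge0 (z - f x)); rewrite !expr2; lra.
  (* The point with standard coordinates [(0, 1)] has [hf] equal to 1, a contradiction. *)
  have := neg (horiz (pt 0 1 *m Q + b)) (height (pt 0 1 *m Q + b)).
  rewrite -qE pt_horiz_height addrK -mulmxA QQ mulmx1 /hf height_pt horiz_pt.
  by rewrite big1 ?subr0 ?ler10// => i _; rewrite mxE expr0n mulr0.
have QtQtt : Q^T *m Q^T^T = 1%:M by rewrite trmxK.
pose dz := height D.
have DE : D = pt 0 dz by rewrite -Dh0 pt_horiz_height.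
have dz2 : dz ^+ 2 = 1.
  have := dotv_orthogonal (pt 0 1) (pt 0 1) QtQtt.
  by rewrite -/D DE !dotv_pt dotv0l !add0r mulr1 expr2.
pose V v := horiz (pt v 0 *m Q^T) : 'rV[R]_n.
have VE v : pt v 0 *m Q^T = pt (V v) 0.
  rewrite -[LHS]pt_horiz_height; congr pt.
  have := dotv_orthogonal (pt v 0) (pt 0 1) QtQtt.
  rewrite -/D DE -[X in dotv X _ = _]pt_horiz_height !dotv_pt !dotv0r mul0r !add0r => h.
  have : height (pt v 0 *m Q^T) * dz ^+ 2 = 0 by rewrite expr2 mulrA h mul0r.
  by rewrite dz2 mulr1.
have VV v : dotv (V v) (V v) = dotv v v.
  have := dotv_orthogonal (pt v 0) (pt v 0) QtQtt.
  by rewrite !VE !dotv_pt mulr0 !addr0.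
have VZ t v : V (t *: v) = t *: V v.
  have := VE (t *: v); have -> : pt (t *: v) 0 = t *: pt v 0 by rewrite ptZ mulr0.
  by rewrite -scalemxAl VE ptZ => /pt_inj[].
have fE x : f x = - dz * hf (q0 x).
  have := (on_graph x (f x)).1 erefl; rewrite qE hfq Dh0.
  have cb0 (u : 'rV[R]_n) : cb u 0 = 0 by rewrite -(scale0r 0) cbZr mul0r.
  rewrite !cb0 -/dz => h.
  have : dz * (hf (q0 x) + f x * (dz - 2 * 0) - f x ^+ 2 * 0) = 0 by rewrite h mulr0.
  have -> : dz * (hf (q0 x) + f x * (dz - 2 * 0) - f x ^+ 2 * 0) = dz * hf (q0 x) + f x * dz ^+ 2 by ring.
  by rewrite dz2; lra.
have q0D a v : q0 (a + v) = q0 a + pt (V v) 0.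
  rewrite /q0 -VE -mulmxDl; congr (_ *m _).
  by rewrite addrAC ptD addr0.
have f_line a v t : f (a + t *: v) = f a + t * (2 * dz * cb (horiz (q0 a)) (V v)) +
    t ^+ 2 * (dz * cb (V v) (V v)).
  rewrite !fE q0D !cbE horizD heightD horiz_pt height_pt VZ cb_line; ring.
have gap_line a v : gap f a (a + v) = dz * cb (V v) (V v).
  pose L := 2 * dz * cb (horiz (q0 a)) (V v) - dotv (grad f a) v.
  pose s := dz * cb (V v) (V v).
  have gt t : gap f a (a + t *: v) = t * L + t ^+ 2 * s.
    rewrite gapE f_line [a + _ - a]addrAC subrr add0r dotvZr /L /s; ring.
  have L0 : L = 0.
    have h t : 0 <= t * L + t ^+ 2 * s by rewrite -gt gap_ge0.
    have s1 : 0 < `|s| + 1 by rewrite ltr_wpDl.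
    apply/eqP; rewrite -normr_le0 leNgt; apply/negP => Lp.
    (* A nonzero linear coefficient would make the gap negative at this multiple of [v]; so the
       linear part of [f] along [v] is that of the tangent plane. *)
    have := h (- L / (`|s| + 1)).
    have L2 : 0 < L ^+ 2 by rewrite lt_def sqr_ge0 sqrf_eq0 -normr_gt0 Lp.
    have -> : - L / (`|s| + 1) * L + (- L / (`|s| + 1)) ^+ 2 * s =
        - (L ^+ 2 * (`|s| + 1 - s) / (`|s| + 1) ^+ 2) by field; rewrite gt_eqF.
    rewrite oppr_ge0 leNgt => /negP; apply.
    rewrite divr_gt0 ?exprn_gt0// mulr_gt0//.
    by have := ler_norm s; lra.
  by have := gt 1; rewrite scale1r L0 mulr0 add0r expr1n mul1r.
(* For [dz = -1] the paraboloid opens downwards and the gap would be negative at a unit vector,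
   which exists since [n >= 1]. *)
have dz1 : dz = 1.
  pose v : 'rV[R]_n := delta_mx 0 (Ordinal n_gt0).
  have vv : dotv v v = 1 by rewrite dotv_delta mxE !eqxx.
  have cv : 0 < cb (V v) (V v).
    by apply: lt_le_trans (cb_lower _); rewrite VV vv mulr1.
  have := gap_ge0 fd fconv 0 (0 + v); rewrite gap_line pmulr_lge0// => dzp.
  by move/eqP: dz2; rewrite sqrf_eq1 => /orP[/eqP//|/eqP h]; move: dzp; rewrite h; lra.
exists (fun v => cb (V v) (V v)); split.
- by move=> a v; rewrite gap_line dz1 mul1r.
- by move=> t v; rewrite VZ cbZr cbC cbZr mulrA expr2.
- by exists mu => // v; rewrite -VV.
Qed.

End Paraboloid.

(** * Volumes and areas when the gap is homogeneous of degree 2 *)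

Section QuadraticVolumes.
Variables (R : realType) (n : nat) (f : 'rV[R]_n -> R).
Hypothesis fd : forall x, differentiable f x.
Hypothesis fconv : convex_fun f.
Variables (S : 'rV[R]_n -> R) (m : R).
Hypothesis gapS : forall a v, gap f a (a + v) = S v.
Hypothesis SZ : forall t v, S (t *: v) = t ^+ 2 * S v.
Hypothesis m_gt0 : 0 < m.
Hypothesis S_lower : forall v, m * dotv v v <= S v.

Lemma quadratic_bounded a k : 0 < k -> bounded_sublevel f a k.
Proof.
move=> k0; exists (k / m + 1 + `|a|) => x gx.
have km : 0 <= k / m by rewrite divr_ge0 ?ltW.
suff xa : `|x - a| <= k / m + 1.
  by have := ler_normD (x - a) a; rewrite subrK; lra.
have vv : dotv (x - a) (x - a) <= k / m.
  rewrite ler_pdivlMr// mulrC; apply: le_trans (S_lower _) _.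
  by rewrite -(gapS a) subrKC.
apply/mx_norm_leP; first by lra.
move=> i j; rewrite (ord1 i) leNgt; apply/negP => big.
have e2 : (x - a) 0 j ^+ 2 <= k / m.
  apply: le_trans vv; rewrite /dotv (bigD1 j)//= -expr2 lerDl.
  by apply: sumr_ge0 => l _; rewrite -expr2 sqr_ge0.
rewrite -real_normK ?num_real// in e2.
have : (k / m + 1) * (k / m + 1) <= `|(x - a) 0 j| ^+ 2.
  by rewrite expr2 ler_pM ?(ltW big)//; lra.
have : 0 <= (k / m) * (k / m) by exact: mulr_ge0.
move: (k / m) km e2 => q; lra.
Qed.

Let Psi k := J (fun v => ramp1 (k - S v)).

Lemma Phi1_quadratic a k : Phi1 f a k = Psi k.
Proof.
rewrite /Phi1 -(J_shift a (cc_ramp1 fd quadratic_bounded a k)); congr J.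
by apply/funext => v; rewrite gapS.
Qed.

Lemma cc_Psi k : cc (fun v => ramp1 (k - S v)).
Proof.
have := cc_ramp1 fd quadratic_bounded 0 k.
by under eq_fun do rewrite -{1}[X in gap f 0 X]add0r gapS.
Qed.

Lemma Psi_ge0 k : 0 <= Psi k.
Proof. by apply: J_ge0 => v; exact: ramp1_ge0. Qed.

(** Heights are written as squares so that the power (n + 2) / 2 of the height becomes an ordinary
    power of [r]. *)
Lemma Psi_sqr r : 0 < r -> Psi (r ^+ 2) = r ^+ n.+2 * Psi 1.
Proof.
move=> r0; have := J_affine 0 r0 (cc_Psi (r ^+ 2)); rewrite -/(Psi _) => E.
have {E} : r ^+ n * (r ^+ 2 * Psi 1) = Psi (r ^+ 2).
  rewrite -JZ; last exact: cc_Psi.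
  have -> : (fun v => r ^+ 2 * ramp1 (1 - S v)) =
      (fun v : 'rV[R]_n => ramp1 (r ^+ 2 - S (0 + r *: v))).
    by apply/funext => v; rewrite add0r SZ -ramp1Z ?sqr_ge0//; congr ramp1; ring.
  by rewrite E mulrA mulfV ?mul1r// expf_neq0// gt_eqF.
by move=> <-; rewrite mulrA -exprD addn2.
Qed.

Lemma exprS_sub_bounds (x y : R) N : 0 <= x -> x <= y ->
  N.+1%:R * (y - x) * x ^+ N <= y ^+ N.+1 - x ^+ N.+1 <= N.+1%:R * (y - x) * y ^+ N.
Proof.
move=> x0 xy; have y0 : 0 <= y by lra.
have yx : 0 <= y - x by lra.
elim: N => [|N /andP[lo up]]; first by rewrite !expr0 !expr1; lra.
have xyN : x ^+ N.+1 <= y ^+ N.+1 by rewrite lerXn2r.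
have h : (y - x) * x ^+ N.+1 <= (y - x) * y ^+ N.+1 by rewrite ler_wpM2l.
rewrite -[in X in X <= _]natr1 -[in X in _ && (_ <= X)]natr1; apply/andP; split.
  have := ler_wpM2l x0 lo.
  have -> : x * (N.+1%:R * (y - x) * x ^+ N) = N.+1%:R * (y - x) * x ^+ N.+1.
    by rewrite exprS; ring.
  rewrite !(exprS _ N.+1); lra.
have := ler_wpM2l y0 up.
have -> : y * (N.+1%:R * (y - x) * y ^+ N) = N.+1%:R * (y - x) * y ^+ N.+1.
  by rewrite exprS; ring.
rewrite !(exprS _ N.+1); lra.
Qed.

(** With respect to [r ^+ 2], the function [r ^+ n.+2] has derivative [(n + 2) / 2 * r ^+ n]; this
    is its finite form, from [y ^+ 2 - x ^+ 2 = (y - x) * (y + x)] and [2 * x <= y + x <= 2 * y]. *)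
Lemma Psi_slope_bounds (x y : R) : 0 < x -> x < y ->
  Psi 1 * n.+2%:R * x ^+ n.+1 / (2 * y) <= (Psi (y ^+ 2) - Psi (x ^+ 2)) / (y ^+ 2 - x ^+ 2)
    <= Psi 1 * n.+2%:R * y ^+ n.+1 / (2 * x).
Proof.
move=> x0 xy; have y0 : 0 < y by lra.
have yx0 : 0 < y - x by lra.
have P0 := Psi_ge0 1.
have sq : y ^+ 2 - x ^+ 2 = (y - x) * (y + x) by ring.
have yxp : 0 < y + x by lra.
rewrite !Psi_sqr// -mulrBl sq.
have /andP[lo up] := exprS_sub_bounds n.+1 (ltW x0) (ltW xy).
have xn : 0 <= x ^+ n.+1 by rewrite exprn_ge0// ltW.
have yn : 0 <= y ^+ n.+1 by rewrite exprn_ge0// ltW.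
have q0 : 0 <= Psi 1 * n.+2%:R by rewrite mulr_ge0.
rewrite ler_pdivlMr ?mulr_gt0// [X in _ && X]ler_pdivrMr ?mulr_gt0//.
apply/andP; split.
- apply: le_trans (_ : n.+2%:R * (y - x) * x ^+ n.+1 * Psi 1 <= _); last by rewrite ler_wpM2r.
  have -> : Psi 1 * n.+2%:R * x ^+ n.+1 / (2 * y) * ((y - x) * (y + x)) =
    n.+2%:R * (y - x) * x ^+ n.+1 * Psi 1 * ((y + x) / (2 * y)) by field; rewrite gt_eqF.
  rewrite ler_piMr//; first by rewrite !mulr_ge0// ltW.
  by rewrite ler_pdivrMr ?mulr_gt0//; lra.
- apply: le_trans (_ : n.+2%:R * (y - x) * y ^+ n.+1 * Psi 1 <= _); first by rewrite ler_wpM2r.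
  have -> : Psi 1 * n.+2%:R * y ^+ n.+1 / (2 * x) * ((y - x) * (y + x)) =
    n.+2%:R * (y - x) * y ^+ n.+1 * Psi 1 * ((y + x) / (2 * x)) by field; rewrite gt_eqF.
  rewrite ler_peMr//; first by rewrite !mulr_ge0// ltW.
  by rewrite ler_pdivlMr ?mulr_gt0//; lra.
Qed.

(** [Astar_slope] squeezes the area between difference quotients of [Psi] towards the heights
    [(r * (1 + tau)) ^+ 2] and [(r * (1 - tau)) ^+ 2]; both tend to the derivative as [tau] tends to
    0. *)
Lemma Astar_quadratic a r : 0 < r ->
  Astar f a (r ^+ 2) = (Wfun f a * (1 / 2 * Psi 1 * n.+2%:R * r ^+ n))%:E.
Proof.
move=> r0; set T := 1 / 2 * Psi 1 * n.+2%:R * r ^+ n.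
have W0 := Wfun_gt0 f a; have P0 := Psi_ge0 1.
have T0 : 0 <= T by rewrite /T !mulr_ge0// exprn_ge0// ltW.
have slope s t : s < t -> _ := Astar_slope fd quadratic_bounded a (s := s) (t := t).
have up tau : 0 < tau <= 1 -> (Astar f a (r ^+ 2) <= (Wfun f a * (T * (1 + 2 ^+ n.+1 * tau)))%:E)%E.
  move=> /andP[t0 t1].
  have ry : r < r * (1 + tau) by rewrite ltr_pMr//; lra.
  have ry2 : r ^+ 2 < (r * (1 + tau)) ^+ 2 by rewrite ltrXn2r ?nnegrE ?ltW//; lra.
  have [h _] := slope _ _ ry2; apply: le_trans h _; rewrite lee_fin ler_pM2l// !Phi1_quadratic.
  have /andP[_ h] := Psi_slope_bounds r0 ry; apply: le_trans h _.
  have -> : Psi 1 * n.+2%:R * (r * (1 + tau)) ^+ n.+1 / (2 * r) = T * (1 + tau) ^+ n.+1.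
    by rewrite /T exprMn exprS; field; rewrite gt_eqF.
  rewrite ler_wpM2l//; apply: le_trans (expr1D_le _ _) _; first by rewrite ltW.
  by rewrite lerD2l ler_wpM2r ?(ltW t0)// gerBl.
have lo tau : 0 < tau < 1 -> ((Wfun f a * (T * (1 - n.+1%:R * tau)))%:E <= Astar f a (r ^+ 2))%E.
  move=> /andP[t0 t1].
  have x0 : 0 < r * (1 - tau) by rewrite mulr_gt0// subr_gt0.
  have xr : r * (1 - tau) < r by rewrite gtr_pMr//; lra.
  have xr2 : (r * (1 - tau)) ^+ 2 < r ^+ 2 by rewrite ltrXn2r ?nnegrE ?ltW.
  have [_ h] := slope _ _ xr2; apply: le_trans h; rewrite lee_fin ler_pM2l// !Phi1_quadratic.
  have /andP[h _] := Psi_slope_bounds x0 xr; apply: le_trans h.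
  have -> : Psi 1 * n.+2%:R * (r * (1 - tau)) ^+ n.+1 / (2 * r) = T * (1 - tau) ^+ n.+1.
    by rewrite /T exprMn exprS; field; rewrite gt_eqF.
  rewrite ler_wpM2l//.
  have /andP[_ h] := @exprS_sub_bounds (1 - tau) 1 n (ltac:(lra)) (ltac:(lra)).
  by move: h; rewrite !expr1n mulr1 (_ : 1 - (1 - tau) = tau); [lra|ring].
(* One upper and one lower bound already make the area a real number. *)
have := up 1; have := lo (1 / 2); rewrite ltr01 lexx /=.
case E : (Astar f a (r ^+ 2)) => [c| |]; last 2 first.
- by move=> _ /(_ isT); rewrite leNgt ltry.
- by move=> /(_ _)/[swap] _; rewrite leNgt ltNyr => h; have := h (ltac:(lra)).
move=> _ _; congr (_%:E).
pose M := Wfun f a * T * (2 ^+ n.+1 + n.+1%:R).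
have M0 : 0 <= M by rewrite !mulr_ge0 ?addr_ge0 ?exprn_ge0// ltW.
have WT0 : 0 <= Wfun f a * T by rewrite mulr_ge0// ltW.
have close tau : 0 < tau < 1 -> `|c - Wfun f a * T| <= M * tau.
  move=> /andP[t0 t1].
  have := up tau; have := lo tau; rewrite E !lee_fin t0 t1 (ltW t1) => /(_ isT) h1 /(_ isT) h2.
  have h3 : 0 <= Wfun f a * T * (2 ^+ n.+1 * tau) by rewrite mulr_ge0// mulr_ge0 ?exprn_ge0// ltW.
  have h4 : 0 <= Wfun f a * T * (n.+1%:R * tau) by rewrite mulr_ge0// mulr_ge0// ltW.
  by rewrite ler_norml /M; apply/andP; split; lra.
apply/eqP; rewrite -subr_eq0 -normr_le0 leNgt; apply/negP => D0.
set D := `|_| in D0 close.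
(* Below 1, and small enough for [M * tau < D]. *)
pose tau := D / (2 * (M + 1 + D)).
have q0 : 0 < 2 * (M + 1 + D) by lra.
have := close tau; rewrite /tau divr_gt0// ltr_pdivrMr// => h.
have := h (ltac:(lra)); rewrite mulrA ler_pdivlMr//.
have : 0 <= M * D by rewrite mulr_ge0// ltW.
have : 0 < D * D by rewrite mulr_gt0.
lra.
Qed.

End QuadraticVolumes.

(** * Paraboloids and the conditions on volumes and areas *)

Section Characterization.
Variables (R : realType) (n : nat) (f : 'rV[R]_n -> R).
Hypothesis fd : forall x, differentiable f x.
Hypothesis fconv : convex_fun f.

Lemma paraboloid_of_Phi1 : (forall a k, 0 < k -> bounded_sublevel f a k) ->
  (forall a b k, 0 < k -> Phi1 f a k = Phi1 f b k) -> elliptic_paraboloid (graph f).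
Proof.
move=> bdd P1; have P3 := Phi3_eq_of_Phi1 fd fconv bdd P1.
have [X [Xs Xu fE]] := quadratic_of_Phi3 fd fconv bdd P3 0.
apply: (@quadratic_paraboloid _ _ f (grad f 0) X) => // v.
  have := gap_ge0 fd fconv 0 v; rewrite gapE subr0 -[in f v](add0r v) fE; lra.
by rewrite -fE add0r.
Qed.

Lemma paraboloid_Vstar : (1 <= n)%N -> elliptic_paraboloid (graph f) ->
  exists phi : R -> R, (forall k, 0 <= phi k) /\
    forall (a : 'rV[R]_n) (k : R), 0 < k -> Vstar f a k = (phi k)%:E.
Proof.
move=> n0 /(paraboloid_gap n0 fd fconv)[S [gapS SZ [m m0 Sm]]].
exists (fun k => J (fun v => ramp1 (k - S v))); split.
  by move=> k; apply: J_ge0 => v; exact: ramp1_ge0.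
have bdd := quadratic_bounded gapS m0 Sm.
by move=> a k k0; rewrite Vstar_Phi1// (Phi1_quadratic fd gapS m0 Sm).
Qed.

Lemma paraboloid_Astar : (1 <= n)%N -> elliptic_paraboloid (graph f) ->
  exists psi : R -> R, (forall k, 0 <= psi k) /\
    forall (a : 'rV[R]_n) (k : R), 0 < k ->
      (Astar f a k * ((Wfun f a)^-1)%:E)%E = (psi k)%:E.
Proof.
move=> n0 /(paraboloid_gap n0 fd fconv)[S [gapS SZ [m m0 Sm]]].
exists (fun k => 1 / 2 * J (fun v => ramp1 (1 - S v)) * n.+2%:R * Num.sqrt k ^+ n); split.
  move=> k; rewrite !mulr_ge0 ?exprn_ge0 ?sqrtr_ge0//.
  by apply: J_ge0 => v; exact: ramp1_ge0.
move=> a k k0; rewrite -{1}(sqr_sqrtr (ltW k0)).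
rewrite (Astar_quadratic fd gapS SZ m0 Sm) ?sqrtr_gt0// -EFinM; congr (_%:E).
by rewrite mulrAC mulfV ?mul1r// gt_eqF// Wfun_gt0.
Qed.

End Characterization.

Theorem theorem5 (R : realType) (n : nat) (f : 'rV[R]_n -> R) :
  (1 <= n)%N -> smooth f -> convex_fun f ->
  (elliptic_paraboloid (graph f) <->
     exists phi : R -> R, (forall k, 0 <= phi k) /\
       forall (a : 'rV[R]_n) (k : R), 0 < k -> Vstar f a k = (phi k)%:E)
  /\
  (elliptic_paraboloid (graph f) <->
     exists psi : R -> R, (forall k, 0 <= psi k) /\
       forall (a : 'rV[R]_n) (k : R), 0 < k ->
         (Astar f a k * ((Wfun f a)^-1)%:E)%E = (psi k)%:E).
Proof.
move=> n0 fs fconv; have fd x : differentiable f x := fs [::] x.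
split; split.
- exact: paraboloid_Vstar.
- move=> [phi [_ V]]; have bdd a k (k0 : 0 < k) := bounded_sublevel_V fd fconv k0 (V a k k0).
  exact: (paraboloid_of_Phi1 fd fconv bdd (Phi1_eq_of_Vstar fd bdd V)).
- exact: paraboloid_Astar.
- move=> [psi [_ A]].
  have A' a k : 0 < k -> Astar f a k = (Wfun f a * psi k)%:E.
    move=> k0; have W0 := Wfun_gt0 f a.
    rewrite -[LHS]mule1 -(mulVf (lt0r_neq0 W0)) EFinM muleA A//.
    by rewrite -EFinM mulrC.
  have bdd a k (k0 : 0 < k) := bounded_sublevel_A fd fconv k0 (A' a k k0).
  exact: (paraboloid_of_Phi1 fd fconv bdd (Phi1_eq_of_Astar fd fconv bdd A')).
Qed.
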